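(* Let $k\geq 0$, $n\geq 1$ be integers, let $U\subset\mathbb{C}$ be a bounded planar domain, and let the boundary $\Gamma$ of $U$ be of class $\mathcal{C}^{nk+n+1}$. Let $$\Lambda_n = \begin{cases} n! & \text{if } n\leq 3,\\ \frac{3}{2}\, n! & \text{if } n>3.\end{cases}$$ Then, for $0<\alpha<1$, the symmetrized Cauchy transform $\mathcal{E}_n$ is continuous from the space $\mathcal{C}^{(k+1)n-1,\alpha}(\Gamma)$ to the space $\mathcal{A}^{k,\frac{\alpha}{\Lambda_n}}(\Sigma^n U)$.
   Context: Symmetrization map: $\pi:\mathbb{C}^n\to\mathbb{C}^n$, $\pi(z)=(\pi_1(z),\dots,\pi_n(z))$, where $\pi_j$ is the $j$-th elementary symmetric polynomial in $n$ variables. For a bounded domain $U\subset\mathbb{C}$, $\Sigma^nU=\pi(U^n)$, a bounded domain in $\mathbb{C}^n$; equivalently, $\Sigma^nU$ is the set of $z\in\mathbb{C}^n$ such that all roots in $t$ of $$q_n(z,t)=t^n-z_1t^{n-1}+z_2t^{n-2}-\dots+(-1)^nz_n$$ lie in $U$. The symmetrized Cauchy transform $\mathcal{E}_n$ maps a continuous function $\phi$ on $\Gamma=\partial U$ (positively oriented as the boundary of $U$) to the holomorphic function on $\Sigma^nU$ given by $$\mathcal{E}_n\phi(z)=\frac{1}{2\pi i}\int_\Gamma\frac{\phi(t)}{q_n(z,t)}\,dt,\qquad z\in\Sigma^nU.$$ For an integer $m\ge0$ and $0<\alpha<1$, $\mathcal{C}^{m,\alpha}(\Gamma)$ is the Banach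 space of functions on the curve $\Gamma$ that are $m$ times continuously differentiable with respect to arc length and whose $m$-th derivative is Hölder continuous of order $\alpha$, with norm $\|\phi\|_{\mathcal{C}^{m,\alpha}(\Gamma)}=\sum_{j=0}^m\|\phi^{(j)}\|_\infty+|\phi^{(m)}|_\alpha$, where derivatives are with respect to arc length and $|\psi|_\alpha=\sup_{s\ne s'}\frac{|\psi(s)-\psi(s')|}{|s-s'|^\alpha}$. For a bounded domain $\Omega\subset\mathbb{C}^n$, an integer $k\ge0$ and $0<\beta<1$, or $\beta = \alpha/\Lambda_n$ in particular, $\mathcal{A}^{k,\beta}(\Omega)=\mathcal{O}(\Omega)\cap\mathcal{C}^{k,\beta}(\Omega)$ is the space of holomorphic functions $\Phi$ on $\Omega$ with finite norm $$\|\Phi\|_{\mathcal{C}^{k,\beta}(\Omega)}=\sum_{|\gamma|\le k}\|\partial^\gamma\Phi\|_\infty+\sum_{|\gamma|=k}|\partial^\gamma\Phi|_\beta,$$ where $\gamma$ ranges over multi-indices in $\mathbb{N}^n$, $\partial^\gamma=(\partial/\partial z_1)^{\gamma_1}\cdots(\partial/\partial z_n)^{\gamma_n}$, $\|\cdot\|_\infty$ is the supremum norm on $\Omega$, and $|\Psi|_\beta=\sup_{z\ne w}\frac{|\Psi(z)-\Psi(w)|}{|z-w|^\beta}$. *)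

(* Defs.v *)
From HB Require Import structures.
From mathcomp Require Import all_boot all_order all_algebra.
From mathcomp Require Import all_classical all_reals all_analysis.
From mathcomp Require Import complex.
Set Implicit Arguments.
Unset Strict Implicit.
Unset Printing Implicit Defensive.
Import Order.TTheory GRing.Theory Num.Theory.
Import numFieldTopology.Exports numFieldNormedType.Exports.
Local Open Scope classical_set_scope.
Local Open Scope ring_scope.
Local Open Scope complex_scope.

(* [R[i]] as a normed space over itself, so that [differentiable] and ['D_v]
   on ['rV[R[i]]_n] are the complex ones. *)
HB.instance Definition _ (R : realType) := NormedModule.copy R[i] R[i]^o.

(* The norm [`|z|] takes its values in [R[i]]; this is the real-valued one. *)
Notation normc := ComplexField.Normc.normc.

Section RealVariable.
Variable R : realType.
Implicit Types (m : nat) (f : R -> R[i]).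

Definition Cm_real m (f : R -> R) : Prop :=
  (forall i, (i < m)%N -> forall s, derivable (f^`(i))%classic s 1) /\
  continuous (f^`(m))%classic.

Definition Cm m f : Prop :=
  Cm_real m (fun s => complex.Re (f s)) /\ Cm_real m (fun s => complex.Im (f s)).

Definition nderive m f (s : R) : R[i] :=
  ((fun u => complex.Re (f u))^`(m))%classic s +i*
  ((fun u => complex.Im (f u))^`(m))%classic s.

Definition cintegral (a b : R) f : R[i] :=
  (\int[lebesgue_measure]_(s in `[a, b]) complex.Re (f s)) +i*
  (\int[lebesgue_measure]_(s in `[a, b]) complex.Im (f s)).

End RealVariable.

(* The boundary of the open set [U] is of class C^m: it is a disjoint union of
   finitely many simple closed curves of class C^m, and [U] lies locally on
   exactly one side of it.  The curves are parametrized by arc length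
   (periodically over the whole line) and oriented so that [U] is on the left,
   which is the positive orientation of the boundary. *)
Record smooth_boundary (R : realType) (U : set R[i]) (m : nat) := SmoothBoundary {
  ncurves : nat;
  len : 'I_ncurves -> R;
  curve : 'I_ncurves -> R -> R[i];
  len_gt0 : forall j, 0 < len j;
  curve_periodic : forall j s, curve j (s + len j) = curve j s;
  curve_inj : forall j j' s s', 0 <= s < len j -> 0 <= s' < len j' ->
    curve j s = curve j' s' -> j = j' /\ s = s';
  curve_boundary : \bigcup_j range (curve j) = closure U `\` interior U;
  curve_Cm : forall j, Cm m (curve j);
  curve_unit_speed : forall j s, normc (nderive 1 (curve j) s) = 1;
  curve_left : forall j s, \forall e \near (0 : R)^'+,
    U (curve j s + e%:C * 'i%C * nderive 1 (curve j) s);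
  curve_right : forall j s, \forall e \near (0 : R)^'+,
    ~ closure U (curve j s - e%:C * 'i%C * nderive 1 (curve j) s)
}.
Arguments ncurves {R U m} _.
Arguments len {R U m} _ _.
Arguments curve {R U m} _ _ _.

Section Seminorms.
Variables (R : realType) (T : Type).
Implicit Types (D : set T) (psi : T -> R[i]).

Definition sup_norm D psi : \bar R :=
  ereal_sup [set (normc (psi x))%:E | x in D].

Definition holder_seminorm (dist : T -> T -> R) D (beta : R) psi : \bar R :=
  ereal_sup [set (normc (psi p.1 - psi p.2) / dist p.1 p.2 `^ beta)%:E
            | p in [set p : T * T | [/\ D p.1, D p.2 & 0 < dist p.1 p.2]]].

End Seminorms.

Section BoundarySpaces.
Variables (R : realType) (U : set R[i]) (l : nat) (G : smooth_boundary U l).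
Implicit Types (m : nat) (alpha : R) (phi : R[i] -> R[i]).

(* A function on the boundary is the restriction of a [phi : R[i] -> R[i]]
   (only its values on the boundary matter below).  Points of the boundary are
   represented by pairs (index of a curve, arc-length parameter on it). *)
Definition bpoint (p : 'I_(ncurves G) * R) : R[i] := curve G p.1 p.2.

Definition bdist (p p' : 'I_(ncurves G) * R) : R := normc (bpoint p - bpoint p').

Definition arc_derive m phi (p : 'I_(ncurves G) * R) : R[i] :=
  nderive m (fun s => phi (curve G p.1 s)) p.2.

Definition bnorm m alpha phi : \bar R :=
  (\sum_(j < m.+1) sup_norm setT (arc_derive j phi) +
   holder_seminorm bdist setT alpha (arc_derive m phi))%E.

Definition bspace m alpha : set (R[i] -> R[i]) :=
  [set phi | (forall j, Cm m (fun s => phi (curve G j s))) /\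
             (bnorm m alpha phi < +oo)%E].

End BoundarySpaces.

Section HolomorphicSpaces.
Variables (R : realType) (n : nat).
Implicit Types (Omega : set 'rV[R[i]]_n) (Phi : 'rV[R[i]]_n -> R[i]).
Implicit Types (k : nat) (beta : R).

Definition euclidean_dist (z w : 'rV[R[i]]_n) : R :=
  Num.sqrt (\sum_(i < n) normc (z 0 i - w 0 i) ^+ 2).

Definition holomorphic_on Omega Phi : Prop :=
  forall z, Omega z -> differentiable Phi z.

Definition partial (i : 'I_n) Phi : 'rV[R[i]]_n -> R[i] :=
  fun z => 'D_(delta_mx 0 i) Phi z.

Definition mpartial (g : 'I_n -> nat) Phi : 'rV[R[i]]_n -> R[i] :=
  foldr (fun i Psi => iter (g i) (partial i) Psi) Phi (enum 'I_n).

(* The multi-indices of length at most [k] have entries at most [k]. *)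
Definition hnorm Omega k beta Phi : \bar R :=
  (\sum_(g : {ffun 'I_n -> 'I_k.+1} | (\sum_(i < n) g i <= k)%N)
     sup_norm Omega (mpartial (fun i => g i) Phi) +
   \sum_(g : {ffun 'I_n -> 'I_k.+1} | (\sum_(i < n) g i == k)%N)
     holder_seminorm euclidean_dist Omega beta (mpartial (fun i => g i) Phi))%E.

Definition hspace Omega k beta : set ('rV[R[i]]_n -> R[i]) :=
  [set Phi | holomorphic_on Omega Phi /\ (hnorm Omega k beta Phi < +oo)%E].

End HolomorphicSpaces.

Section SymmetricProduct.
Variables (R : realType) (n : nat).

Definition symmetrization (x : 'rV[R[i]]_n) : 'rV[R[i]]_n :=
  \row_(i < n) \sum_(A : {set 'I_n} | #|A| == i.+1) \prod_(j in A) x 0 j.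

Definition sym_product (U : set R[i]) : set 'rV[R[i]]_n :=
  symmetrization @` [set x : 'rV[R[i]]_n | forall i, U (x 0 i)].

(* The coordinate z_(i+1) is [z 0 i]. *)
Definition q (z : 'rV[R[i]]_n) (t : R[i]) : R[i] :=
  t ^+ n + \sum_(i < n) (-1) ^+ i.+1 * z 0 i * t ^+ (n - i.+1).

Definition sym_cauchy (U : set R[i]) (l : nat) (G : smooth_boundary U l)
    (phi : R[i] -> R[i]) (z : 'rV[R[i]]_n) : R[i] :=
  ((2 * pi)%:C * 'i%C)^-1 *
  \sum_(j < ncurves G)
    cintegral 0 (len G j) (fun s =>
      phi (curve G j s) / q z (curve G j s) * nderive 1 (curve G j) s).

End SymmetricProduct.

Definition Lambda (R : realType) (n : nat) : R :=
  if (n <= 3)%N then n`!%:R else 3 / 2 * n`!%:R.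

(* [F] maps the function space [X], with norm [nX], continuously into the
   function space [Y], with norm [nY]. *)
Definition continuous_between (R : realType) (S T : Type)
    (X : set (S -> R[i])) (nX : (S -> R[i]) -> \bar R)
    (Y : set (T -> R[i])) (nY : (T -> R[i]) -> \bar R)
    (F : (S -> R[i]) -> (T -> R[i])) : Prop :=
  (forall phi, X phi -> Y (F phi)) /\
  (forall phi, X phi -> forall e : R, 0 < e -> exists2 d : R, 0 < d &
     forall psi, X psi -> (nX (psi \- phi)%R < d%:E)%E ->
       (nY (F psi \- F phi)%R < e%:E)%E).

(* Main.v *)
Require Import Defs.
From HB Require Import structures.
From mathcomp Require Import all_boot all_order all_algebra.
From mathcomp Require Import all_classical all_reals all_analysis.
From mathcomp Require Import complex.
From mathcomp Require Import ring lra.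
Import Order.TTheory GRing.Theory Num.Theory.
Import numFieldTopology.Exports numFieldNormedType.Exports.
Local Open Scope classical_set_scope.
Local Open Scope ring_scope.
Local Open Scope complex_scope.
Set Implicit Arguments. Unset Strict Implicit. Unset Printing Implicit Defensive.

(** Write [E phi] for the symmetrized Cauchy transform of [phi]. If the roots
    of [q z] are [x_1, ..., x_n], then [E phi] at [z] is, up to a constant,
    the integral of [phi t / ((t - x_1) ... (t - x_n))], and a derivative of
    [E phi] of order [g <= k] is, up to a constant, the integral of [phi t * t
    ^+ a / q z t ^+ g.+1] ([mpartial_qint]): again a Cauchy integral with
    several poles, now the roots of [q z], each repeated [g.+1] times, hence
    at most [(k + 1) n] in all. So there are two separate questions.

    The first one is the dependence of such an integral on its poles. With
    [m.+1] poles and [phi] of class [C^(m, alpha)] on the boundary it is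
    Hoelder continuous with the exponent [alpha] in each pole, up to the
    boundary and uniformly in the other poles ([multi_cauchy_holder]). The
    difference of its values at [x] and [y] is [x - y] times an integral with
    one pole more, both [x] and [y] being present. To bound this integral,
    represent [phi] by its Taylor polynomials along the boundary
    ([boundary_jet]). For another pole [x'], with nearest boundary point
    [tau], subtract [phi tau] from [phi]: by residue calculus on the connected
    set [U] rational functions that decay fast enough integrate to zero
    ([oint_moment]), so that the integral does not change. Then [(phi t - phi
    tau) / (t - x')] is the product of [(t - tau) / (t - x')], of modulus at
    most two, and [(phi t - phi tau) / (t - tau)], which has one derivative
    less than [phi] ([whitney_div]). The [m] additional poles absorb the [m]
    derivatives; what remains is a function of class [C^(0, alpha)] against
    the double pole [1 / ((t - x) (t - y))], which gives the bound [e `^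
    (alpha - 1)] when [x] and [y] are at distance at least [e] from the
    boundary and [normc (x - y)] is of the order of [e] ([oint_two_poles]).
    Chains of such pairs along the inner normals connect any two points of
    [U], and the errors form a geometric series ([chain_holder]).

    The second question is the dependence of the roots on the coefficients.
    Roots of two monic polynomials of degree [n] are matched one at a time,
    dividing out a matched pair at each step; a polynomial of degree [p] costs
    a [p]-th root, and the total is the exponent [1 / n`!] ([root_matching]).
    Composing, the derivatives of [E phi] are Hoelder continuous with exponent
    [alpha / n`!], thus also with the smaller exponent [alpha / Lambda R n].
    All bounds are linear in the norm of [phi], so that the linear operator
    [E] is bounded, hence continuous. *)

(** * The modulus as a real number *)

Local Arguments ComplexField.Normc.normc : simpl never.

Section Modulus.
Variable R : realType.
Implicit Types x y z : R[i].

Lemma nc_ge0 z : 0 <= normc z.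
Proof. by case: z => a b; exact: sqrtr_ge0. Qed.

Lemma nc0 : normc (0 : R[i]) = 0.
Proof. exact: ComplexField.Normc.normc0. Qed.

Lemma nc1 : normc (1 : R[i]) = 1.
Proof. exact: ComplexField.Normc.normc1. Qed.

Lemma ncM x y : normc (x * y) = normc x * normc y.
Proof. exact: ComplexField.Normc.normcM. Qed.

Lemma ncV x : normc x^-1 = (normc x)^-1.
Proof. exact: ComplexField.Normc.normcV. Qed.

Lemma ncN x : normc (- x) = normc x.
Proof. exact: normcN. Qed.

Lemma ncD x y : normc (x + y) <= normc x + normc y.
Proof. exact: le_normcD. Qed.

Lemma ncX x k : normc (x ^+ k) = normc x ^+ k.
Proof. by elim: k => [|k IH]; rewrite ?expr0 ?nc1// !exprS ncM IH. Qed.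

Lemma ncBC x y : normc (x - y) = normc (y - x).
Proof. by rewrite -ncN opprB. Qed.

Lemma ncB x y : normc (x - y) <= normc x + normc y.
Proof. by rewrite -(ncN y) ncD. Qed.

Lemma nc_eq0 x : (normc x == 0) = (x == 0).
Proof.
apply/eqP/eqP => [|->]; last exact: nc0.
by move/ComplexField.Normc.eq0_normc.
Qed.

Lemma nc_gt0 x : (0 < normc x) = (x != 0).
Proof. by rewrite lt_def nc_ge0 andbT nc_eq0. Qed.

Lemma ncE x : (normc x)%:C = `|x|.
Proof. by rewrite normc_def; case: x. Qed.

Lemma ncR (a : R) : normc a%:C = `|a|.
Proof. by rewrite /ComplexField.Normc.normc /= expr0n addr0 sqrtr_sqr. Qed.

Lemma nc_nat k : normc (k%:R : R[i]) = k%:R.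
Proof. by rewrite -(rmorph_nat (real_complex R)) ncR ger0_norm. Qed.

Lemma nc_i : normc ('i%C : R[i]) = 1.
Proof. by rewrite /ComplexField.Normc.normc /= expr0n add0r expr1n sqrtr1. Qed.

Lemma nc_tri x y z : normc (x - z) <= normc (x - y) + normc (y - z).
Proof. by apply: le_trans (ncD _ _); rewrite addrA subrK. Qed.

Lemma nc_rtri x y : normc x - normc y <= normc (x - y).
Proof. by rewrite lerBlDr; apply: le_trans (ncD _ _); rewrite subrK. Qed.

Lemma nc_Re z : `|complex.Re z| <= normc z.
Proof.
case: z => a b; rewrite /ComplexField.Normc.normc /= -sqrtr_sqr ler_wsqrtr// lerDl; exact: sqr_ge0.
Qed.

Lemma nc_Im z : `|complex.Im z| <= normc z.
Proof.
case: z => a b; rewrite /ComplexField.Normc.normc /= -sqrtr_sqr ler_wsqrtr// lerDr; exact: sqr_ge0.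
Qed.

Lemma nc_ReIm z : normc z <= `|complex.Re z| + `|complex.Im z|.
Proof.
case: z => a b; rewrite /ComplexField.Normc.normc /=.
rewrite -[leRHS]ger0_norm ?addr_ge0// -sqrtr_sqr ler_wsqrtr// sqrrD.
by rewrite !real_normK ?num_real// [leRHS]addrAC lerDl mulrn_wge0// mulr_ge0.
Qed.

Lemma nc_conj z : normc (z^*)%C = normc z.
Proof. by case: z => a b; rewrite /ComplexField.Normc.normc /= sqrrN. Qed.

Lemma nc_mul_conj z : normc z = 1 -> z * (z^*)%C = 1.
Proof.
move=> z1; have := sqr_normc z; rewrite -ncE z1 /= => <-.
by rewrite -[1%:C]/(1 : R[i]) expr1n.
Qed.

Lemma nc_sum (I : Type) (r : seq I) (P : pred I) (F : I -> R[i]) :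
  normc (\sum_(i <- r | P i) F i) <= \sum_(i <- r | P i) normc (F i).
Proof.
elim/big_rec2: _ => [|i y1 y2 _ H]; first by rewrite nc0.
by apply: le_trans (ncD _ _) _; rewrite lerD2l.
Qed.

End Modulus.

(** * A weighted coefficient norm on polynomials *)

Section PolyNorm.
Variable R : realType.
Implicit Types (P Q : {poly R[i]}) (r K : R) (a b c t u : R[i]).

(** A submultiplicative norm that dominates the values on the disc of radius [r]
    around the origin. *)
Definition pnorm r P : R := \sum_(i < size P) normc P`_i * r ^+ i.

(** The coefficients of [rebase a P] are the Taylor coefficients of [P] at [a]. *)
Definition rebase a P : {poly R[i]} := P \Po ('X + a%:P).

Lemma pnormE r P d : (size P <= d)%N -> pnorm r P = \sum_(i < d) normc P`_i * r ^+ i.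
Proof.
move=> Pd; rewrite /pnorm -(subnKC Pd) big_split_ord /= [X in _ + X]big1 ?addr0//.
by move=> i _; rewrite nth_default ?leq_addr// nc0 mul0r.
Qed.

Lemma pnorm_ge0 r P : 0 <= r -> 0 <= pnorm r P.
Proof. by move=> r0; apply: sumr_ge0 => i _; rewrite mulr_ge0 ?nc_ge0 ?exprn_ge0. Qed.

Lemma pnormD r P Q : 0 <= r -> pnorm r (P + Q) <= pnorm r P + pnorm r Q.
Proof.
move=> r0; set d := maxn (size P) (size Q).
rewrite (@pnormE _ _ d) ?(leq_trans (size_polyD _ _))//.
rewrite (@pnormE _ P d) ?leq_maxl// (@pnormE _ Q d) ?leq_maxr//.
rewrite -big_split; apply: ler_sum => i _ /=.
by rewrite coefD -mulrDl ler_wpM2r ?exprn_ge0// ncD.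
Qed.

Lemma pnormZ r c P : pnorm r (c *: P) = normc c * pnorm r P.
Proof.
rewrite (@pnormE _ _ (size P)) ?size_scale_leq// /pnorm mulr_sumr.
by apply: eq_bigr => i _; rewrite coefZ ncM mulrA.
Qed.

Lemma pnormN r P : pnorm r (- P) = pnorm r P.
Proof. by rewrite -scaleN1r pnormZ ncN nc1 mul1r. Qed.

Lemma pnormB r P Q : 0 <= r -> pnorm r (P - Q) <= pnorm r P + pnorm r Q.
Proof. by move=> r0; rewrite -(pnormN r Q) pnormD. Qed.

Lemma pnormC r c : pnorm r c%:P = normc c.
Proof. by rewrite (@pnormE _ _ 1) ?size_polyC_leq1// big_ord1 coefC expr0 mulr1. Qed.

Lemma pnormMX r P : pnorm r (P * 'X) = r * pnorm r P.
Proof.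
rewrite (@pnormE _ _ (size P).+1); last first.
  by apply: leq_trans (size_polyMleq _ _) _; rewrite size_polyX addn2.
rewrite big_ord_recl coefMX /= nc0 mul0r add0r /pnorm mulr_sumr.
by apply: eq_bigr => i _; rewrite coefMX /= exprS mulrCA.
Qed.

Lemma pnormM r P Q : 0 <= r -> pnorm r (P * Q) <= pnorm r P * pnorm r Q.
Proof.
move=> r0; elim/poly_ind: P => [|P c IH].
  by rewrite mul0r /pnorm size_poly0 big_ord0 mul0r.
have eqn : pnorm r (P * 'X + c%:P) = r * pnorm r P + normc c.
  rewrite (@pnormE _ _ (size P).+1); last by rewrite size_MXaddC; case: ifP.
  rewrite -(pnormMX r P) (@pnormE _ (P * 'X) (size P).+1); last first.
    by apply: leq_trans (size_polyMleq _ _) _; rewrite size_polyX addn2.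
  rewrite 2!big_ord_recl !coefD !coefMX !coefC /= !add0r nc0 mul0r add0r expr0 mulr1 addrC.
  by congr (_ + _); apply: eq_bigr => i _; rewrite !coefD !coefMX coefC /= addr0.
rewrite eqn mulrDl mulrAC mul_polyC; apply: le_trans (pnormD _ _ r0) _.
by rewrite pnormMX pnormZ mulrDl -mulrA lerD2r ler_wpM2l.
Qed.

Lemma pnormXn r P k : 0 <= r -> pnorm r (P ^+ k) <= pnorm r P ^+ k.
Proof.
move=> r0; elim: k => [|k IH]; first by rewrite !expr0 -polyC1 pnormC nc1.
rewrite !exprS; apply: le_trans (pnormM _ _ r0) _.
by rewrite ler_wpM2l// pnorm_ge0.
Qed.

Lemma pnorm_XaddC r c : 0 <= r -> pnorm r ('X + c%:P) <= r + normc c.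
Proof.
move=> r0; apply: le_trans (pnormD _ _ r0) _; rewrite pnormC lerD2r.
by rewrite -['X]mul1r pnormMX -polyC1 pnormC nc1 mulr1.
Qed.

Lemma pnorm_XsubC r c : 0 <= r -> pnorm r ('X - c%:P) <= r + normc c.
Proof. by move=> r0; rewrite -(ncN c) -polyCN pnorm_XaddC. Qed.

Lemma pnorm_coef0 r P : 0 <= r -> normc P.[0] <= pnorm r P.
Proof.
move=> r0; rewrite horner_coef0 (@pnormE _ _ (size P).+1)//.
by rewrite big_ord_recl expr0 mulr1 lerDl sumr_ge0// => i _; rewrite mulr_ge0 ?nc_ge0 ?exprn_ge0.
Qed.

Lemma pnorm_horner r P t : normc t <= r -> normc P.[t] <= pnorm r P.
Proof.
move=> tr; rewrite horner_coef; apply: le_trans (nc_sum _ _ _) _.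
apply: ler_sum => i _; rewrite ncM ncX ler_wpM2l ?nc_ge0//.
by rewrite lerXn2r ?nnegrE ?nc_ge0// (le_trans (nc_ge0 _) tr).
Qed.

Lemma rebaseD a P Q : rebase a (P + Q) = rebase a P + rebase a Q.
Proof. exact: comp_polyD. Qed.

Lemma rebaseB a P Q : rebase a (P - Q) = rebase a P - rebase a Q.
Proof. exact: comp_polyB. Qed.

Lemma rebaseM a P Q : rebase a (P * Q) = rebase a P * rebase a Q.
Proof. exact: comp_polyM. Qed.

Lemma rebaseZ a c P : rebase a (c *: P) = c *: rebase a P.
Proof. exact: comp_polyZ. Qed.

Lemma rebaseC a c : rebase a c%:P = c%:P.
Proof. exact: comp_polyC. Qed.

Lemma rebase_XsubC a c : rebase a ('X - c%:P) = 'X - (c - a)%:P.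
Proof. by rewrite rebaseB rebaseC /rebase comp_polyX polyCB opprB addrA addrAC. Qed.

Lemma rebaseXn a P k : rebase a (P ^+ k) = rebase a P ^+ k.
Proof. exact: rmorphXn. Qed.

Lemma rebase_add a b P : rebase a (rebase b P) = rebase (a + b) P.
Proof.
by rewrite /rebase -comp_polyA comp_polyD comp_polyX comp_polyC polyCD addrA.
Qed.

Lemma horner_rebase a P t : (rebase a P).[t] = P.[t + a].
Proof. by rewrite horner_comp !hornerE. Qed.

Lemma size_rebase a P : size (rebase a P) = size P.
Proof. by rewrite size_comp_poly2// size_XaddC. Qed.

Lemma pnorm_at a r P : 0 <= r -> normc P.[a] <= pnorm r (rebase a P).
Proof. by move=> r0; apply: le_trans (pnorm_coef0 _ r0); rewrite horner_rebase add0r. Qed.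

Lemma pnorm_rebase r K c P d : 0 <= r -> 0 <= K -> normc c <= K * r ->
  (size P <= d.+1)%N -> pnorm r (rebase c P) <= (1 + K) ^+ d * pnorm r P.
Proof.
move=> r0 K0 cK Pd; rewrite /rebase comp_polyE.
rewrite {2}/pnorm mulr_sumr.
elim/big_rec2: _ => [|i y1 y2 _ H]; first by rewrite -polyC0 pnormC nc0.
apply: le_trans (pnormD _ _ r0) _; rewrite lerD// pnormZ mulrCA ler_wpM2l ?nc_ge0//.
apply: le_trans (pnormXn _ _ r0) _.
have id : (i <= d)%N by rewrite -ltnS; apply: leq_trans (ltn_ord i) Pd.
apply: (@le_trans _ _ (((1 + K) * r) ^+ i)).
  rewrite lerXn2r ?nnegrE ?pnorm_ge0 ?mulr_ge0 ?addr_ge0//.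
  by rewrite (le_trans (pnorm_XaddC _ r0))// mulrDl mul1r lerD2l.
by rewrite exprMn ler_wpM2r ?exprn_ge0// ler_weXn2l// lerDl.
Qed.

(** Division by [X - a] gains the larger of [r] and the distance from [t] to [a].
    If that distance is at least [2 * r], the constant [t - a] dominates the
    factor; otherwise move the base point to [a], where the factor is a mere shift
    of the coefficients. *)
Lemma pnorm_divXsubC (d : nat) : exists2 C : R, 0 <= C &
  forall r a t P Q, 0 < r -> ('X - a%:P) * Q = P -> (size P <= d.+2)%N ->
  pnorm r (rebase t Q) * Num.max r (normc (t - a)) <= C * pnorm r (rebase t P).
Proof.
exists (2 * 3 ^+ d * 3 ^+ d.+1); first by rewrite !mulr_ge0 ?exprn_ge0//; lra.
move=> r a t P Q r0 eP sP.
have r0' := ltW r0.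
have sQ : (size Q <= d.+1)%N.
  have [->|Q0] := eqVneq Q 0; first by rewrite size_poly0.
  by move: sP; rewrite -eP size_monicM ?monicXsubC// size_XsubC.
have ge1 k : 1 <= 3 ^+ k :> R by rewrite exprn_ege1//; lra.
have ge13 : 1 <= 3 ^+ d * 3 ^+ d.+1 :> R by rewrite mulr_ege1.
have [far|near] := leP (2 * r) (normc (t - a)).
  have -> : Num.max r (normc (t - a)) = normc (t - a) by apply/max_r; lra.
  have H : normc (t - a) * pnorm r (rebase t Q) <=
           pnorm r (rebase t P) + r * pnorm r (rebase t Q).
    rewrite -eP rebaseM rebase_XsubC -pnormMX -pnormZ -(pnormN r (_ * 'X)).
    apply: le_trans (pnormD _ _ r0').
    have -> : ('X - (a - t)%:P) * rebase t Q - rebase t Q * 'X = (t - a) *: rebase t Q.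
      by rewrite -mul_polyC mulrC !polyCB; ring.
    by [].
  have h0 := pnorm_ge0 (rebase t Q) r0'; have h1 := pnorm_ge0 (rebase t P) r0'.
  have h2 : r * pnorm r (rebase t Q) <= normc (t - a) / 2 * pnorm r (rebase t Q).
    by rewrite ler_wpM2r//; lra.
  apply: (@le_trans _ _ (2 * pnorm r (rebase t P))); first by lra.
  by rewrite ler_wpM2r// -[leLHS]mulr1 -mulrA ler_wpM2l.
have mx : Num.max r (normc (t - a)) <= 2 * r by rewrite ge_max; apply/andP; split; lra.
have aux b c (Z : {poly R[i]}) e : normc (b - c) <= 2 * r -> (size Z <= e.+1)%N ->
    pnorm r (rebase b Z) <= 3 ^+ e * pnorm r (rebase c Z).
  move=> bc sZ; rewrite -[b in rebase b](subrK c) -rebase_add.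
  have -> : 3 = 1 + 2 :> R by lra.
  by apply: pnorm_rebase => //; rewrite ?size_rebase.
have eqa : pnorm r (rebase a P) = r * pnorm r (rebase a Q).
  by rewrite -eP rebaseM rebase_XsubC subrr subr0 mulrC pnormMX.
have h1 := aux t a Q d (ltW near) sQ.
have h2 : pnorm r (rebase a P) <= 3 ^+ d.+1 * pnorm r (rebase t P).
  by apply: aux => //; rewrite ncBC ltW.
apply: (@le_trans _ _ (3 ^+ d * pnorm r (rebase a Q) * (2 * r))).
  by rewrite ler_pM// ?pnorm_ge0// le_max r0'.
rewrite [leLHS](_ : _ = 2 * 3 ^+ d * pnorm r (rebase a P)); last by rewrite eqa; ring.
by rewrite -!mulrA !ler_wpM2l// exprn_ge0.
Qed.

End PolyNorm.

(** * Whitney jets of holomorphic type on a plane set *)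

Section PowR.
Variables (R : realType) (alpha : R).
Hypothesis halpha : 0 < alpha < 1.
Implicit Types x y r M : R.

Let alpha0 : 0 <= alpha. Proof. by case/andP: halpha => /ltW. Qed.
Let alpha1 : alpha <= 1. Proof. by case/andP: halpha => _ /ltW. Qed.

Lemma powR_le_scale K x y : 1 <= K -> 0 <= x -> 0 <= y -> x <= K * y ->
  x `^ alpha <= K * y `^ alpha.
Proof.
move=> K1 x0 y0 xy; have K0 : 0 <= K by lra.
apply: (@le_trans _ _ ((K * y) `^ alpha)).
  by apply: ge0_ler_powR => //; rewrite nnegrE// mulr_ge0.
rewrite powRM// ler_wpM2r ?powR_ge0// -[leRHS]powRr1//.
exact: ler_powR.
Qed.

(** [x `^ alpha / x] decreases. *)
Lemma powR_sublinear r M : 0 < r -> r <= M -> M `^ alpha * r <= r `^ alpha * M.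
Proof.
move=> r0 rM; have r0' := ltW r0.
rewrite -ler_pdivlMr// -mulrA [leRHS]mulrC; apply: powR_le_scale => //.
- by rewrite ler_pdivlMr ?mul1r.
- exact: le_trans r0' rM.
- by rewrite mulfVK ?gt_eqF.
Qed.

End PowR.

Section Whitney.
Variables (R : realType) (alpha : R) (D : set R[i]).
Hypothesis halpha : 0 < alpha < 1.
Implicit Types (F G : R[i] -> {poly R[i]}) (A r : R) (t s a : R[i]) (m : nat).

(** [F t] plays the part of the Taylor polynomial at [t] of a function of class
    [C^(m, alpha)] on [D]; the function itself is [fun t => (F t).[t]].  The norm
    [pnorm r] at the base point [t] contains the derivatives of all orders, with
    their natural weights, so that the last clause gathers Whitney's conditions on
    the Taylor remainders. *)
Definition whitney m F A : Prop :=
  [/\ forall t, D t -> (size (F t) <= m.+1)%N,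
      forall t, D t -> pnorm 1 (rebase t (F t)) <= A &
      forall t s r, D t -> D s -> 0 < r -> normc (t - s) <= r ->
        pnorm r (rebase t (F t - F s)) <= A * r ^+ m * r `^ alpha].

Lemma whitney_bound m F A t : whitney m F A -> D t -> normc (F t).[t] <= A.
Proof. by case=> _ H _ Dt; apply: le_trans (H t Dt); apply: pnorm_at. Qed.

Lemma whitney_holder F A t s : whitney 0 F A -> D t -> D s ->
  normc ((F t).[t] - (F s).[s]) <= A * normc (t - s) `^ alpha.
Proof.
move=> [sF _ H] Dt Ds; have [->|ts] := eqVneq t s.
  by rewrite !subrr nc0 powR0 ?mulr0//; case/andP: halpha => /gt_eqF->.
have r0 : 0 < normc (t - s) by rewrite nc_gt0 subr_eq0.
have := H t s _ Dt Ds r0 (lexx _); rewrite expr0 mulr1; apply: le_trans.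
have cF u : D u -> (F u).[t] = (F u).[u].
  by move=> Du; rewrite (size1_polyC (sF u Du)) !hornerC.
by rewrite -(cF s Ds) -hornerN -hornerD pnorm_at// ltW.
Qed.

Let pnorm_Xpow r b c k : 0 <= r ->
  pnorm r (rebase b (('X - c%:P) ^+ k)) <= (r + normc (c - b)) ^+ k.
Proof.
move=> r0; rewrite rebaseXn rebase_XsubC; apply: le_trans (pnormXn _ _ r0) _.
by rewrite lerXn2r ?nnegrE ?pnorm_ge0 ?addr_ge0 ?nc_ge0 ?pnorm_XsubC.
Qed.

(** Division by [X - a]: the quotient [(f t - f a) / (t - a)] of a Whitney
    function loses one derivative.  The Taylor polynomial of [f - f a] at [t]
    need not vanish at [a]; correcting its coefficient of degree [m.+1] makes it
    divisible by [X - a], and the correction is as small as the Taylor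
    remainder. *)
Lemma whitney_div m : exists2 C : R, 0 <= C & forall F A a, D a ->
  whitney m.+1 F A -> exists2 G, whitney m G (C * A) &
    forall t, D t -> (F t).[t] - (F a).[a] = (t - a) * (G t).[t].
Proof.
have [C0 C00 hdiv] := pnorm_divXsubC R m.
pose C1 : R := 3 + 2 * 2 ^+ m.+1.
have C13 : 3 <= C1 by rewrite /C1 lerDl mulr_ge0// exprn_ge0.
exists (C0 * C1); first by rewrite mulr_ge0//; lra.
move=> F A a Da wF; have [sF bF hF] := wF.
have A0 : 0 <= A := le_trans (nc_ge0 _) (whitney_bound wF Da).
(* [k t] is chosen such that [N t] vanishes at [a]. *)
pose k t := ((F a).[a] - (F t).[a]) / (a - t) ^+ m.+1.
pose N t := F t - ((F a).[a])%:P + k t *: ('X - t%:P) ^+ m.+1.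
pose G t := N t %/ ('X - a%:P).
have kE t : k t * (a - t) ^+ m.+1 = (F a).[a] - (F t).[a].
  have [->|ta] := eqVneq t a; first by rewrite !subrr expr0n mulr0.
  by rewrite /k mulfVK// expf_neq0// subr_eq0 eq_sym.
have GE t : ('X - a%:P) * G t = N t.
  rewrite mulrC divpK// dvdp_XsubCl; apply/eqP; rewrite !hornerE kE.
  by ring.
have kb t : D t -> normc (k t) <= A * normc (t - a) `^ alpha.
  move=> Dt; have [->|ta] := eqVneq t a.
    by rewrite /k !subrr mul0r nc0 mulr_ge0 ?powR_ge0.
  have u0 : 0 < normc (a - t) by rewrite nc_gt0 subr_eq0 eq_sym.
  rewrite /k ncM ncV ncX ler_pdivrMr ?exprn_gt0// [normc (t - a)]ncBC mulrAC.
  apply: le_trans (hF a t _ Da Dt u0 (lexx _)).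
  by rewrite -hornerN -hornerD pnorm_at// ltW.
have sN t : D t -> (size (N t) <= m.+2)%N.
  move=> Dt; rewrite /N (leq_trans (size_polyD _ _))// geq_max; apply/andP; split.
    rewrite (leq_trans (size_polyD _ _))// geq_max sF//= size_polyN.
    by rewrite (leq_trans (size_polyC_leq1 _)).
  by rewrite (leq_trans (size_scale_leq _ _))// size_exp_XsubC.
have pw0 x : 0 <= x `^ alpha := powR_ge0 x alpha.
have M_mono r t : 0 < r -> 1 <= Num.max r (normc (t - a)) / r.
  by move=> r0; rewrite ler_pdivlMr// mul1r le_max lexx.
exists G; last first.
  move=> t Dt; have := congr1 (fun p => p.[t]) (GE t).
  by rewrite /N !hornerE subrr expr0n mulr0 addr0 => <-.
split.
- move=> t Dt; have [->|G0] := eqVneq (G t) 0; first by rewrite size_poly0.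
  by have := sN t Dt; rewrite -(GE t) size_monicM ?monicXsubC// size_XsubC.
- move=> t Dt; set M := Num.max 1 (normc (t - a)).
  have M1 : 1 <= M by rewrite le_max lexx.
  have uM : normc (t - a) <= M by rewrite le_max lexx orbT.
  have M0 : 0 < M by lra.
  rewrite -(ler_pM2r M0); apply: le_trans (hdiv 1 a t _ _ ltr01 (GE t) (sN t Dt)) _.
  rewrite -!mulrA ler_wpM2l//.
  have ua : normc (t - a) `^ alpha <= M.
    apply: (@le_trans _ _ (M * 1 `^ alpha)); last by rewrite powR1 mulr1.
    by apply: powR_le_scale; rewrite ?nc_ge0// mulr1.
  apply: (@le_trans _ _ (A + A + A * M)).
    rewrite /N rebaseD rebaseB rebaseC rebaseZ.
    apply: le_trans (pnormD _ _ ler01) _; apply: lerD.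
      apply: le_trans (pnormB _ _ ler01) _; rewrite pnormC.
      by rewrite lerD ?bF// (whitney_bound wF Da).
    rewrite pnormZ -[A * M]mulr1 ler_pM ?nc_ge0 ?pnorm_ge0//.
      by apply: le_trans (kb t Dt) _; rewrite ler_wpM2l.
    apply: le_trans (pnorm_Xpow _ _ _ ler01) _.
    by rewrite subrr nc0 addr0 expr1n.
  have : A <= A * M by rewrite ler_peMr.
  have : 0 <= A * M by rewrite mulr_ge0// ltW.
  move=> AM0 AM; apply: (@le_trans _ _ (3 * (A * M))); first lra.
  by rewrite ler_wpM2r.
- move=> t s r Dt Ds r0 ts; have r0' := ltW r0.
  set M := Num.max r (normc (t - a)).
  have rM : r <= M by rewrite le_max lexx.
  have uM : normc (t - a) <= M by rewrite le_max lexx orbT.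
  have M0 : 0 < M by lra.
  have GNE : ('X - a%:P) * (G t - G s) = N t - N s by rewrite mulrBr !GE.
  have sNN : (size (N t - N s)%R <= m.+2)%N.
    by rewrite (leq_trans (size_polyD _ _))// geq_max size_polyN !sN.
  have := hdiv r a t _ _ r0 GNE sNN; rewrite -/M => H.
  have NN : pnorm r (rebase t (N t - N s)) <= C1 * (A * r ^+ m.+1 * M `^ alpha).
    have -> : N t - N s = F t - F s + k t *: ('X - t%:P) ^+ m.+1
                          - k s *: ('X - s%:P) ^+ m.+1.
      by rewrite /N; ring.
    have P0 : 0 <= A * r ^+ m.+1 by rewrite mulr_ge0 ?exprn_ge0.
    rewrite rebaseB rebaseD 2!rebaseZ.
    apply: le_trans (pnormB _ _ r0') _.
    apply: (@le_trans _ _ (A * r ^+ m.+1 * M `^ alpha + A * r ^+ m.+1 * M `^ alpha +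
             2 * 2 ^+ m.+1 * (A * r ^+ m.+1 * M `^ alpha))).
      apply: lerD; last first.
        rewrite pnormZ.
        apply: (@le_trans _ _ ((A * (2 * M `^ alpha)) * (2 * r) ^+ m.+1)).
          apply: ler_pM; rewrite ?nc_ge0 ?pnorm_ge0//.
            apply: le_trans (kb s Ds) _; rewrite ler_wpM2l//.
            apply: powR_le_scale => //; rewrite ?nc_ge0 ?(ltW M0)//; first lra.
            have := nc_tri s t a; rewrite (ncBC s t); lra.
          apply: le_trans (pnorm_Xpow _ _ _ r0') _.
          rewrite lerXn2r ?nnegrE ?addr_ge0 ?nc_ge0//; first lra.
          by rewrite ncBC; lra.
        by rewrite exprMn le_eqVlt; apply/orP; left; apply/eqP; ring.
      apply: le_trans (pnormD _ _ r0') _; apply: lerD.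
        apply: le_trans (hF t s r Dt Ds r0 ts) _; rewrite ler_wpM2l//.
        rewrite -[leRHS]mul1r; apply: powR_le_scale => //; first exact: ltW.
        by rewrite mul1r.
      rewrite pnormZ [leRHS]mulrAC ler_pM ?nc_ge0 ?pnorm_ge0//.
        apply: le_trans (kb t Dt) _; rewrite ler_wpM2l//.
        rewrite -[leRHS]mul1r; apply: powR_le_scale; rewrite ?nc_ge0 ?(ltW M0)//.
        by rewrite mul1r.
      apply: le_trans (pnorm_Xpow _ _ _ r0') _.
      by rewrite subrr nc0 addr0.
    have : 0 <= A * r ^+ m.+1 * M `^ alpha by rewrite mulr_ge0.
    rewrite /C1 mulrDl; lra.
  rewrite -(ler_pM2r M0); apply: le_trans H _.
  apply: (@le_trans _ _ (C0 * (C1 * (A * r ^+ m.+1 * M `^ alpha)))).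
    by rewrite ler_wpM2l.
  rewrite [leLHS](_ : _ = (C0 * C1 * A * r ^+ m) * (M `^ alpha * r)); last first.
    by rewrite exprS; ring.
  rewrite -[leRHS]mulrA ler_wpM2l//; last exact: powR_sublinear.
  by rewrite !mulr_ge0 ?exprn_ge0//; lra.
Qed.

End Whitney.

(** * Complex functions of a real variable *)

Section ComplexCurves.
Variable R : realType.
Implicit Types (f g h : R -> R[i]) (s a b : R) (x y z l : R[i]).

Definition ccont f : Prop :=
  continuous (fun s => complex.Re (f s)) /\ continuous (fun s => complex.Im (f s)).

(** Real and imaginary parts are differentiated separately, as in the function
    spaces. *)
Definition cderive f s l : Prop :=
  is_derive s (1 : R) (fun u => complex.Re (f u)) (complex.Re l) /\
  is_derive s (1 : R) (fun u => complex.Im (f u)) (complex.Im l).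

Lemma ReM x y : complex.Re (x * y : R[i]) =
  complex.Re x * complex.Re y - complex.Im x * complex.Im y.
Proof. by case: x y => [a b] [c d]. Qed.

Lemma ImM x y : complex.Im (x * y : R[i]) =
  complex.Re x * complex.Im y + complex.Im x * complex.Re y.
Proof. by case: x y => [a b] [c d]. Qed.

Lemma ReD x y : complex.Re (x + y : R[i]) = complex.Re x + complex.Re y.
Proof. by case: x y => [a b] [c d]. Qed.

Lemma ImD x y : complex.Im (x + y : R[i]) = complex.Im x + complex.Im y.
Proof. by case: x y => [a b] [c d]. Qed.

Lemma ReN x : complex.Re (- x : R[i]) = - complex.Re x.
Proof. by case: x. Qed.

Lemma ImN x : complex.Im (- x : R[i]) = - complex.Im x.
Proof. by case: x. Qed.

Lemma ReV x : complex.Re (x^-1 : R[i]) =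
  complex.Re x / (complex.Re x ^+ 2 + complex.Im x ^+ 2).
Proof. by case: x. Qed.

Lemma ImV x : complex.Im (x^-1 : R[i]) =
  - (complex.Im x / (complex.Re x ^+ 2 + complex.Im x ^+ 2)).
Proof. by case: x. Qed.

Lemma sqr_ReIm x : x != 0 -> complex.Re x ^+ 2 + complex.Im x ^+ 2 != 0.
Proof.
case: x => a b; rewrite eq_complex /= negb_and => ab0.
rewrite gt_eqF// lt_def paddr_eq0 ?sqr_ge0// !sqrf_eq0 negb_and ab0/=.
by rewrite addr_ge0 ?sqr_ge0.
Qed.

Lemma complex_ext x y : complex.Re x = complex.Re y -> complex.Im x = complex.Im y ->
  x = y :> R[i].
Proof. by case: x y => [a b] [c d] /= -> ->. Qed.

Lemma eq_ccont f g : f =1 g -> ccont f -> ccont g.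
Proof. by move=> /funext ->. Qed.

Lemma ccont_cst z : ccont (fun=> z).
Proof. by split; exact: cst_continuous. Qed.

Lemma ccontD f g : ccont f -> ccont g -> ccont (fun s => f s + g s).
Proof.
move=> [fr fi] [gr gi]; split => s.
  rewrite (_ : (fun s => _) = (fun s => complex.Re (f s) + complex.Re (g s))).
    by apply: cvgD; [exact: fr|exact: gr].
  by apply/funext => u; rewrite ReD.
rewrite (_ : (fun s => _) = (fun s => complex.Im (f s) + complex.Im (g s))).
  by apply: cvgD; [exact: fi|exact: gi].
by apply/funext => u; rewrite ImD.
Qed.

Lemma ccontM f g : ccont f -> ccont g -> ccont (fun s => f s * g s).
Proof.
move=> [fr fi] [gr gi]; split => s.
  rewrite (_ : (fun s => _) = (fun s => complex.Re (f s) * complex.Re (g s) -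
      complex.Im (f s) * complex.Im (g s))).
    by apply: cvgB; apply: cvgM; [exact: fr|exact: gr|exact: fi|exact: gi].
  by apply/funext => u; rewrite ReM.
rewrite (_ : (fun s => _) = (fun s => complex.Re (f s) * complex.Im (g s) +
      complex.Im (f s) * complex.Re (g s))).
  by apply: cvgD; apply: cvgM; [exact: fr|exact: gi|exact: fi|exact: gr].
by apply/funext => u; rewrite ImM.
Qed.

Lemma ccontN f : ccont f -> ccont (fun s => - f s).
Proof.
move=> cf; apply: eq_ccont (ccontM (ccont_cst (-1)) cf).
by move=> s; rewrite mulN1r.
Qed.

Lemma ccontB f g : ccont f -> ccont g -> ccont (fun s => f s - g s).
Proof. by move=> cf cg; apply: ccontD => //; exact: ccontN. Qed.

Lemma ccontV f : (forall s, f s != 0) -> ccont f -> ccont (fun s => (f s)^-1).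
Proof.
move=> f0 [fr fi].
have c2 : continuous (fun s => complex.Re (f s) ^+ 2 + complex.Im (f s) ^+ 2).
  by move=> s; apply: cvgD; apply: (@cvgM R); solve [exact: fr|exact: fi].
split => s.
  rewrite (_ : (fun s => _) = (fun s => complex.Re (f s) /
      (complex.Re (f s) ^+ 2 + complex.Im (f s) ^+ 2))).
    apply: cvgM; first exact: fr.
    by apply: cvgV; [exact: sqr_ReIm|exact: c2].
  by apply/funext => u; rewrite ReV.
rewrite (_ : (fun s => _) = (fun s => - (complex.Im (f s) /
      (complex.Re (f s) ^+ 2 + complex.Im (f s) ^+ 2)))).
  apply: cvgN; apply: cvgM; first exact: fi.
  by apply: cvgV; [exact: sqr_ReIm|exact: c2].
by apply/funext => u; rewrite ImV.
Qed.

Lemma ccontX f k : ccont f -> ccont (fun s => f s ^+ k).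
Proof.
move=> cf; elim: k => [|k IH].
  by apply: eq_ccont (ccont_cst 1) => s; rewrite expr0.
by apply: eq_ccont (ccontM cf IH) => s; rewrite exprS.
Qed.

Lemma ccont_sum (I : Type) (r : seq I) (P : pred I) (F : I -> R -> R[i]) :
  (forall i, ccont (F i)) -> ccont (fun s => \sum_(i <- r | P i) F i s).
Proof.
move=> cF; elim: r => [|i r IH].
  by apply: eq_ccont (ccont_cst 0) => s; rewrite big_nil.
case Pi: (P i); last by apply: eq_ccont IH => s; rewrite big_cons Pi.
by apply: eq_ccont (ccontD (cF i) IH) => s; rewrite big_cons Pi.
Qed.

Lemma ccont_prod (I : Type) (r : seq I) (P : pred I) (F : I -> R -> R[i]) :
  (forall i, ccont (F i)) -> ccont (fun s => \prod_(i <- r | P i) F i s).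
Proof.
move=> cF; elim: r => [|i r IH].
  by apply: eq_ccont (ccont_cst 1) => s; rewrite big_nil.
case Pi: (P i); last by apply: eq_ccont IH => s; rewrite big_cons Pi.
by apply: eq_ccont (ccontM (cF i) IH) => s; rewrite big_cons Pi.
Qed.

Lemma normcE2 z : normc z = Num.sqrt (complex.Re z ^+ 2 + complex.Im z ^+ 2).
Proof. by case: z. Qed.

Lemma continuous_normc f : ccont f -> continuous (fun s => normc (f s)).
Proof.
move=> [fr fi] s.
rewrite (_ : (fun s => _) = Num.sqrt \o
    (fun s => complex.Re (f s) ^+ 2 + complex.Im (f s) ^+ 2)); last first.
  by apply/funext => u; rewrite /= normcE2.
apply: continuous_comp; last exact: sqrt_continuous.
by apply: cvgD; apply: (@cvgM R); solve [exact: fr|exact: fi].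
Qed.

Lemma cderive_cst z s : cderive (fun=> z) s 0.
Proof. by split; exact: is_derive_cst. Qed.

Lemma cderiveD f g s l l' : cderive f s l -> cderive g s l' ->
  cderive (fun u => f u + g u) s (l + l').
Proof.
move=> [fr fi] [gr gi]; split.
  rewrite (_ : (fun u => _) = (fun u => complex.Re (f u)) + (fun u => complex.Re (g u))).
    by rewrite ReD; exact: is_deriveD.
  by apply/funext => u; rewrite ReD.
rewrite (_ : (fun u => _) = (fun u => complex.Im (f u)) + (fun u => complex.Im (g u))).
  by rewrite ImD; exact: is_deriveD.
by apply/funext => u; rewrite ImD.
Qed.

Lemma cderiveM f g s l l' : cderive f s l -> cderive g s l' ->
  cderive (fun u => f u * g u) s (l * g s + f s * l').
Proof.
move=> [fr fi] [gr gi]; split.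
  rewrite (_ : (fun u => _) = (fun u => complex.Re (f u)) * (fun u => complex.Re (g u)) -
     (fun u => complex.Im (f u)) * (fun u => complex.Im (g u))).
    apply: is_derive_eq (is_deriveB (is_deriveM fr gr) (is_deriveM fi gi)) _.
    by rewrite ReD !ReM /GRing.scale /=; ring.
  by apply/funext => u; rewrite ReM.
rewrite (_ : (fun u => _) = (fun u => complex.Re (f u)) * (fun u => complex.Im (g u)) +
     (fun u => complex.Im (f u)) * (fun u => complex.Re (g u))).
  apply: is_derive_eq (is_deriveD (is_deriveM fr gi) (is_deriveM fi gr)) _.
  by rewrite ImD !ImM /GRing.scale /=; ring.
by apply/funext => u; rewrite ImM.
Qed.

Lemma cderiveZ z f s l : cderive f s l -> cderive (fun u => z * f u) s (z * l).
Proof. by move=> df; have := cderiveM (cderive_cst z s) df; rewrite mul0r add0r. Qed.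

Lemma cderiveN f s l : cderive f s l -> cderive (fun u => - f u) s (- l).
Proof.
move=> /(cderiveZ (-1)); rewrite mulN1r; congr (cderive _ _ _).
by apply/funext => u; rewrite mulN1r.
Qed.

Lemma cderiveB f g s l l' : cderive f s l -> cderive g s l' ->
  cderive (fun u => f u - g u) s (l - l').
Proof. by move=> df dg; apply: cderiveD => //; exact: cderiveN. Qed.

Lemma cderive_conj f s l : cderive f s l -> cderive (fun u => (f u)^*%C) s (l^*%C).
Proof.
move=> [fr fi]; split.
  rewrite (_ : (fun u => _) = (fun u => complex.Re (f u))); first by case: l fr {fi}.
  by apply/funext => u; case: (f u).
rewrite (_ : (fun u => _) = - (fun u => complex.Im (f u))).
  by rewrite (_ : complex.Im _ = - complex.Im l); [exact: is_deriveN|case: l {fr fi}].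
by apply/funext => u; rewrite /= [RHS]/(- complex.Im (f u)); case: (f u).
Qed.

Lemma cderive_horner (P : {poly R[i]}) f s l : cderive f s l ->
  cderive (fun u => P.[f u]) s (l * P^`().[f s]).
Proof.
move=> df; elim/poly_ind: P => [|P c IH].
  rewrite deriv0 horner0 mulr0 (_ : (fun u => _) = fun=> 0); first exact: cderive_cst.
  by apply/funext => u; rewrite horner0.
have := cderiveD (cderiveM IH df) (cderive_cst c s).
rewrite derivD derivM derivX derivC !hornerE /=.
rewrite (_ : (fun u => _ + c) = (fun u => (P * 'X + c%:P).[f u])).
  by congr (cderive _ _ _); ring.
by apply/funext => u; rewrite !hornerE.
Qed.

Lemma cderiveV f s l : (forall u, f u != 0) -> cderive f s l ->
  cderive (fun u => (f u)^-1) s (- (l / f s ^+ 2)).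
Proof.
move=> f0 [fr fi].
pose nn := (fun u => complex.Re (f u)) * (fun u => complex.Re (f u)) +
  (fun u => complex.Im (f u)) * (fun u => complex.Im (f u)).
have nnE u : nn u = complex.Re (f u) ^+ 2 + complex.Im (f u) ^+ 2 by rewrite !expr2.
have nn0 u : nn u != 0 by rewrite nnE sqr_ReIm.
have dn : is_derive s 1 nn (complex.Re (f s) *: complex.Re l + complex.Re (f s) *: complex.Re l +
   (complex.Im (f s) *: complex.Im l + complex.Im (f s) *: complex.Im l)).
  exact: is_deriveD (is_deriveM fr fr) (is_deriveM fi fi).
have dnV := is_deriveV (nn0 s) dn.
have e0 : complex.Re (f s) ^+ 2 + complex.Im (f s) ^+ 2 != 0 by rewrite sqr_ReIm.
split.
  rewrite (_ : (fun u => _) = (fun u => complex.Re (f u)) * (fun u => (nn u)^-1)); last first.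
    by apply/funext => u; rewrite ReV -nnE.
  apply: is_derive_eq (is_deriveM fr dnV) _.
  rewrite ReN ReM ReV ImV expr2 ReM ImM /GRing.scale /= nnE.
  move: e0; move: (complex.Re (f s)) (complex.Im (f s)) (complex.Re l) (complex.Im l).
  move=> a b c d e0; field; rewrite e0 /=.
  have -> : (a * a - b * b) ^+ 2 + (a * b + b * a) ^+ 2 = (a ^+ 2 + b ^+ 2) ^+ 2 by ring.
  by rewrite expf_neq0.
rewrite (_ : (fun u => _) = - ((fun u => complex.Im (f u)) * (fun u => (nn u)^-1))); last first.
  by apply/funext => u; rewrite ImV -nnE.
apply: is_derive_eq (is_deriveN (is_deriveM fi dnV)) _.
rewrite ImN ImM ReV ImV expr2 ReM ImM /GRing.scale /= nnE.
move: e0; move: (complex.Re (f s)) (complex.Im (f s)) (complex.Re l) (complex.Im l).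
move=> a b c d e0; field; rewrite e0 /=.
have -> : (a * a - b * b) ^+ 2 + (a * b + b * a) ^+ 2 = (a ^+ 2 + b ^+ 2) ^+ 2 by ring.
by rewrite expf_neq0.
Qed.

Lemma cderive_cont f f' : (forall s, cderive f s (f' s)) -> ccont f.
Proof.
move=> df; split => s.
  by apply: differentiable_continuous; apply/derivable1_diffP; have [[]] := df s.
by apply: differentiable_continuous; apply/derivable1_diffP; have [_ []] := df s.
Qed.

Lemma cderive_unique f s l l' : cderive f s l -> cderive f s l' -> l = l'.
Proof.
move=> [fr fi] [fr' fi']; apply: complex_ext.
  by rewrite -(@derive_val _ _ _ _ _ _ _ fr) (@derive_val _ _ _ _ _ _ _ fr').
by rewrite -(@derive_val _ _ _ _ _ _ _ fi) (@derive_val _ _ _ _ _ _ _ fi').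
Qed.

Lemma cderive_shift f s l a : cderive f (s + a) l -> cderive (fun u => f (u + a)) s l.
Proof.
have dsh : is_derive s (1 : R) (fun u => u + a) 1 by exact: is_derive_shift.
move=> [fr fi]; split.
  by have := @is_derive1_comp _ (fun u => complex.Re (f u)) (fun u => u + a) s _ _ fr dsh; rewrite mulr1.
by have := @is_derive1_comp _ (fun u => complex.Im (f u)) (fun u => u + a) s _ _ fi dsh; rewrite mulr1.
Qed.

Let mvt_real (f df : R -> R) a b (B : R) : (forall s, is_derive s 1 f (df s)) ->
  (forall s, Num.min a b <= s <= Num.max a b -> `|df s| <= B) ->
  `|f b - f a| <= B * `|b - a|.
Proof.
move=> hf; wlog ab : a b / a <= b => [W H|].
  have [/W|/ltW/W] := leP a b; first exact.
  by rewrite minC maxC distrC [`|b - a|]distrC; apply.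
rewrite min_l// max_r// => H.
have cf : {within `[a, b], continuous f}.
  by apply: derivable_within_continuous => x _; have [] := hf x.
have [c cab ->] := MVT_segment ab (fun u _ => hf u) cf.
by rewrite normrM ler_wpM2r// H// (itvP cab).
Qed.

(** The mean value inequality; the factor [2] comes from treating real and
    imaginary parts separately. *)
Lemma cderive_mvt f f' a b (B : R) : (forall s, cderive f s (f' s)) ->
  (forall s, Num.min a b <= s <= Num.max a b -> normc (f' s) <= B) ->
  normc (f b - f a) <= 2 * B * `|b - a|.
Proof.
move=> df Bf; apply: le_trans (nc_ReIm _) _; rewrite !(ReD, ImD, ReN, ImN).
rewrite -mulrA mulr_natl mulr2n; apply: lerD.
  apply: (@mvt_real (fun u => complex.Re (f u)) (fun u => complex.Re (f' u))).
    by move=> s; have [] := df s.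
  by move=> s /Bf; apply: le_trans; exact: nc_Re.
apply: (@mvt_real (fun u => complex.Im (f u)) (fun u => complex.Im (f' u))).
  by move=> s; have [] := df s.
by move=> s /Bf; apply: le_trans; exact: nc_Im.
Qed.

Local Notation mu := (@lebesgue_measure R).

Lemma continuous_integrable_cc (f : R -> R) a b : continuous f ->
  mu.-integrable `[a, b] (EFin \o f).
Proof.
move=> cf; apply: continuous_compact_integrable; first exact: segment_compact.
exact: continuous_subspaceT.
Qed.

Lemma cintegralD a b f g : ccont f -> ccont g ->
  cintegral a b (fun s => f s + g s) = cintegral a b f + cintegral a b g.
Proof.
move=> [fr fi] [gr gi]; apply: complex_ext; rewrite ?ReD ?ImD /=.
  rewrite -RintegralD//; try exact: continuous_integrable_cc.
  by apply: eq_Rintegral => s _; rewrite ReD.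
rewrite -RintegralD//; try exact: continuous_integrable_cc.
by apply: eq_Rintegral => s _; rewrite ImD.
Qed.

Lemma cintegralZ a b z f : ccont f ->
  cintegral a b (fun s => z * f s) = z * cintegral a b f.
Proof.
move=> [fr fi]; apply: complex_ext; rewrite ?ReM ?ImM /=.
  rewrite -!RintegralZl//; try exact: continuous_integrable_cc.
  rewrite -RintegralB//; first by apply: eq_Rintegral => s _; rewrite ReM.
    by apply: continuous_integrable_cc => s; apply: cvgMr; exact: fr.
  by apply: continuous_integrable_cc => s; apply: cvgMr; exact: fi.
rewrite -!RintegralZl//; try exact: continuous_integrable_cc.
rewrite -RintegralD//; first by apply: eq_Rintegral => s _; rewrite ImM.
  by apply: continuous_integrable_cc => s; apply: cvgMr; exact: fi.
by apply: continuous_integrable_cc => s; apply: cvgMr; exact: fr.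
Qed.

Lemma eq_cintegral a b f g : f =1 g -> cintegral a b f = cintegral a b g.
Proof. by move=> /funext ->. Qed.

Lemma cintegral_le a b f (B : R -> R) : ccont f -> continuous B ->
  (forall s, a <= s <= b -> normc (f s) <= B s) ->
  normc (cintegral a b f) <= 2 * \int[mu]_(s in `[a, b]) B s.
Proof.
move=> [fr fi] cB fB; apply: le_trans (nc_ReIm _) _ => /=.
rewrite mulr_natl mulr2n; apply: lerD.
  apply: le_trans (le_normr_Rintegral _ _) _ => //; first exact: continuous_integrable_cc.
  apply: le_Rintegral => //; first 2 last.
  - by move=> s /=; rewrite in_itv /= => /fB; apply: le_trans; exact: nc_Re.
  - apply: (@continuous_integrable_cc (fun s => `|complex.Re (f s)|)) => s.
    by apply: cvg_norm; exact: fr.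
  - exact: continuous_integrable_cc.
apply: le_trans (le_normr_Rintegral _ _) _ => //; first exact: continuous_integrable_cc.
apply: le_Rintegral => //; first 2 last.
- by move=> s /=; rewrite in_itv /= => /fB; apply: le_trans; exact: nc_Im.
- apply: (@continuous_integrable_cc (fun s => `|complex.Im (f s)|)) => s.
  by apply: cvg_norm; exact: fi.
- exact: continuous_integrable_cc.
Qed.

Lemma cintegral_le_cst a b f (B : R) : a <= b -> ccont f ->
  (forall s, a <= s <= b -> normc (f s) <= B) ->
  normc (cintegral a b f) <= 2 * (B * (b - a)).
Proof.
move=> ab cf fB; apply: le_trans (cintegral_le cf (B := cst B) _ fB) _.
  exact: cst_continuous.
rewrite Rintegral_cst// (_ : fine (mu `[a, b]%classic) = b - a)//.
rewrite (@lebesgue_measure_itv R `[a, b]) /= lte_fin.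
by case: ltP => [_|ba]; rewrite //= (_ : b = a) ?subrr//; apply/eqP; rewrite eq_le ab ba.
Qed.

Lemma Rintegral_FTC (f F : R -> R) a b : a <= b ->
  (forall s, a <= s <= b -> is_derive s 1 F (f s)) ->
  {within `[a, b], continuous f} ->
  \int[mu]_(s in `[a, b]) f s = F b - F a.
Proof.
rewrite le_eqVlt => /predU1P[<- _ _|ab dF cf].
  by rewrite set_itv1 Rintegral_set1 subrr.
have cF s : a <= s <= b -> {for s, continuous F}.
  move=> sab; apply: differentiable_continuous; apply/derivable1_diffP.
  by have [] := dF s sab.
rewrite /Rintegral (@continuous_FTC2 _ f F)//.
- split.
  + by move=> x; rewrite in_itv /= => /andP[xa xb]; have [] := dF x _; rewrite ?(ltW xa) ?(ltW xb).
  + by apply: cvg_at_right_filter; apply: cF; rewrite lexx ltW.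
  + by apply: cvg_at_left_filter; apply: cF; rewrite lexx ltW.
- move=> x; rewrite in_itv /= => /andP[xa xb].
  by rewrite derive1E; apply: derive_val; apply: dF; rewrite (ltW xa) (ltW xb).
Qed.

Lemma cintegral_FTC a b f F : a <= b -> ccont f -> (forall s, cderive F s (f s)) ->
  cintegral a b f = F b - F a.
Proof.
move=> ab [fr fi] dF; apply: complex_ext; rewrite ?(ReD, ReN, ImD, ImN) /=.
  apply: (@Rintegral_FTC (fun s => complex.Re (f s)) (fun s => complex.Re (F s))) => //.
    by move=> s _; have [] := dF s.
  exact: continuous_subspaceT.
apply: (@Rintegral_FTC (fun s => complex.Im (f s)) (fun s => complex.Im (F s))) => //.
  by move=> s _; have [] := dF s.
exact: continuous_subspaceT.
Qed.

End ComplexCurves.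

Section SingularIntegral.
Variables (R : realType) (alpha : R).
Hypothesis halpha : 0 < alpha < 1.
Local Notation mu := (@lebesgue_measure R).

Lemma continuous_kernel (a e : R) : 0 < e ->
  continuous (fun s : R => (e + `|s - a|) `^ (alpha - 2)).
Proof.
move=> e0 s.
apply: (@continuous_comp _ _ _ (fun s => e + `|s - a|) (fun x => x `^ (alpha - 2))).
  apply: cvgD; first exact: cvg_cst.
  by apply: cvg_norm; apply: cvgB; [exact: cvg_id|exact: cvg_cst].
apply: differentiable_continuous; apply/derivable1_diffP.
have x0 : 0 < e + `|s - a| by rewrite ltr_pwDl.
by have [] := is_derive1_powR (alpha - 2) x0.
Qed.

Let half (a e u v : R) : 0 < e -> u <= v -> (v <= a) || (a <= u) ->
  \int[mu]_(s in `[u, v]) ((e + `|s - a|) `^ (alpha - 2)) <= e `^ (alpha - 1) / (1 - alpha).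
Proof.
move=> e0 uv avu; have [al0 al1] := andP halpha.
have a1 : 1 - alpha != 0 by rewrite subr_eq0 gt_eqF.
pose sg : R := if v <= a then -1 else 1.
have sgE s : u <= s <= v -> `|s - a| = sg * (s - a).
  rewrite /sg; case: ifPn avu => [va _|_ /= au] /andP[us sv].
    by rewrite mulN1r ler0_norm// subr_le0 (le_trans sv).
  by rewrite mul1r ger0_norm// subr_ge0 (le_trans au).
have sg2 : sg * sg = 1 by rewrite /sg; case: ifP; rewrite ?mulrNN mul1r.
have y0 s : u <= s <= v -> 0 < e + sg * (s - a).
  by move=> /sgE <-; rewrite ltr_pwDl.
pose F s := - sg / (1 - alpha) * (e + sg * (s - a)) `^ (alpha - 1).
have -> : \int[mu]_(s in `[u, v]) ((e + `|s - a|) `^ (alpha - 2)) = F v - F u.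
  apply: Rintegral_FTC => //.
  - move=> s us; rewrite sgE//.
    have dlin : is_derive s (1 : R) (fun s => e + sg * (s - a)) sg.
      apply: is_derive_eq (is_deriveD (is_derive_cst e s 1)
        (is_deriveZ sg (is_derive_shift s 1 (- a)))) _.
      by rewrite add0r /GRing.scale /= mulr1.
    have := @is_derive1_comp _ (fun x => x `^ (alpha - 1)) (fun s => e + sg * (s - a)) s _ _
      (is_derive1_powR (alpha - 1) (y0 s us)) dlin.
    move=> /(@is_deriveZ _ _ _ _ (- sg / (1 - alpha))) H.
    apply: is_derive_eq H _; rewrite /GRing.scale /=.
    rewrite (_ : alpha - 1 - 1 = alpha - 2); last by lra.
    rewrite [LHS](_ : _ = (sg * sg) * ((1 - alpha) / (1 - alpha)) *
      (e + sg * (s - a)) `^ (alpha - 2)); last by ring.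
    by rewrite sg2 divff// !mul1r.
  - by apply: continuous_subspaceT; exact: continuous_kernel.
have P x : 0 <= x `^ (alpha - 1) / (1 - alpha).
  by rewrite divr_ge0 ?powR_ge0//; lra.
have le_e s : u <= s <= v -> (e + sg * (s - a)) `^ (alpha - 1) / (1 - alpha) <=
    e `^ (alpha - 1) / (1 - alpha).
  move=> us; rewrite ler_pM2r ?invr_gt0; last lra.
  rewrite -[alpha - 1]opprB !powRN lef_pV2 ?posrE ?powR_gt0 ?y0//.
  apply: ge0_ler_powR; rewrite ?nnegrE; try lra; last first.
    by rewrite lerDl -sgE.
  by rewrite ltW// y0.
have Hu : u <= u <= v by rewrite lexx.
have Hv : u <= v <= v by rewrite lexx uv.
move/le_e: Hu => Hu; move/le_e: Hv => Hv.
have := P (e + sg * (u - a)); have := P (e + sg * (v - a)).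
rewrite [X in _ -> _ -> X <= _](_ : F v - F u = sg * ((e + sg * (u - a)) `^ (alpha - 1) / (1 - alpha)) -
   sg * ((e + sg * (v - a)) `^ (alpha - 1) / (1 - alpha))); last by rewrite /F; ring.
by rewrite /sg in Hu Hv *; case: ifP Hu Hv => _ Hu Hv; lra.
Qed.

(** A double pole at distance [e] from the curve, against a function that
    vanishes to the order [alpha], has this size. *)
Lemma kernel_integral (a e L : R) : 0 < e -> 0 < L ->
  \int[mu]_(s in `[0, L]) ((e + `|s - a|) `^ (alpha - 2)) <=
    2 * (e `^ (alpha - 1) / (1 - alpha)).
Proof.
move=> e0 L0; have [al0 al1] := andP halpha.
have P : 0 <= e `^ (alpha - 1) / (1 - alpha) by rewrite divr_ge0 ?powR_ge0//; lra.
have [La|aL] := leP L a.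
  by apply: le_trans (half e0 (ltW L0) _) _; rewrite ?La//; lra.
have [a0|a0] := leP a 0.
  by apply: le_trans (half e0 (ltW L0) _) _; rewrite ?a0 ?orbT//; lra.
have cK := @continuous_kernel a e e0.
have := @Rintegral_itvB _ (fun s => (e + `|s - a|) `^ (alpha - 2)) (BLeft 0) (BRight L) a
  (continuous_integrable_cc _ _ cK).
rewrite !bnd_simp ltW// => /(_ isT); rewrite ltW// => /(_ isT).
rewrite Rintegral_itv_obnd_cbnd; last first.
  apply: integrableS (continuous_integrable_cc a L cK) => //.
  exact: subset_itv_oc_cc.
have H1 := @half a e 0 a e0 (ltW a0); have H2 := @half a e a L e0 (ltW aL).
move=> /eqP; rewrite subr_eq => /eqP ->.
rewrite mulr_natl mulr2n; apply: lerD; first by apply: H2; rewrite lexx orbT.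
by apply: H1; rewrite lexx.
Qed.

End SingularIntegral.

(** * Hoelder classes on the line and Taylor jets along a curve *)

Section HolderLine.
Variables (R : realType) (alpha rho : R).
Hypotheses (halpha : 0 < alpha < 1) (rho0 : 0 < rho).
Implicit Types (f g h : R -> R[i]) (s L A B : R) (m : nat).

Definition holder f A : Prop :=
  forall s s', `|s - s'| <= rho -> normc (f s - f s') <= A * `|s - s'| `^ alpha.

(** [f] is of class [C^(m, alpha)] with constant [A].  The Hoelder condition is
    imposed at distances at most [rho] only, so that it can be checked on arcs of
    a closed curve that do not wrap around. *)
Fixpoint hold m f A : Prop :=
  if m is m'.+1 then
    (forall s, normc (f s) <= A) /\
    exists2 f', forall s, cderive f s (f' s) & hold m' f' A
  else (forall s, normc (f s) <= A) /\ holder f A.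

Lemma hold_bound m f A s : hold m f A -> normc (f s) <= A.
Proof. by case: m => [|m] [H _]. Qed.

Lemma hold_ge0 m f A : hold m f A -> 0 <= A.
Proof. by move=> /(hold_bound 0); apply: le_trans; exact: nc_ge0. Qed.

Lemma hold_mono m f A B : A <= B -> hold m f A -> hold m f B.
Proof.
move=> AB; elim: m f => [|m IH] f /= [fA H]; split.
- by move=> s; exact: le_trans AB.
- move=> s s' ss'; apply: le_trans (H s s' ss') _.
  by rewrite ler_wpM2r ?powR_ge0.
- by move=> s; exact: le_trans AB.
- by have [f' df hf] := H; exists f' => //; exact: IH.
Qed.

Let lip : R := 1 + 2 * (rho / rho `^ alpha).

Let lip_ge1 : 1 <= lip.
Proof. by rewrite /lip lerDl mulr_ge0// divr_ge0 ?powR_ge0 ?ltW. Qed.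

Let lip_ge0 : 0 <= lip.
Proof. exact: le_trans ler01 lip_ge1. Qed.

Let lip_holder f f' A : 0 <= A -> (forall s, cderive f s (f' s)) ->
  (forall s, normc (f' s) <= A) -> holder f (lip * A).
Proof.
move=> A0 df f'A s s' ss'.
apply: le_trans (cderive_mvt df (B := A) _) _; first by move=> u _; exact: f'A.
have [->|h0] := eqVneq `|s - s'| 0.
  by rewrite mulr0 mulr_ge0 ?powR_ge0 ?mulr_ge0.
have {}h0 : 0 < `|s - s'| by rewrite lt_def h0 normr_ge0.
have P := powR_sublinear halpha h0 ss'.
have ra0 : 0 < rho `^ alpha by rewrite powR_gt0.
have {}P : `|s - s'| <= `|s - s'| `^ alpha * (rho / rho `^ alpha).
  by rewrite mulrA ler_pdivlMr// mulrC.
apply: (@le_trans _ _ (2 * A * (`|s - s'| `^ alpha * (rho / rho `^ alpha)))).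
  by rewrite ler_wpM2l ?mulr_ge0.
rewrite [leLHS](_ : _ = 2 * (rho / rho `^ alpha) * A * `|s - s'| `^ alpha); last by ring.
by rewrite !ler_wpM2r ?powR_ge0// /lip lerDr.
Qed.

(** A function with a bounded derivative is Lipschitz, thus Hoelder continuous on
    arcs of bounded length. *)
Lemma hold_pred m : exists2 C : R, 0 <= C &
  forall f A, hold m.+1 f A -> hold m f (C * A).
Proof.
exists lip; first exact: lip_ge0.
move=> f A; elim: m f => [|m IH] f hf; have A0 := hold_ge0 hf;
  move: hf => /= [fA [f' df hf]]; split.
- by move=> s; apply: le_trans (fA s) _; rewrite ler_peMl.
- by apply: lip_holder df _ => // s; case: hf => /(_ s).
- by move=> s; apply: le_trans (fA s) _; rewrite ler_peMl.
- by exists f' => //; apply: IH.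
Qed.

Lemma hold_le m p : (m <= p)%N -> exists2 C : R, 0 <= C &
  forall f A, hold p f A -> hold m f (C * A).
Proof.
elim: p => [|p IH]; first by rewrite leqn0 => /eqP->; exists 1 => // f A; rewrite mul1r.
rewrite leq_eqVlt => /predU1P[->|]; first by exists 1 => // f A; rewrite mul1r.
rewrite ltnS => /IH[C C0 HC]; have [K K0 HK] := hold_pred p.
exists (C * K); first exact: mulr_ge0.
by move=> f A /HK/HC; rewrite mulrA.
Qed.

Lemma hold_cst m z A : normc z <= A -> hold m (fun=> z) A.
Proof.
move=> zA; have A0 := le_trans (nc_ge0 _) zA.
elim: m z zA => [|m IH] z zA /=; split => //.
  by move=> s s' _; rewrite subrr nc0 mulr_ge0// powR_ge0.
by exists (fun=> 0); [move=> s; exact: cderive_cst|apply: IH; rewrite nc0].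
Qed.

Lemma holdD m f g A B : hold m f A -> hold m g B -> hold m (fun s => f s + g s) (A + B).
Proof.
elim: m f g => [|m IH] f g /= [fA Hf] [gB Hg]; split.
- by move=> s; apply: le_trans (ncD _ _) _; rewrite lerD.
- move=> s s' ss'; rewrite opprD addrACA; apply: le_trans (ncD _ _) _.
  by rewrite mulrDl lerD ?Hf ?Hg.
- by move=> s; apply: le_trans (ncD _ _) _; rewrite lerD.
- case: Hf => f' df hf; case: Hg => g' dg hg.
  by exists (fun s => f' s + g' s); [move=> s; exact: cderiveD|exact: IH].
Qed.

Lemma holdM m : exists2 C : R, 0 <= C & forall f g A B,
  hold m f A -> hold m g B -> hold m (fun s => f s * g s) (C * (A * B)).
Proof.
elim: m => [|m [C C0 HC]].
  exists 2 => // f g A B Hf Hg; have A0 := hold_ge0 Hf; have B0 := hold_ge0 Hg.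
  move: Hf Hg => /= [fA Hf] [gB Hg]; split => [s|s s' ss'].
    apply: (@le_trans _ _ (A * B)); first by rewrite ncM ler_pM ?nc_ge0.
    by rewrite ler_peMl ?mulr_ge0//; lra.
  have -> : f s * g s - f s' * g s' = (f s - f s') * g s + f s' * (g s - g s') by ring.
  apply: le_trans (ncD _ _) _; rewrite !ncM.
  apply: (@le_trans _ _ (A * `|s - s'| `^ alpha * B + A * (B * `|s - s'| `^ alpha))).
    by apply: lerD; apply: ler_pM; rewrite ?nc_ge0 ?Hf ?Hg.
  by rewrite le_eqVlt; apply/orP; left; apply/eqP; ring.
have [K K0 HK] := hold_pred m.
exists (1 + C * K + C * K); first by rewrite !addr_ge0 ?mulr_ge0.
move=> f g A B Hf Hg; have A0 := hold_ge0 Hf; have B0 := hold_ge0 Hg.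
have Lf := HK _ _ Hf; have Lg := HK _ _ Hg.
move: Hf Hg => /= [fA [f' df hf]] [gB [g' dg hg]].
have AB0 : 0 <= A * B by exact: mulr_ge0.
have CK0 : 0 <= C * K * (A * B) by rewrite !mulr_ge0.
split.
  move=> s; apply: (@le_trans _ _ (A * B)); first by rewrite ncM ler_pM ?nc_ge0.
  by rewrite !mulrDl mul1r; lra.
exists (fun s => f' s * g s + f s * g' s); first by move=> s; exact: cderiveM.
apply: hold_mono (holdD (HC _ _ _ _ hf Lg) (HC _ _ _ _ Lf hg)).
rewrite [leLHS](_ : _ = C * K * (A * B) + C * K * (A * B)); last by ring.
by rewrite !mulrDl mul1r; lra.
Qed.

Lemma hold_conj m f A : hold m f A -> hold m (fun s => (f s)^*%C) A.
Proof.
elim: m f => [|m IH] f /= [fA Hf]; split.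
- by move=> s; rewrite nc_conj.
- by move=> s s' ss'; rewrite -rmorphB nc_conj Hf.
- by move=> s; rewrite nc_conj.
- case: Hf => f' df hf.
  by exists (fun s => (f' s)^*%C); [move=> s; exact: cderive_conj|exact: IH].
Qed.

Lemma hold_exp m f A k : hold m f A -> exists B, hold m (fun s => f s ^+ k) B.
Proof.
move=> Hf; elim: k => [|k [B HB]].
  by exists 1; rewrite (_ : (fun s => _) = fun=> 1); [apply: hold_cst; rewrite nc1|
    apply/funext => s; rewrite expr0].
have [C _ HC] := holdM m; exists (C * (A * B)).
rewrite (_ : (fun s => _) = fun s => f s * f s ^+ k); first exact: HC.
by apply/funext => s; rewrite exprS.
Qed.

Lemma nderive0 f : nderive 0 f = f.
Proof. by apply/funext => s; rewrite /nderive /=; case: (f s). Qed.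

Lemma cderive_nderive m f i s : Cm m f -> (i < m)%N ->
  cderive (nderive i f) s (nderive i.+1 f s).
Proof.
move=> [[fr _] [fi _]] im; split.
  by apply: DeriveDef; [exact: fr|rewrite /nderive /= derive1E].
by apply: DeriveDef; [exact: fi|rewrite /nderive /= derive1E].
Qed.

Lemma ccont_nderive m f i : Cm m f -> (i <= m)%N -> ccont (nderive i f).
Proof.
move=> Cf; rewrite leq_eqVlt => /predU1P[->|im]; last first.
  by apply: cderive_cont => s; exact: cderive_nderive Cf im.
by case: Cf => [[_ cr] [_ ci]]; split.
Qed.

Lemma ccont_Cm m f : Cm m f -> ccont f.
Proof. by move=> Cf; rewrite -(nderive0 f); exact: ccont_nderive Cf _. Qed.

Lemma hold_nderive m f A : Cm m f ->
  (forall i s, (i <= m)%N -> normc (nderive i f s) <= A) ->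
  holder (nderive m f) A -> hold m f A.
Proof.
move=> Cf fA Hf.
suff H p : (p <= m)%N -> hold p (nderive (m - p) f) A.
  by have := H m (leqnn m); rewrite subnn nderive0.
elim: p => [|p IH] pm /=; split.
- by move=> s; apply: fA; rewrite subn0.
- by rewrite subn0.
- by move=> s; apply: fA; exact: leq_subr.
- exists (nderive (m - p) f); last by apply: IH; exact: ltnW.
  move=> s; rewrite -[in nderive (m - p)](@prednK (m - p)) ?subn_gt0// -subnS.
  by apply: cderive_nderive Cf _; rewrite -subSn// subSS leq_subr.
Qed.

Section Periodic.
Variable L : R.
Hypothesis L0 : 0 < L.

Lemma periodic_nat (T : Type) (f : R -> T) : (forall s, f (s + L) = f s) ->
  forall k s, f (s + L *+ k) = f s.
Proof.
move=> pf; elim=> [|k IH] s; first by rewrite mulr0n addr0.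
by rewrite mulrSr addrA pf IH.
Qed.

Lemma periodic_int (T : Type) (f : R -> T) : (forall s, f (s + L) = f s) ->
  forall (k : int) s, f (s + L *~ k) = f s.
Proof.
move=> pf [k|k] s; first exact: periodic_nat.
by rewrite NegzE mulrNz -pmulrn -[in RHS](subrK (L *+ k.+1) s) periodic_nat.
Qed.

Lemma period_reduce s : exists k : int, 0 <= s - L *~ k < L.
Proof.
exists (Num.floor (s / L)).
have := floor_le_tmp (s / L); have := lt_succ_floor (s / L).
rewrite ltr_pdivrMr// ler_pdivlMr// => h1 h2.
rewrite -mulrzr [L * _]mulrC subr_ge0 h2/= ltrBlDr.
by move: h1; rewrite intrD mulrDl mul1r addrC.
Qed.

Lemma periodic_bounded f : ccont f -> (forall s, f (s + L) = f s) ->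
  exists2 A : R, 0 <= A & forall s, normc (f s) <= A.
Proof.
move=> cf pf.
have cn : {within `[0, L], continuous (fun s => normc (f s))}.
  by apply: continuous_subspaceT; exact: continuous_normc.
have [c _ Hc] := EVT_max (ltW L0) cn.
exists (normc (f c)); first exact: nc_ge0.
move=> s; have [k /andP[k0 kL]] := period_reduce s.
rewrite -[s](subrK (L *~ k)) periodic_int//; apply: Hc.
by rewrite in_itv /= k0 ltW.
Qed.

Lemma cderive_periodic f f' : (forall s, cderive f s (f' s)) ->
  (forall s, f (s + L) = f s) -> forall s, f' (s + L) = f' s.
Proof.
move=> df pf s; apply: cderive_unique (df s).
have := cderive_shift (df (s + L)).
by congr (cderive _ _ _); apply/funext => u; rewrite pf.
Qed.

Lemma nderive_periodic m f i : Cm m f -> (i <= m)%N ->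
  (forall s, f (s + L) = f s) -> forall s, nderive i f (s + L) = nderive i f s.
Proof.
move=> Cf im pf; elim: i im => [|i IH] im; first by rewrite nderive0.
apply: (@cderive_periodic (nderive i f)); last by apply: IH; exact: ltnW.
by move=> s; exact: cderive_nderive Cf im.
Qed.

Lemma hold_Cm m f : Cm m.+1 f -> (forall s, f (s + L) = f s) -> exists A, hold m f A.
Proof.
move=> Cf pf.
have bd i : (i <= m.+1)%N -> exists2 A : R, 0 <= A & forall s, normc (nderive i f s) <= A.
  by move=> im; apply: periodic_bounded;
    [exact: ccont_nderive Cf im|exact: nderive_periodic Cf im pf].
have [A A0 HA] : exists2 A : R, 0 <= A &
    forall i s, (i <= m.+1)%N -> normc (nderive i f s) <= A.
  have : forall p, (p <= m.+1)%N -> exists2 A : R, 0 <= A &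
      forall i s, (i <= p)%N -> normc (nderive i f s) <= A.
    elim=> [|p IH] pm.
      by have [A A0 HA] := bd 0 pm; exists A => // i s; rewrite leqn0 => /eqP->.
    have [A A0 HA] := IH (ltnW pm); have [B B0 HB] := bd _ pm.
    exists (A + B); first exact: addr_ge0.
    move=> i s; rewrite leq_eqVlt => /predU1P[->|ip].
      by apply: le_trans (HB s) _; rewrite lerDr.
    by apply: le_trans (HA i s ip) _; rewrite lerDl.
  exact.
exists (lip * A).
have Cf' : Cm m f.
  split; split.
  - by move=> i im s; case: Cf => [[H _] _]; apply: H; exact: leqW.
  - by have [] := ccont_nderive Cf (leqnSn m).
  - by move=> i im s; case: Cf => [_ [H _]]; apply: H; exact: leqW.
  - by have [] := ccont_nderive Cf (leqnSn m).
apply: hold_nderive => //.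
  by move=> i s im; apply: le_trans (HA i s (leqW im)) _; rewrite ler_peMl.
apply: (@lip_holder _ (nderive m.+1 f)) => //.
  by move=> s; exact: cderive_nderive Cf _.
by move=> s; exact: HA.
Qed.

End Periodic.

End HolderLine.

Section TaylorJets.
Variables (R : realType) (alpha rho L : R) (gam g : R -> R[i]).
Hypotheses (halpha : 0 < alpha < 1) (rho0 : 0 < rho).
Hypothesis dgam : forall s, cderive gam s (g s).
Hypothesis g1 : forall s, normc (g s) = 1.
Hypothesis g_per : forall s, g (s + L) = g s.
Implicit Types (f : R -> R[i]) (h : nat -> R -> R[i]) (s A B : R) (m : nat).

(** The [h i] are the successive derivatives of [f] with respect to the complex
    variable [gam]. *)
Definition arc_jet m f h A : Prop :=
  [/\ forall s, h 0 s = f s,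
      forall i s, (i < m)%N -> cderive (h i) s (g s * h i.+1 s),
      forall i s, (i <= m)%N -> normc (h i s) <= A,
      forall i s, (i <= m)%N -> h i (s + L) = h i s &
      holder alpha rho (h m) A].

(** Since [g] has modulus one, differentiation along the curve is
    multiplication of the derivative by the conjugate of [g]. *)
Lemma arc_jet_exists m B : hold alpha rho m g B -> exists2 C : R, 0 <= C &
  forall f A, hold alpha rho m f A -> (forall s, f (s + L) = f s) ->
  exists h, arc_jet m f h (C * A).
Proof.
elim: m B => [|m IH] B gB.
  exists 1 => // f A [fA Hf] pf; exists (fun=> f); rewrite mul1r.
  by split.
have [K K0 HK] := hold_pred halpha rho0 m.
have [C0 C00 HC0] := holdM halpha rho0 m.
have {gB} := HK _ _ gB; move: (K * B) => {}B gB; have B0 := hold_ge0 gB.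
have [C1 C10 HC1] := IH _ gB.
exists (1 + C1 * (C0 * B)); first by rewrite addr_ge0 // !mulr_ge0.
move=> f A Hf pf; have A0 := hold_ge0 Hf.
move: Hf => /= [fA [f' df hf]].
have hf2 := HC0 _ _ _ _ (hold_conj gB) hf.
have [|h [h0 dh hA hp hh]] := HC1 _ _ hf2.
  by move=> s; rewrite g_per (cderive_periodic df pf).
pose D := C1 * (C0 * (B * A)).
have D0 : 0 <= D by rewrite !mulr_ge0.
have AD : A <= (1 + C1 * (C0 * B)) * A.
  by rewrite ler_peMl// lerDl !mulr_ge0.
have DD : D <= (1 + C1 * (C0 * B)) * A.
  rewrite mulrDl mul1r (_ : D = C1 * (C0 * B) * A); first by rewrite lerDr.
  by rewrite /D; ring.
exists (fun i => if i is j.+1 then h j else f); split => //.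
- case=> [|i] s im; last by apply: dh.
  by rewrite h0 mulrA nc_mul_conj// mul1r.
- case=> [|i] s im; first exact: le_trans AD.
  by apply: le_trans DD; exact: hA.
- by case=> [|i] s im; [exact: pf|exact: hp].
- move=> s s' ss'; apply: le_trans (hh s s' ss') _.
  by rewrite ler_wpM2r ?powR_ge0.
Qed.

(** The Taylor polynomial at [gam s]. *)
Definition arc_poly m h s : {poly R[i]} :=
  rebase (- gam s) (\poly_(i < m.+1) (h i s / (i`!)%:R)).

Lemma derivn_at (P : {poly R[i]}) i a : (P^`(i)).[a] = (rebase a P)`_i * (i`!)%:R.
Proof.
have E : rebase a (P^`(i)) = (rebase a P)^`(i).
  elim: i => [//|i IH]; rewrite !derivnS -IH /rebase deriv_comp.
  by rewrite derivD derivX derivC addr0 mulr1.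
have := horner_rebase a (P^`(i)) 0; rewrite add0r => <-.
by rewrite E horner_coef0 coef_derivn addn0 ffactnn mulr_natr.
Qed.

Lemma fact_neq0 i : (i`!)%:R != 0 :> R[i].
Proof. by rewrite pnatr_eq0 -lt0n fact_gt0. Qed.

Lemma rebase_arc_poly m h s :
  rebase (gam s) (arc_poly m h s) = \poly_(i < m.+1) (h i s / (i`!)%:R).
Proof.
by rewrite /arc_poly rebase_add subrr /rebase addr0 comp_polyXr.
Qed.

Lemma derivn_arc_poly m h s i : (i <= m)%N -> ((arc_poly m h s)^`(i)).[gam s] = h i s.
Proof.
by move=> im; rewrite derivn_at rebase_arc_poly coef_poly ltnS im mulfVK ?fact_neq0.
Qed.

Lemma size_arc_poly m h s : (size (arc_poly m h s) <= m.+1)%N.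
Proof. by rewrite size_rebase size_poly. Qed.

(** Taylor's theorem along the curve: the remainder of order [i] has derivative
    [g] times the remainder of order [i.+1], so the estimate descends from the
    Hoelder condition on the last derivative. *)
Lemma arc_taylor m f h A : arc_jet m f h A -> forall j s s', (j <= m)%N ->
  `|s - s'| <= rho ->
  normc (h (m - j)%N s - ((arc_poly m h s')^`(m - j)).[gam s]) <=
    2 ^+ j * A * `|s - s'| ^+ j * `|s - s'| `^ alpha.
Proof.
move=> [h0 dh hA _ hh].
have A0 : 0 <= A := le_trans (nc_ge0 (h 0%N 0)) (hA 0%N 0 (leq0n m)).
elim=> [|j IH] s s' jm ss'.
  rewrite subn0 expr0 mul1r expr0 mulr1.
  have -> : ((arc_poly m h s')^`(m)).[gam s] = h m s'.
    rewrite -(derivn_arc_poly h s' (leqnn m)).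
    have : (size ((arc_poly m h s')^`(m))%R <= 1)%N.
      apply/leq_sizeP => i i1; rewrite coef_derivn nth_default ?mul0rn//.
      by rewrite (leq_trans (size_arc_poly _ _ _))// -addn1 leq_add2l.
    by move=> /size1_polyC ->; rewrite !hornerC.
  exact: hh.
set i := (m - j.+1)%N.
have iE : (m - j)%N = i.+1 by rewrite /i subnSK.
pose rem u := h i u - ((arc_poly m h s')^`(i)).[gam u].
pose rem' u := g u * (h i.+1 u - ((arc_poly m h s')^`(i.+1)).[gam u]).
have im : (i < m)%N by rewrite /i -subSn// subSS leq_subr.
have drem u : cderive rem u (rem' u).
  rewrite /rem' mulrBr derivnS; apply: cderiveB; first exact: dh.
  exact: cderive_horner.
have rem0 : rem s' = 0 by rewrite /rem derivn_arc_poly ?subrr// ltnW.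
have /= := cderive_mvt (a := s') (b := s) (B := 2 ^+ j * A * `|s - s'| ^+ j * `|s - s'| `^ alpha)
  drem.
rewrite rem0 subr0 => H; apply: le_trans (H _) _.
  move=> u us; rewrite /rem' ncM g1 mul1r -iE.
  have us' : `|u - s'| <= `|s - s'|.
    have [ss|/ltW ss] := leP s' s; move: us.
      rewrite (min_l ss) (max_r ss) => /andP[u1 u2].
      by rewrite !ger0_norm ?subr_ge0// lerD2r.
    rewrite (min_r ss) (max_l ss) => /andP[u1 u2].
    by rewrite !ler0_norm ?subr_le0// !opprB lerD2l lerN2.
  apply: le_trans (IH u s' (ltnW jm) (le_trans us' ss')) _.
  apply: ler_pM; rewrite ?powR_ge0 ?mulr_ge0 ?exprn_ge0//.
    by rewrite ler_wpM2l ?mulr_ge0 ?exprn_ge0// lerXn2r ?nnegrE.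
  by apply: ge0_ler_powR; rewrite ?nnegrE//; case/andP: halpha => /ltW.
by rewrite !exprS le_eqVlt; apply/orP; left; apply/eqP; ring.
Qed.

(** The estimates of [arc_taylor] for all orders at once; [K] compares the length
    of the arc with the scale [r]. *)
Lemma arc_taylor_pnorm m K : 1 <= K -> exists2 C : R, 0 <= C &
  forall f h A, arc_jet m f h A -> forall s s' r, `|s - s'| <= rho -> 0 < r ->
  `|s - s'| <= K * r ->
  pnorm r (rebase (gam s) (arc_poly m h s - arc_poly m h s')) <= C * A * r ^+ m * r `^ alpha.
Proof.
move=> K1; have K0 : 0 <= K by lra.
exists (m.+1%:R * (2 ^+ m * K ^+ m * K)); first by rewrite !mulr_ge0 ?exprn_ge0.
move=> f h A Hj s s' r ss' r0 sKr; have r0' := ltW r0.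
have A0 : 0 <= A.
  by case: Hj => _ _ hA _ _; exact: le_trans (nc_ge0 (h 0%N 0)) (hA 0%N 0 (leq0n m)).
rewrite (@pnormE _ _ _ m.+1); last first.
  rewrite size_rebase (leq_trans (size_polyD _ _))// geq_max size_polyN.
  by rewrite !size_arc_poly.
apply: (@le_trans _ _ (\sum_(i < m.+1) (2 ^+ m * K ^+ m * K * A * r ^+ m * r `^ alpha))); last first.
  by rewrite sumr_const card_ord -mulr_natl; rewrite le_eqVlt; apply/orP; left; apply/eqP; ring.
apply: ler_sum => -[i /= im1] _; have im : (i <= m)%N by [].
have ge1 (x : R) k : 1 <= x -> 1 <= x ^+ k by exact: exprn_ege1.
have cE : (rebase (gam s) (arc_poly m h s - arc_poly m h s'))`_i =
   (h i s - ((arc_poly m h s')^`(i)).[gam s]) / (i`!)%:R.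
  rewrite -[LHS](mulfK (fact_neq0 i)) -derivn_at derivnB hornerD hornerN.
  by rewrite derivn_arc_poly.
rewrite cE ncM ncV nc_nat.
have T := arc_taylor Hj (leq_subr i m) ss'; rewrite subKn// in T.
apply: (@le_trans _ _ (normc (h i s - ((arc_poly m h s')^`(i)).[gam s]) * r ^+ i)).
  rewrite ler_wpM2r ?exprn_ge0// ler_piMr ?nc_ge0// invf_le1 ?ltr0n ?fact_gt0//.
  by rewrite ler1n fact_gt0.
apply: le_trans (ler_wpM2r (exprn_ge0 i r0') T) _.
apply: (@le_trans _ _ (2 ^+ m * A * (K ^+ m * r ^+ (m - i)) * (K * r `^ alpha) * r ^+ i)).
  rewrite ler_wpM2r ?exprn_ge0// ler_pM ?powR_ge0 ?mulr_ge0 ?exprn_ge0//; last first.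
    exact: powR_le_scale.
  rewrite ler_pM ?mulr_ge0 ?exprn_ge0// ?ler_wpM2r//.
    by rewrite ler_weXn2l ?leq_subr//; lra.
  apply: (@le_trans _ _ ((K * r) ^+ (m - i))).
    by rewrite lerXn2r ?nnegrE ?mulr_ge0.
  by rewrite exprMn ler_wpM2r ?exprn_ge0// ler_weXn2l// leq_subr.
rewrite -[in leRHS](subnK im) [in X in _ <= _ * X * _]exprD.
by rewrite subnK// le_eqVlt; apply/orP; left; apply/eqP; ring.
Qed.

Lemma arc_poly_bound m : exists2 C : R, 0 <= C & forall f h A, arc_jet m f h A ->
  forall s, pnorm 1 (rebase (gam s) (arc_poly m h s)) <= C * A.
Proof.
exists m.+1%:R => // f h A [_ _ hA _ _] s.
rewrite rebase_arc_poly (@pnormE _ _ _ m.+1) ?size_poly//.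
rewrite mulr_natl -[X in _ *+ X]card_ord -sumr_const; apply: ler_sum => -[i /= im] _.
rewrite coef_poly im expr1n mulr1 ncM ncV nc_nat; apply: le_trans (hA i s im).
by rewrite ler_piMr ?nc_ge0// invf_le1 ?ltr0n ?fact_gt0// ler1n fact_gt0.
Qed.

End TaylorJets.

(** * The plane as a metric space, and finite families of constants *)

Section Plane.
Variable R : realType.
Implicit Types (x y z : R[i]) (A : set R[i]) (e c : R).

Lemma nbhs_nc x A : nbhs x A <-> exists2 e : R, 0 < e & forall y, normc (x - y) < e -> A y.
Proof.
split=> [/nbhs_ballP[e /= e0 He]|[e e0 He]].
  have [eR eI] : 0 < complex.Re e /\ complex.Im e = 0.
    by move: e0; rewrite ltcE /= => /andP[/eqP -> ->].
  exists (complex.Re e) => // y xy; apply: He; rewrite /ball /= -ncE.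
  by rewrite ltcE /= eI eqxx.
apply/nbhs_ballP; exists e%:C; first by rewrite /= ltcR.
by move=> y; rewrite /ball /= -ncE ltcR => /He.
Qed.

Lemma open_nc A : open A <-> forall x, A x -> exists2 e : R, 0 < e & forall y, normc (x - y) < e -> A y.
Proof. by rewrite openE; split => H x /H /nbhs_nc. Qed.

Lemma bounded_nc A : bounded_set A -> exists2 B : R, 0 <= B & forall x, A x -> normc x <= B.
Proof.
move=> -[M [Mr HM]].
have /complex_realP[k kE] := Mr.
exists (Num.max 0 (k + 1)); first by rewrite le_max lexx.
move=> x Ax; rewrite le_max; apply/orP; right.
have := HM (k + 1)%:C; rewrite kE ltcR ltrDl => /(_ ltr01) /(_ x Ax) /=.
by rewrite -ncE lecR.
Qed.

Lemma fin_ub (I : finType) (P : I -> R -> Prop) :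
  (forall i, exists2 C : R, 0 <= C & P i C) ->
  (forall i C C', C <= C' -> P i C -> P i C') ->
  exists2 C : R, 0 <= C & forall i, P i C.
Proof.
move=> H mono.
have [C HC] : {C : I -> R & forall i, 0 <= C i /\ P i (C i)}.
  apply: (@choice _ _ (fun i c => 0 <= c /\ P i c)) => i.
  by have [c c0 Pc] := H i; exists c.
exists (\sum_i C i); first by apply: sumr_ge0 => i _; case: (HC i).
move=> i; apply: (mono i (C i)); last by case: (HC i).
by rewrite (bigD1 i)//= lerDl sumr_ge0// => j _; case: (HC j).
Qed.

Lemma fin_lb (I : finType) (P : I -> R -> Prop) :
  (forall i, exists2 c : R, 0 < c & P i c) ->
  (forall i c c', 0 < c' -> c' <= c -> P i c -> P i c') ->
  exists2 c : R, 0 < c & forall i, P i c.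
Proof.
move=> H mono.
have [c Hc] : {c : I -> R & forall i, 0 < c i /\ P i (c i)}.
  apply: (@choice _ _ (fun i c => 0 < c /\ P i c)) => i.
  by have [c c0 Pc] := H i; exists c.
have S0 (Q : pred I) : 0 <= \sum_(i | Q i) (c i)^-1.
  by apply: sumr_ge0 => i _; rewrite invr_ge0 ltW//; case: (Hc i).
exists (1 + \sum_i (c i)^-1)^-1; first by rewrite invr_gt0 ltr_pwDl.
move=> i; have [c0 Pc] := Hc i; apply: (mono i (c i)) => //.
  by rewrite invr_gt0 ltr_pwDl.
rewrite -[leRHS]invrK lef_pV2 ?posrE ?invr_gt0 ?ltr_pwDl//.
rewrite (bigD1 i)//= addrCA lerDl addr_ge0//.
Qed.

Lemma continuous_sqrt_sum (T : topologicalType) (f g : T -> R) : continuous f -> continuous g ->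
  continuous (fun p => Num.sqrt (f p ^+ 2 + g p ^+ 2)).
Proof.
move=> cf cg p; apply: (@continuous_comp _ _ _ (fun p => f p ^+ 2 + g p ^+ 2) Num.sqrt).
  by apply: cvgD; apply: (@cvgM R); solve [exact: cf|exact: cg].
exact: sqrt_continuous.
Qed.

Lemma compact_pos (T : topologicalType) (K : set T) (f : T -> R) : compact K ->
  continuous f -> (forall p, K p -> 0 < f p) -> exists2 c : R, 0 < c & forall p, K p -> c <= f p.
Proof.
move=> cK cf f0; have [->|/set0P K0] := eqVneq K set0; first by exists 1.
have [|p pK Hp] := compact_EVT_min K0 cK (f := f); first exact: continuous_subspaceT.
exists (f p); first by apply: f0; rewrite inE in pK.
by move=> p' Kp'; apply: Hp; rewrite inE.
Qed.

Lemma pnorm_scale (P : {poly R[i]}) r K m : 1 <= K -> 0 <= r -> 1 <= K * r ->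
  (size P <= m.+1)%N -> pnorm r P <= (K * r) ^+ m * pnorm 1 P.
Proof.
move=> K1 r0 Kr sP; rewrite {2}/pnorm mulr_sumr; apply: ler_sum => -[i /= im] _.
rewrite expr1n mulr1 mulrC ler_wpM2r ?nc_ge0//.
apply: (@le_trans _ _ ((K * r) ^+ i)).
  by rewrite lerXn2r ?nnegrE ?mulr_ge0// ?ler_peMl//; lra.
by rewrite ler_weXn2l// -ltnS (leq_trans im).
Qed.

End Plane.

(** * The boundary curves *)

Section Boundary.
Variables (R : realType) (U : set R[i]) (l : nat) (G : smooth_boundary U l).
Hypotheses (U_open : open U) (l2 : (2 <= l)%N).
Implicit Types (j : 'I_(ncurves G)) (s e c A : R) (t x : R[i]).

Local Notation gam := (curve G).
Local Notation Gam := (closure U `\` interior U).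
Local Notation dgam j := (nderive 1 (curve G j)).

Let L0 j : 0 < len G j := len_gt0 j.
Let gam_per j s : gam j (s + len G j) = gam j s := curve_periodic j s.
Let Cgam j : Cm l (gam j) := curve_Cm j.

Lemma Gam_curve j s : Gam (gam j s).
Proof. by rewrite -(curve_boundary G); exists j => //; exists s. Qed.

Lemma Gam_param t : Gam t -> exists j s, gam j s = t.
Proof. by rewrite -(curve_boundary G) => -[j _ [s _ <-]]; exists j, s. Qed.

Lemma interior_U : interior U = U.
Proof. exact/interior_id. Qed.

Lemma U_notGam x : U x -> ~ Gam x.
Proof. by rewrite interior_U => Ux [_]. Qed.

Lemma curve_notU j s x : U x -> gam j s - x != 0.
Proof.
move=> Ux; rewrite subr_eq0; apply/eqP => E; apply: (U_notGam Ux).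
by rewrite -E; exact: Gam_curve.
Qed.

Lemma curve_reduce j s : exists2 s0, 0 <= s0 < len G j & gam j s0 = gam j s /\
  exists k : int, s0 = s - len G j *~ k.
Proof.
have [k Hk] := period_reduce (L0 j) s; exists (s - len G j *~ k) => //; split; last by exists k.
by rewrite -mulrNz periodic_int.
Qed.

Lemma period_near j s s' : exists k : int, `|s - (s' + len G j *~ k)| <= len G j / 2.
Proof.
have [k /andP[k0 kL]] := period_reduce (L0 j) (s - s' + len G j / 2).
by exists k; rewrite ler_norml; apply/andP; split; lra.
Qed.

Lemma dgamE j s : cderive (gam j) s (dgam j s).
Proof. by have := @cderive_nderive _ l (gam j) 0 s (Cgam j) (ltnW l2); rewrite nderive0. Qed.

Lemma ccont_gam j : ccont (gam j).
Proof. exact: ccont_Cm (Cgam j). Qed.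

Lemma ccont_dgam j : ccont (dgam j).
Proof. by apply: ccont_nderive (Cgam j) _; exact: ltnW. Qed.

Lemma dgam1 j s : normc (dgam j s) = 1.
Proof. exact: curve_unit_speed. Qed.

Lemma dgam_per j s : dgam j (s + len G j) = dgam j s.
Proof. by apply: nderive_periodic (Cgam j) (ltnW l2) _ _. Qed.

Lemma gam_lip j s s' : normc (gam j s - gam j s') <= 2 * `|s - s'|.
Proof.
have := cderive_mvt (a := s') (b := s) (B := 1) (dgamE j).
by rewrite mulr1; apply => u _; rewrite dgam1.
Qed.

Lemma cderive_id s : cderive (fun u : R => u%:C) s 1.
Proof. by split => /=; [exact: is_derive_id|exact: is_derive_cst]. Qed.

(** The second derivative along the boundary is continuous and periodic, hence
    bounded. *)
Lemma gam_tangent : exists2 B : R, 0 <= B & forall j s s',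
  normc (gam j s - gam j s' - dgam j s' * (s - s')%:C) <= B * `|s - s'| ^+ 2.
Proof.
apply: (@fin_ub R _ (fun j B => forall s s',
  normc (gam j s - gam j s' - dgam j s' * (s - s')%:C) <= B * `|s - s'| ^+ 2)).
  move=> j; have d2 s : cderive (dgam j) s (nderive 2 (gam j) s) by exact: cderive_nderive (Cgam j) l2.
  have [B B0 HB] : exists2 B : R, 0 <= B & forall s, normc (nderive 2 (gam j) s) <= B.
    apply: (periodic_bounded (L0 j)).
      exact: ccont_nderive (Cgam j) l2.
    by apply: nderive_periodic (Cgam j) l2 _.
  exists (4 * B); first by rewrite mulr_ge0.
  move=> s s'; pose f u := gam j u - dgam j s' * u%:C.
  have df u : cderive f u (dgam j u - dgam j s').
    have := cderiveB (dgamE j u) (cderiveZ (dgam j s') (cderive_id u)).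
    by rewrite mulr1.
  have -> : gam j s - gam j s' - dgam j s' * (s - s')%:C = f s - f s'.
    by rewrite /f rmorphB /=; ring.
  apply: le_trans (cderive_mvt (a := s') (b := s) (B := 2 * B * `|s - s'|) df _) _.
    move=> u us; apply: le_trans (cderive_mvt (a := s') (b := u) (B := B) d2 _) _ => //.
    rewrite ler_wpM2l ?mulr_ge0//.
    have [ss|/ltW ss] := leP s' s; move: us.
      rewrite (min_l ss) (max_r ss) => /andP[u1 u2].
      by rewrite !ger0_norm ?subr_ge0// lerD2r.
    rewrite (min_r ss) (max_l ss) => /andP[u1 u2].
    by rewrite !ler0_norm ?subr_le0// !opprB lerD2l lerN2.
  by rewrite le_eqVlt; apply/orP; left; apply/eqP; ring.
move=> j C C' CC' H s s'; apply: le_trans (H s s') _.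
by rewrite ler_wpM2r ?exprn_ge0.
Qed.

Let cont_chord j j' (a b : R * R -> R) : continuous a -> continuous b ->
  continuous (fun p => normc (gam j (a p) - gam j' (b p))).
Proof.
move=> ca cb.
have cg i (pr : R * R -> R) : continuous pr ->
  continuous (fun p => complex.Re (gam i (pr p))) /\
  continuous (fun p => complex.Im (gam i (pr p))).
  move=> cpr; have [cr ci] := ccont_gam i; split => p.
    by apply: (@continuous_comp _ _ _ pr (fun s => complex.Re (gam i s))); [exact: cpr|exact: cr].
  by apply: (@continuous_comp _ _ _ pr (fun s => complex.Im (gam i s))); [exact: cpr|exact: ci].
have [r1 i1] := cg j a ca.
have [r2 i2] := cg j' b cb.
rewrite (_ : (fun p => _) = fun p => Num.sqrt
   ((complex.Re (gam j (a p)) - complex.Re (gam j' (b p))) ^+ 2 +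
    (complex.Im (gam j (a p)) - complex.Im (gam j' (b p))) ^+ 2)).
  by apply: continuous_sqrt_sum => p; apply: cvgB; solve [exact: r1|exact: i1|exact: r2|exact: i2].
by apply/funext => p; rewrite normcE2 !(ReD, ImD, ReN, ImN).
Qed.

Let chord_same j s h : 0 < h <= len G j / 2 -> gam j (s + h) <> gam j s.
Proof.
move=> /andP[h0 hL] E; have := L0 j => Lj0.
have [s0 /andP[s00 s0L] [Es [k sk]]] := curve_reduce j s.
have {}E : gam j (s0 + h) = gam j s0.
  by rewrite Es -E sk addrAC -mulrNz periodic_int.
have [shL|shL] := ltP (s0 + h) (len G j).
  have Hsh : 0 <= s0 + h < len G j by rewrite shL addr_ge0// ltW.
  have Hs0 : 0 <= s0 < len G j by rewrite s00.
  have [_] := curve_inj Hsh Hs0 E; lra.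
have E' : gam j (s0 + h - len G j) = gam j s0.
  by rewrite -E -[in RHS](subrK (len G j) (s0 + h)) gam_per.
have Hsh : 0 <= s0 + h - len G j < len G j by apply/andP; split; lra.
have Hs0 : 0 <= s0 < len G j by rewrite s00.
have [_] := curve_inj Hsh Hs0 E'; lra.
Qed.

(** For points close to each other the chord is compared with the tangent, and the
    other pairs form compact sets on which the chord does not vanish. *)
Lemma arc_chord : exists2 c : R, 0 < c &
  (forall j s s', `|s - s'| <= len G j / 2 -> c * `|s - s'| <= normc (gam j s - gam j s')) /\
  (forall j j' s s', j != j' -> c <= normc (gam j s - gam j' s')).
Proof.
have [B B0 HB] := gam_tangent.
have [c1 c10 Hc1] : exists2 c : R, 0 < c & forall j s s', `|s - s'| <= len G j / 2 ->
    c * `|s - s'| <= normc (gam j s - gam j s').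
  apply: (@fin_lb R _ (fun j c => forall s s', `|s - s'| <= len G j / 2 ->
     c * `|s - s'| <= normc (gam j s - gam j s'))); last first.
    move=> j c c' _ cc' H s s' ss'; apply: le_trans (H s s' ss').
    by rewrite ler_wpM2r.
  move=> j; pose d := (2 * (B + 1))^-1.
  have B1 : 0 < 2 * (B + 1) by lra.
  have d0 : 0 < d by rewrite invr_gt0.
  have Lj0 := L0 j.
  pose K := `[0, len G j] `*` `[d, len G j / 2] : set (R * R).
  have cK : compact K by apply: compact_setX; exact: segment_compact.
  have cf : continuous (fun p : R * R => normc (gam j (p.1 + p.2) - gam j p.1)).
    apply: cont_chord => p; last exact: cvg_fst.
    by apply: cvgD; [exact: cvg_fst|exact: cvg_snd].
  have [|c c0 Hc] := compact_pos cK cf.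
    move=> [s h] [/= _ ]; rewrite in_itv /= => /andP[dh hL].
    rewrite nc_gt0 subr_eq0; apply/eqP; apply: chord_same.
    by rewrite hL (lt_le_trans d0 dh).
  exists (Num.min (1 / 2) (c / len G j)); first by rewrite lt_min; apply/andP; split; [lra|rewrite divr_gt0].
  have main s s' : s' <= s -> s - s' <= len G j / 2 ->
      Num.min (1 / 2) (c / len G j) * (s - s') <= normc (gam j s - gam j s').
    move=> ss' hL; set h := s - s' in hL *; have h0 : 0 <= h by rewrite /h subr_ge0.
    have [hd|dh] := leP h d.
      apply: (@le_trans _ _ (1 / 2 * h)); first by rewrite ler_wpM2r// ge_min lexx.
      have T := HB j s s'; rewrite -/h (ger0_norm h0) in T.
      have := nc_rtri (dgam j s' * h%:C) (gam j s - gam j s').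
      rewrite (ncBC (dgam j s' * h%:C)) ncM dgam1 mul1r ncR (ger0_norm h0) => T2.
      have : B * h ^+ 2 <= 1 / 2 * h.
        rewrite expr2 mulrA ler_wpM2r//.
        apply: (@le_trans _ _ (B * d)); first by rewrite ler_wpM2l.
        by rewrite /d ler_pdivrMr//; lra.
      lra.
    have [s0 /andP[s00 s0L] [Es [k sk]]] := curve_reduce j s'.
    have Eh : gam j (s0 + h) = gam j s.
      by rewrite sk -mulrNz addrAC periodic_int// /h addrC subrK.
    apply: (@le_trans _ _ (c / len G j * h)); first by rewrite ler_wpM2r// ge_min lexx orbT.
    rewrite -Eh -Es; apply: le_trans (Hc (s0, h) _); last first.
      by split; rewrite /= in_itv /= ?s00 ?(ltW s0L)// (ltW dh).
    by rewrite mulrAC ler_pdivrMr// ler_wpM2l ?(ltW c0)//; lra.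
  move=> s s' ss'; have [le|/ltW le] := leP s' s.
    by move: ss'; rewrite ger0_norm ?subr_ge0//; exact: main.
  by move: ss'; rewrite ler0_norm ?subr_le0// opprB ncBC; exact: main.
have [c2 c20 Hc2] : exists2 c : R, 0 < c & forall p : 'I_(ncurves G) * 'I_(ncurves G),
    p.1 != p.2 -> forall s s', c <= normc (gam p.1 s - gam p.2 s').
  apply: fin_lb; last first.
    by move=> p c c' _ cc' H np s s'; apply: le_trans (H np s s').
  move=> [j j'] /=; have [->|jj'] := eqVneq j j'; first by exists 1 => //; rewrite eqxx.
  have cK : compact (`[0, len G j] `*` `[0, len G j'] : set (R * R)).
    by apply: compact_setX; exact: segment_compact.
  have inter s s' : 0 <= s < len G j -> 0 <= s' < len G j' -> gam j s <> gam j' s'.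
    move=> Hs Hs' E; have [E' _] := curve_inj Hs Hs' E.
    by move/eqP: jj'; apply.
  have [|c c0 Hc] := compact_pos cK (@cont_chord j j' fst snd (fun p => cvg_fst) (fun p => cvg_snd)).
    move=> [s s'] _ /=; rewrite nc_gt0 subr_eq0; apply/eqP.
    have [s0 Hs0 [<- _]] := curve_reduce j s; have [s1 Hs1 [<- _]] := curve_reduce j' s'.
    exact: inter.
  exists c => // _ s s'.
  have [s0 /andP[a1 b1] [<- _]] := curve_reduce j s.
  have [s1 /andP[a2 b2] [<- _]] := curve_reduce j' s'.
  by apply: (Hc (s0, s1)); split; rewrite /= in_itv /= ?a1 ?a2 ltW.
exists (Num.min c1 c2); first by rewrite lt_min c10.
split=> [j s s' ss'|j j' s s' jj'].
  by apply: le_trans (Hc1 j s s' ss'); rewrite ler_wpM2r// ge_min lexx.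
by apply: le_trans (Hc2 (j, j') jj' s s'); rewrite ge_min lexx orbT.
Qed.

Lemma nearest_on_curve j x : exists2 s0, 0 <= s0 <= len G j &
  forall s, normc (gam j s0 - x) <= normc (gam j s - x).
Proof.
have cn : {within `[0, len G j], continuous (fun s => normc (gam j s - x))}.
  apply: continuous_subspaceT; apply: continuous_normc.
  by apply: ccontB; [exact: ccont_gam|exact: ccont_cst].
have [c ci Hc] := EVT_min (ltW (L0 j)) cn.
exists c; first by move: ci; rewrite in_itv.
move=> s; have [s0 /andP[a b] [<- _]] := curve_reduce j s.
by apply: Hc; rewrite in_itv /= a ltW.
Qed.

Lemma nearest (j0 : 'I_(ncurves G)) x : exists2 t, Gam t &
  forall t', Gam t' -> normc (t - x) <= normc (t' - x).
Proof.
have [f Hf] : {f : 'I_(ncurves G) -> R &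
    forall j s, normc (gam j (f j) - x) <= normc (gam j s - x)}.
  apply: (@choice _ _ (fun j a => forall s, normc (gam j a - x) <= normc (gam j s - x))) => j.
  by have [s0 _ H] := nearest_on_curve j x; exists s0.
have [j _ Hj] := @arg_minP _ _ _ j0 xpredT (fun j => normc (gam j (f j) - x)) isT.
exists (gam j (f j)); first exact: Gam_curve.
by move=> t' /Gam_param[j' [s <-]]; apply: le_trans (Hj j' isT) (Hf j' s).
Qed.

Lemma dist_pos x : U x -> exists2 e : R, 0 < e & forall t, Gam t -> e <= normc (t - x).
Proof.
move=> Ux; have [e e0 He] := (open_nc U).1 U_open x Ux.
exists e => // t Gt; rewrite leNgt; apply/negP => te.
by apply: (@U_notGam t) => //; apply: He; rewrite ncBC.
Qed.

(** For small [e] the tangent estimate keeps the point at height [e] on the inner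
    normal away from the boundary.  It belongs to [U], since the normal segment is
    connected and its points of small height belong to [U]. *)
Lemma collar : exists2 e0 : R, 0 < e0 & forall j s e, 0 < e <= e0 ->
  U (gam j s + e%:C * 'i%C * dgam j s) /\
  forall t, Gam t -> e / 2 <= normc (t - (gam j s + e%:C * 'i%C * dgam j s)).
Proof.
have [B B0 HB] := gam_tangent.
have [c c0 [Hc1 Hc2]] := arc_chord.
have iR e j s : normc (e%:C * 'i%C * dgam j s) = `|e|.
  by rewrite !ncM dgam1 ncR nc_i !mulr1.
(* The first bound confines the boundary points closer than [2 * e] to the same
   curve; by the second one the quadratic error is at most [e / 2] there. *)
pose e0 := Num.min (c / 4) (c ^+ 2 / (8 * (B + 1))).
have e00 : 0 < e0.
  by rewrite lt_min !divr_gt0 ?exprn_gt0//; lra.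
have dist j s e : 0 < e <= e0 -> forall t, Gam t ->
    e / 2 <= normc (t - (gam j s + e%:C * 'i%C * dgam j s)).
  move=> /andP[ep ee0] t /Gam_param[j' [s' <-]].
  have ec : e <= c / 4 by apply: le_trans ee0 _; rewrite ge_min lexx.
  have eB : e <= c ^+ 2 / (8 * (B + 1)) by apply: le_trans ee0 _; rewrite ge_min lexx orbT.
  have N0 : normc (e%:C * 'i%C * dgam j s) = e by rewrite iR gtr0_norm.
  have [far|near] := leP (2 * e) (normc (gam j' s' - gam j s)).
    have := nc_rtri (gam j' s' - gam j s) (e%:C * 'i%C * dgam j s).
    rewrite N0 opprD addrA; lra.
  have jj : j' = j.
    apply/eqP; apply/negP => /negP jj; have := Hc2 j' j s' s jj; lra.
  rewrite {}jj {j'} in near *.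
  have [k Hk] := period_near j s' s; set s1 := s + _ in Hk.
  have E1 : gam j s1 = gam j s by rewrite /s1 periodic_int.
  have E2 : dgam j s1 = dgam j s.
    by rewrite /s1 periodic_int// => u; exact: dgam_per.
  rewrite -E1 -E2 in near N0 *; move: s1 Hk near N0 {E1 E2} => {}s Hk near N0.
  set h := s' - s in Hk.
  have ch := Hc1 j s' s Hk; rewrite -/h in ch.
  have hb : `|h| <= 2 * e / c by rewrite ler_pdivlMr// mulrC; lra.
  have T := HB j s' s; rewrite -/h in T.
  have hB : B * `|h| ^+ 2 <= e / 2.
    apply: (@le_trans _ _ ((B + 1) * (2 * e / c) ^+ 2)).
      apply: ler_pM; rewrite ?exprn_ge0//; first lra.
      by rewrite lerXn2r// nnegrE// divr_ge0 ?mulr_ge0 ?ltW.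
    rewrite expr_div_n mulrA ler_pdivrMr ?exprn_gt0//.
    move: eB; rewrite ler_pdivlMr; last lra.
    move=> eB; rewrite exprMn expr2.
    have := ler_wpM2l (ltW ep) eB; lra.
  have ortho : e <= normc ((h%:C - e%:C * 'i%C) * dgam j s).
    rewrite ncM dgam1 mulr1 normcE2 -[leLHS](gtr0_norm ep) -sqrtr_sqr ler_wsqrtr//.
    rewrite !(ReD, ImD, ReN, ImN, ReM, ImM) /=.
    rewrite !(mulr0, mul0r, mulr1, subr0, addr0, oppr0, add0r) sqrrN lerDr.
    exact: sqr_ge0.
  have := nc_rtri ((h%:C - e%:C * 'i%C) * dgam j s)
     (- (gam j s' - gam j s - dgam j s * h%:C)).
  rewrite ncN.
  have -> : (h%:C - e%:C * 'i) * dgam j s - - (gam j s' - gam j s - dgam j s * h%:C) =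
      gam j s' - (gam j s + e%:C * 'i * dgam j s) by ring.
  lra.
exists e0 => // j s e ee0; split; last exact: dist.
have /andP[ep ele] := ee0.
pose p u := gam j s + u%:C * 'i%C * dgam j s.
have pd u v : normc (p u - p v) = `|u - v|.
  rewrite (_ : p u - p v = (u - v)%:C * 'i%C * dgam j s) ?iR//.
  by rewrite /p rmorphB /=; ring.
have cp : continuous p.
  move=> u A /nbhs_nc[r r0 Hr]; apply/nbhs_ballP; exists r => //= v.
  by rewrite /ball /= => uv; apply: Hr; rewrite pd.
have [u1 u10 [u1e Uu1]] : exists2 u1, 0 < u1 & u1 <= e /\ U (p u1).
  have /nbhs_ballP[r /= r0 Hr] := curve_left j s.
  exists (Num.min e (r / 2)); first by rewrite lt_min ep divr_gt0.
  split; first by rewrite ge_min lexx.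
  apply: Hr; last by rewrite lt_min ep divr_gt0.
  rewrite /ball /= sub0r normrN gtr0_norm ?lt_min ?ep ?divr_gt0//.
  by rewrite gt_min; apply/orP; right; lra.
have offG u : u1 <= u <= e -> ~ Gam (p u).
  move=> /andP[a b] Gp; have up : 0 < u by exact: lt_le_trans a.
  have := dist j s u _ _ Gp; rewrite up (le_trans b ele) subrr nc0 => /(_ isT); lra.
have cU u : u1 <= u <= e -> closure U (p u) -> U (p u).
  move=> ub cl; apply: contrapT => nU; apply: (offG u ub); split => //.
  by rewrite interior_U.
have H : `[u1, e]%classic `&` p @^-1` U = `[u1, e]%classic.
  apply: (@segment_connected R u1 e).
  - by exists u1; split => //=; rewrite in_itv /= lexx.
  - by exists (p @^-1` U) => //; apply: open_comp => // ? _; exact: cp.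
  - exists (p @^-1` closure U).
      by apply: closed_comp => [? _|]; [exact: cp|exact: closed_closure].
    apply/seteqP; split => u /= [ub Hu]; split => //; first exact: subset_closure.
    by apply: cU => //; move: ub; rewrite in_itv.
have : `[u1, e]%classic e by rewrite /= in_itv /= u1e lexx.
by rewrite -H => -[].
Qed.

End Boundary.

Section BoundaryJets.
Variables (R : realType) (U : set R[i]) (l : nat) (G : smooth_boundary U l).
Variables (alpha : R) (m : nat).
Hypotheses (U_open : open U) (halpha : 0 < alpha < 1) (ml : (m.+2 <= l)%N).
Implicit Types (j : 'I_(ncurves G)) (s A : R) (t : R[i]).

Local Notation gam := (curve G).
Local Notation Gam := (closure U `\` interior U).
Local Notation dgam j := (nderive 1 (curve G j)).

Let l2 : (2 <= l)%N. Proof. exact: leq_trans ml. Qed.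
Let L0 j : 0 < len G j := len_gt0 j.

Lemma Cm_le (p q : nat) (f : R -> R[i]) : (q <= p)%N -> Cm p f -> Cm q f.
Proof.
move=> qp Cf; have [cr ci] := ccont_nderive Cf qp.
by case: Cf => [[Hr _] [Hi _]]; split; split => // i iq; [apply: Hr|apply: Hi];
  exact: leq_trans qp.
Qed.

Lemma hold_dgam j : exists A, hold alpha 1 m.+1 (gam j) A /\ hold alpha 1 m (dgam j) A.
Proof.
have Cg : Cm m.+2 (gam j) := Cm_le ml (curve_Cm j).
have [A HA] := hold_Cm halpha ltr01 (L0 j) Cg (curve_periodic j).
exists A; split => //; move: HA => /= [_ [f' df hf]].
rewrite (_ : dgam j = f')//; apply/funext => s.
exact: cderive_unique (dgamE l2 j s) (df s).
Qed.

Let curve_jet j K : 1 <= K -> exists2 C : R, 0 <= C & forall f A, hold alpha 1 m f A ->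
  (forall s, f (s + len G j) = f s) -> exists F : R -> {poly R[i]},
  [/\ forall s, F (s + len G j) = F s,
      forall s, (size (F s) <= m.+1)%N /\ (F s).[gam j s] = f s,
      forall s, pnorm 1 (rebase (gam j s) (F s)) <= C * A &
      forall s s' r, `|s - s'| <= 1 -> 0 < r -> `|s - s'| <= K * r ->
        pnorm r (rebase (gam j s) (F s - F s')) <= C * A * r ^+ m * r `^ alpha].
Proof.
move=> K1; have [B [_ hB]] := hold_dgam j.
have [C1 C10 H1] := arc_jet_exists halpha ltr01 (dgam1 j) (dgam_per l2 j) hB.
have [C2 C20 H2] := arc_taylor_pnorm 1 (len G j) halpha (dgamE l2 j) (dgam1 j) m K1.
have [C3 C30 H3] := arc_poly_bound alpha 1 (len G j) (gam j) (dgam j) m.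
exists (C2 * C1 + C3 * C1); first by rewrite addr_ge0 ?mulr_ge0.
move=> f A hf pf; have A0 := hold_ge0 hf; have [h Hh] := H1 f A hf pf.
exists (arc_poly (gam j) m h); split.
- move=> s; rewrite /arc_poly curve_periodic; congr (rebase _ _).
  apply/polyP => i; rewrite !coef_poly; case: ifP => // im.
  by case: Hh => _ _ _ -> .
- move=> s; split; first exact: size_arc_poly.
  by rewrite -[arc_poly _ _ _ _]/((arc_poly (gam j) m h s)^`(0)) derivn_arc_poly//; case: Hh.
- move=> s; apply: le_trans (H3 _ _ _ Hh s) _; rewrite mulrA ler_wpM2r// lerDr.
  exact: mulr_ge0.
- move=> s s' r s1 r0 sK; apply: le_trans (H2 _ _ _ Hh s s' r s1 r0 sK) _.
  rewrite mulrA !ler_wpM2r ?powR_ge0 ?exprn_ge0 ?(ltW r0)// lerDl.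
  exact: mulr_ge0.
Qed.

(** Functions of class [C^(m, alpha)] in the arc-length parameter are Whitney
    functions on the boundary: close points lie on a common arc, where Taylor's
    theorem applies, and for distant points there is nothing to compare. *)
Lemma boundary_jet : exists2 C : R, 0 <= C & forall (phi : R[i] -> R[i]) A, 0 <= A ->
  (forall j, hold alpha 1 m (fun s => phi (gam j s)) A) ->
  exists2 F, whitney alpha Gam m F (C * A) & forall t, Gam t -> (F t).[t] = phi t.
Proof.
have [c' c'0 [Hc1' Hc2']] := arc_chord G l2.
pose c := Num.min c' 1.
have c0 : 0 < c by rewrite lt_min c'0 ltr01.
have c1 : c <= 1 by rewrite ge_min lexx orbT.
have cc' : c <= c' by rewrite ge_min lexx.
have K1 : 1 <= c^-1 by rewrite invf_ge1.
have K0 : 0 <= c^-1 by rewrite invr_ge0 ltW.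
(* One constant for all the curves; the argument proves that the property is
   monotone in the constant. *)
have [C0 C00 HC0] := fin_ub (fun j => curve_jet j K1) (fun j C C' CC' H f A hf pf =>
  let: ex_intro F (And4 a b d e) := H f A hf pf in
  let A0 := hold_ge0 hf in
  ex_intro _ F (And4 a b
   (fun s => le_trans (d s) (ler_wpM2r A0 CC'))
   (fun s s' r x y z => le_trans (e s s' r x y z)
     (ler_wpM2r (powR_ge0 _ _) (ler_wpM2r (exprn_ge0 m (ltW y)) (ler_wpM2r A0 CC')))))).
pose C1 := C0 * (c^-1 ^+ m * c^-1 * (1 + 2 ^+ m)).
have k1 : 1 <= c^-1 ^+ m * c^-1 by rewrite mulr_ege1// exprn_ege1.
have k2 : 1 <= c^-1 ^+ m * c^-1 * (1 + 2 ^+ m) by rewrite mulr_ege1// lerDl exprn_ge0.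
have C01 : C0 <= C1 by rewrite /C1 ler_peMr.
exists C1; first exact: le_trans C01.
move=> phi A A0 hphi.
have /choice[F HF] : forall j, exists F : R -> {poly R[i]},
  [/\ forall s, F (s + len G j) = F s,
      forall s, (size (F s) <= m.+1)%N /\ (F s).[gam j s] = phi (gam j s),
      forall s, pnorm 1 (rebase (gam j s) (F s)) <= C0 * A &
      forall s s' r, `|s - s'| <= 1 -> 0 < r -> `|s - s'| <= c^-1 * r ->
        pnorm r (rebase (gam j s) (F s - F s')) <= C0 * A * r ^+ m * r `^ alpha].
  move=> j; apply: HC0; first exact: hphi.
  by move=> s; rewrite curve_periodic.
have [P HP] : {P : R[i] -> {poly R[i]} & forall t, Gam t -> exists j s, gam j s = t /\ P t = F j s}.
  apply: (@choice _ _ (fun t P => Gam t -> exists j s, gam j s = t /\ P = F j s)) => t.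
  have [/(Gam_param G)[j [s js]]|nt] := pselect (Gam t); first by exists (F j s) => _; exists j, s.
  by exists 0.
exists P; last first.
  by move=> t /HP[j [s [<- ->]]]; have [_ /(_ s)[_ ->] _ _] := HF j.
have b1 t : Gam t -> (size (P t) <= m.+1)%N /\ pnorm 1 (rebase t (P t)) <= C0 * A.
  by move=> /HP[j [s [<- ->]]]; have [_ /(_ s)[? _] /(_ s) ? _] := HF j.
split.
- by move=> t /b1[].
- by move=> t /b1[_ H]; apply: le_trans H _; rewrite ler_wpM2r.
move=> t t' r Gt Gt' r0 tt'; have r0' := ltW r0.
(* For [r] at least [c] boundedness alone gives the estimate; for smaller [r] the
   two points lie on the same curve. *)
have [far|near] := leP c r.
  have cr : 1 <= c^-1 * r by rewrite mulrC ler_pdivlMr// mul1r.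
  have [s1 p1] := b1 t Gt; have [s2 p2] := b1 t' Gt'.
  rewrite rebaseB; apply: le_trans (pnormB _ _ r0') _.
  have e1 : pnorm r (rebase t (P t)) <= (c^-1 * r) ^+ m * (C0 * A).
    apply: le_trans (pnorm_scale K1 r0' cr (m := m) _) _; first by rewrite size_rebase.
    by rewrite ler_wpM2l// exprn_ge0// mulr_ge0.
  have e2 : pnorm r (rebase t (P t')) <= 2 ^+ m * ((c^-1 * r) ^+ m * (C0 * A)).
    rewrite -[t in rebase t](subrK t') -rebase_add.
    have -> : 2 = 1 + 1 :> R by lra.
    apply: le_trans (pnorm_rebase (K := 1) r0' ler01 _ (d := m) _) _.
    - by rewrite mul1r.
    - by rewrite size_rebase.
    rewrite ler_wpM2l ?exprn_ge0//.
    apply: le_trans (pnorm_scale K1 r0' cr (m := m) _) _; first by rewrite size_rebase.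
    by rewrite ler_wpM2l// exprn_ge0// mulr_ge0.
  apply: le_trans (lerD e1 e2) _.
  have ra : 1 <= c^-1 * r `^ alpha.
    have := @powR_le_scale _ alpha halpha c^-1 1 r K1 ler01 r0' cr.
    by rewrite powR1.
  have X0 : 0 <= C0 * A * (c^-1 ^+ m) * r ^+ m * (1 + 2 ^+ m).
    by rewrite !mulr_ge0 ?exprn_ge0// addr_ge0 ?exprn_ge0.
  rewrite [leLHS](_ : _ = C0 * A * (c^-1 ^+ m) * r ^+ m * (1 + 2 ^+ m)); last first.
    by rewrite exprMn; ring.
  rewrite /C1 [leRHS](_ : _ = C0 * A * (c^-1 ^+ m) * r ^+ m * (1 + 2 ^+ m) * (c^-1 * r `^ alpha)).
    by rewrite ler_peMr.
  by ring.
have [j [s [ts Pt]]] := HP t Gt; have [j' [s' [ts' Pt']]] := HP t' Gt'.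
have jj : j = j'.
  apply/eqP; apply/negP => /negP jj; have := Hc2' j j' s s' jj.
  by rewrite ts ts'; lra.
rewrite {}jj {j} in ts Pt.
have [pF _ _ hF] := HF j'.
have [k Hk] := period_near j' s s'; set s1 := s' + _ in Hk.
have E1 : gam j' s1 = t' by rewrite /s1 periodic_int// => u; exact: curve_periodic.
have E2 : F j' s1 = P t' by rewrite Pt' /s1 periodic_int.
have ss1 : `|s - s1| <= c^-1 * r.
  rewrite mulrC ler_pdivlMr// mulrC; apply: le_trans tt'; rewrite -ts -E1.
  by apply: le_trans (Hc1' j' s s1 Hk); rewrite ler_wpM2r.
rewrite Pt -E2 -ts; apply: le_trans (hF s s1 r _ r0 ss1) _.
  apply: le_trans ss1 _; rewrite mulrC ler_pdivrMr// mul1r; exact: ltW.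
by rewrite !ler_wpM2r ?powR_ge0 ?exprn_ge0.
Qed.

End BoundaryJets.

(** * Integration over the boundary *)

Section Contour.
Variables (R : realType) (U : set R[i]) (l : nat) (G : smooth_boundary U l).
Hypotheses (U_open : open U) (l2 : (2 <= l)%N).
Implicit Types (f g : R[i] -> R[i]) (t x y z : R[i]) (X T : seq R[i]) (j : 'I_(ncurves G)).

Local Notation gam := (curve G).
Local Notation Gam := (closure U `\` interior U).
Local Notation dgam j := (nderive 1 (curve G j)).

Definition oint f : R[i] :=
  \sum_(j < ncurves G) cintegral 0 (len G j) (fun s => f (gam j s) * dgam j s).

Definition contG f : Prop := forall j, ccont (fun s => f (gam j s)).

Definition nodes X t : R[i] := \prod_(x <- X) (t - x).

Lemma eq_contG f g : (forall t, Gam t -> f t = g t) -> contG f -> contG g.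
Proof.
move=> fg cf j; apply: eq_ccont (cf j) => s.
by apply: fg; exact: Gam_curve.
Qed.

Lemma contG_cst z : contG (fun=> z).
Proof. by move=> j; exact: ccont_cst. Qed.

Lemma contG_id : contG (fun t => t).
Proof. by move=> j; exact: ccont_gam. Qed.

Lemma contGD f g : contG f -> contG g -> contG (fun t => f t + g t).
Proof. by move=> cf cg j; apply: ccontD; [exact: cf|exact: cg]. Qed.

Lemma contGB f g : contG f -> contG g -> contG (fun t => f t - g t).
Proof. by move=> cf cg j; apply: ccontB; [exact: cf|exact: cg]. Qed.

Lemma contGM f g : contG f -> contG g -> contG (fun t => f t * g t).
Proof. by move=> cf cg j; apply: ccontM; [exact: cf|exact: cg]. Qed.

Lemma contGX f k : contG f -> contG (fun t => f t ^+ k).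
Proof. by move=> cf j; apply: ccontX; exact: cf. Qed.

Lemma contGV f : (forall t, Gam t -> f t != 0) -> contG f -> contG (fun t => (f t)^-1).
Proof.
move=> f0 cf j; apply: (@ccontV _ (fun s => f (gam j s))); last exact: cf.
by move=> s; apply: f0; exact: Gam_curve.
Qed.

Lemma contG_nodes X : contG (nodes X).
Proof.
move=> j; apply: (@ccont_prod _ _ _ _ (fun x s => gam j s - x)) => x.
by apply: ccontB; [exact: ccont_gam|exact: ccont_cst].
Qed.

Lemma eq_oint f g : (forall t, Gam t -> f t = g t) -> oint f = oint g.
Proof.
move=> fg; apply: eq_bigr => j _; apply: eq_cintegral => s.
by rewrite fg//; exact: Gam_curve.
Qed.

Lemma ointD f g : contG f -> contG g -> oint (fun t => f t + g t) = oint f + oint g.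
Proof.
move=> cf cg; rewrite /oint -big_split; apply: eq_bigr => j _ /=.
rewrite -cintegralD; first by apply: eq_cintegral => s; rewrite mulrDl.
- by apply: ccontM; [exact: cf|exact: ccont_dgam].
- by apply: ccontM; [exact: cg|exact: ccont_dgam].
Qed.

Lemma ointZ z f : contG f -> oint (fun t => z * f t) = z * oint f.
Proof.
move=> cf; rewrite /oint mulr_sumr; apply: eq_bigr => j _ /=.
rewrite -cintegralZ; first by apply: eq_cintegral => s; rewrite mulrA.
by apply: ccontM; [exact: cf|exact: ccont_dgam].
Qed.

Lemma ointB f g : contG f -> contG g -> oint (fun t => f t - g t) = oint f - oint g.
Proof.
move=> cf cg; rewrite -mulN1r -ointZ// -ointD//; last first.
  by apply: contGM => //; exact: contG_cst.
by apply: eq_oint => t _; rewrite mulN1r.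
Qed.

Lemma oint_le : exists2 C : R, 0 <= C & forall f (B : R), contG f ->
  (forall t, Gam t -> normc (f t) <= B) -> normc (oint f) <= C * B.
Proof.
exists (\sum_(j < ncurves G) 2 * len G j).
  by apply: sumr_ge0 => j _; rewrite mulr_ge0// ltW// len_gt0.
move=> f B cf fB; apply: le_trans (nc_sum _ _ _) _; rewrite mulr_suml.
apply: ler_sum => j _.
have := @cintegral_le_cst _ 0 (len G j) (fun s => f (gam j s) * dgam j s) B (ltW (len_gt0 j)).
rewrite subr0 mulrAC -mulrA [B * _]mulrC; apply.
  by apply: ccontM; [exact: cf|exact: ccont_dgam].
by move=> s _; rewrite ncM dgam1 mulr1 fB//; exact: Gam_curve.
Qed.

Lemma nodes_cons x X t : nodes (x :: X) t = (t - x) * nodes X t.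
Proof. by rewrite /nodes big_cons. Qed.

Lemma nodes_perm X Y t : perm_eq X Y -> nodes X t = nodes Y t.
Proof. exact: perm_big. Qed.

Lemma node_neq0 x t : U x -> Gam t -> t - x != 0.
Proof.
move=> Ux Gt; rewrite subr_eq0; apply/eqP => tx.
by apply: (U_notGam U_open Ux); rewrite -tx.
Qed.

Lemma nodes_neq0 X t : {in X, forall x, U x} -> Gam t -> nodes X t != 0.
Proof.
move=> XU Gt; elim: X XU => [|x X IH] XU; first by rewrite /nodes big_nil oner_eq0.
rewrite nodes_cons mulf_neq0 ?node_neq0//; first by apply: XU; rewrite mem_head.
by apply: IH => y yX; apply: XU; rewrite inE yX orbT.
Qed.

Lemma contG_invnodes X : {in X, forall x, U x} -> contG (fun t => (nodes X t)^-1).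
Proof.
by move=> XU; apply: contGV; [move=> t; exact: nodes_neq0|exact: contG_nodes].
Qed.

Lemma contG_invnode x k : U x -> contG (fun t => (t - x) ^- k).
Proof.
move=> Ux; apply: contGV; first by move=> t Gt; rewrite expf_neq0 ?node_neq0.
by apply: contGX; apply: contGB; [exact: contG_id|exact: contG_cst].
Qed.

(** * Moments of rational functions *)

(** Powers [(t - x)^-k] with [2 <= k] have a primitive along the closed curves. *)
Lemma oint_pole x k : U x -> oint (fun t => (t - x) ^- k.+2) = 0.
Proof.
move=> Ux; apply: big1 => j _.
pose F (s : R) : R[i] := - (k.+1%:R^-1) * ('X^(k.+1)).[(gam j s - x)^-1].
have k0 : 1 + k%:R != 0 :> R[i] by rewrite -(natrD _ 1) pnatr_eq0.
rewrite (@cintegral_FTC _ _ _ _ F).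
- by rewrite /F -{1}[len G j]add0r curve_periodic subrr.
- exact: ltW (len_gt0 j).
- apply: ccontM; last exact: ccont_dgam.
  exact: contG_invnode.
move=> s; have nz u : gam j u - x != 0 by exact: curve_notU.
have d1 : cderive (fun u => gam j u - x) s (dgam j s).
  by have := cderiveB (dgamE l2 j s) (cderive_cst x s); rewrite subr0.
have := cderiveZ (- (k.+1%:R^-1)) (cderive_horner ('X^(k.+1)) (cderiveV nz d1)).
congr (cderive _ _ _); rewrite derivXn hornerMn hornerXn -mulr_natr.
rewrite !exprVn; have nk : (gam j s - x) ^+ k != 0 by rewrite expf_neq0.
rewrite !exprS; field.
by rewrite /= nk nz k0.
Qed.

Let winding x := oint (fun t => (t - x)^-1).

Let windingE x y : U x -> U y ->
  winding x - winding y = (x - y) * oint (fun t => (t - x)^-1 * (t - y)^-1).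
Proof.
move=> Ux Uy.
have c1 z : U z -> contG (fun t => (t - z)^-1).
  by move=> Uz; have := contG_invnode 1 Uz.
rewrite /winding -ointB; try exact: c1.
rewrite -ointZ; last by apply: contGM; exact: c1.
apply: eq_oint => t Gt; field.
by rewrite !node_neq0.
Qed.

(** The terms of the geometric series between the first one and the remainder are
    poles of higher order, and integrate to zero. *)
Let winding_taylor x y N : U x -> U y -> winding y - winding x =
  (y - x) ^+ N.+1 * oint (fun t => (t - x) ^- N.+1 * (t - y)^-1).
Proof.
move=> Ux Uy; elim: N => [|N IH].
  rewrite windingE// expr1; congr (_ * _).
  by apply: eq_oint => t _; rewrite mulrC.
have c1 k : contG (fun t => (t - x) ^- k * (t - y)^-1).
  by apply: contGM; [exact: contG_invnode|have := contG_invnode 1 Uy].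
rewrite IH [in RHS]exprSr -mulrA; congr (_ * _).
rewrite -[RHS]add0r -(oint_pole N Ux) -ointZ// -ointD//; last first.
- by apply: contGM; [exact: contG_cst|exact: c1].
- exact: contG_invnode.
apply: eq_oint => t Gt; rewrite !exprS.
have tx := node_neq0 Ux Gt; have ty := node_neq0 Uy Gt.
have nk : (t - x) ^+ N != 0 by rewrite expf_neq0.
by field; rewrite tx ty nk.
Qed.

Let winding_local x : U x -> exists2 e : R, 0 < e &
  forall y, normc (x - y) < e -> U y /\ winding y = winding x.
Proof.
move=> Ux; have [e e0 He] := (open_nc U).1 U_open x Ux.
exists (e / 2); first by rewrite divr_gt0.
move=> y xy; have Uy : U y by apply: He; lra.
split=> //; have [C C0 HC] := oint_le.
have dist t : Gam t -> e <= normc (t - x).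
  by move=> Gt; rewrite leNgt; apply/negP; rewrite ncBC => /He Ut; exact: U_notGam Ut Gt.
have disty t : Gam t -> e / 2 <= normc (t - y).
  move=> Gt; have := dist t Gt; have := nc_tri t y x; rewrite (ncBC y); lra.
(* The ratio of the geometric series is at most one half, since [y] is closer to [x]
   than [e / 2] and the boundary is not closer than [e]. *)
have bd N : normc (winding y - winding x) * 2 ^+ N <= C * (2 / e).
  rewrite (winding_taylor N) // ncM ncX.
  have q : normc (oint (fun t => (t - x) ^- N.+1 * (t - y)^-1)) <= C * (e ^- N.+1 * (2 / e)).
    apply: HC.
      by apply: contGM; [exact: contG_invnode|have := contG_invnode 1 Uy].
    move=> t Gt; rewrite ncM !ncV ncX; apply: ler_pM; rewrite ?invr_ge0 ?exprn_ge0 ?nc_ge0//.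
      rewrite lef_pV2 ?posrE ?exprn_gt0//; last by apply: lt_le_trans (dist t Gt).
      by rewrite lerXn2r ?nnegrE ?nc_ge0 ?(ltW e0)//; exact: dist.
    rewrite -[leRHS]invf_div lef_pV2 ?posrE ?divr_gt0//; first exact: disty.
    by apply: lt_le_trans (disty t Gt); rewrite divr_gt0.
  have p : normc (y - x) ^+ N.+1 <= (e / 2) ^+ N.+1.
    by rewrite lerXn2r ?nnegrE ?nc_ge0 ?divr_ge0 ?(ltW e0)// ncBC ltW.
  apply: (@le_trans _ _ ((e / 2) ^+ N.+1 * (C * (e ^- N.+1 * (2 / e))) * 2 ^+ N)).
    by rewrite ler_wpM2r ?exprn_ge0// ler_pM ?exprn_ge0 ?nc_ge0.
  have eN : e ^+ N.+1 != 0 by rewrite expf_neq0// gt_eqF.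
  have N2 : 2 ^+ N != 0 :> R by rewrite expf_neq0.
  rewrite [leLHS](_ : _ = 1 / 2 * (C * (2 / e))); last first.
    rewrite exprMn exprVn (exprS (2 : R)); field.
    by rewrite N2 eN gt_eqF.
  rewrite ler_piMl ?mulr_ge0 ?invr_ge0 ?(ltW e0)//; lra.
apply/eqP; rewrite -subr_eq0 -nc_eq0 eq_le nc_ge0 andbT leNgt; apply/negP => d0.
have K0 : 0 <= C * (2 / e) by rewrite mulr_ge0// divr_ge0// ltW.
have := bd (Num.truncn (C * (2 / e) / normc (winding y - winding x))).+1.
apply/negP; rewrite -ltNge -ltr_pdivrMl// mulrC.
apply: lt_le_trans (truncnS_gt _) _.
by rewrite -natrX ler_nat ltnW// ltn_expl.
Qed.

Hypothesis U_connected : connected U.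

(** The winding number of the boundary is locally constant, and [U] is
    connected. *)
Let winding_cst x y : U x -> U y -> winding x = winding y.
Proof.
move=> Ux Uy.
suff H : U `&` [set z | winding z = winding x] = U.
  by have : U y by []; rewrite -{1}H => -[_ /= ->].
apply: U_connected; first by exists x.
- exists (U `&` [set z | winding z = winding x]); last by rewrite setIA setIid.
  apply/open_nc => z [Uz zx]; have [e e0 He] := winding_local Uz.
  exists e => // w /He[Uw wz]; split => //=; by rewrite wz.
- exists (~` (U `&` [set z | winding z != winding x])).
    apply: open_closedC; apply/open_nc => z [Uz /= zx].
    have [e e0 He] := winding_local Uz; exists e => // w /He[Uw wz]; split => //=.
    by rewrite wz.
  apply/seteqP; split => z [Uz zx]; split => //=.
    by move=> [_ /=]; rewrite zx eqxx.
  by apply: contrapT => /eqP zx'; apply: zx.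
Qed.

(** Partial fractions reduce the number of poles until one repeated pole is left,
    or two simple poles, where the winding numbers cancel. *)
Lemma oint_invnodes X : (2 <= size X)%N -> {in X, forall x, U x} ->
  oint (fun t => (nodes X t)^-1) = 0.
Proof.
move: {2}(size X) (erefl (size X)) => n; elim: n X => [|n IH] X sX X2 XU.
  by rewrite sX in X2.
case: X sX X2 XU => [//|x X] /= [sX] X1 XU.
have Ux : U x by apply: XU; rewrite mem_head.
have [/all_pred1P Xx|/allPn[y yX yx]] := boolP (all (pred1 x) X).
  move: X1; rewrite Xx size_nseq ltnS; case: (size X) => [//|k] _.
  rewrite -[RHS](oint_pole k Ux); apply: eq_oint => t _.
  by rewrite nodes_cons /nodes big_nseq iter_mulr_1 -exprS.
have Uy : U y by apply: XU; rewrite inE yX orbT.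
set Z := rem y X.
have pX : perm_eq (x :: X) [:: x, y & Z] by rewrite perm_cons perm_to_rem.
have sZ : size Z = n.-1 by rewrite size_rem// sX.
have ZU : {in Z, forall z, U z}.
  by move=> z /mem_rem zX; apply: XU; rewrite inE zX orbT.
have cZ z : U z -> {in z :: Z, forall z, U z}.
  by move=> Uz u; rewrite inE => /predU1P[->//|/ZU].
have E : oint (fun t => (nodes (x :: X) t)^-1) =
   (x - y)^-1 * (oint (fun t => (nodes (x :: Z) t)^-1) - oint (fun t => (nodes (y :: Z) t)^-1)).
  rewrite -ointB; try by apply: contG_invnodes; exact: cZ.
  rewrite -ointZ; last by apply: contGB; apply: contG_invnodes; exact: cZ.
  apply: eq_oint => t Gt; rewrite (nodes_perm _ pX) !nodes_cons.
  have := nodes_neq0 ZU Gt; have := node_neq0 Ux Gt; have := node_neq0 Uy Gt.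
  have xy : x - y != 0 by rewrite subr_eq0 eq_sym.
  by move=> h1 h2 h3; field; rewrite h1 h2 h3 xy.
rewrite E; case: (posnP n.-1) => [n0|np].
  have Z0 : Z = [::] by apply: size0nil; rewrite sZ.
  have w z : oint (fun t => (nodes [:: z] t)^-1) = winding z.
    by apply: eq_oint => t _; rewrite nodes_cons /nodes big_nil mulr1.
  by rewrite Z0 !w (winding_cst Ux Uy) subrr mulr0.
have n1 : n.-1.+1 = n by rewrite prednK// -sX -ltnS.
by rewrite !IH ?subrr ?mulr0//=; solve [exact: cZ|rewrite sZ; exact: n1|by rewrite sZ ltnS].
Qed.

Lemma oint_moment T X : (size T + 2 <= size X)%N -> {in X, forall x, U x} ->
  oint (fun t => nodes T t / nodes X t) = 0.
Proof.
elim: T X => [|a T IH] X TX XU.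
  rewrite -[RHS](oint_invnodes (X := X))//; apply: eq_oint => t _.
  by rewrite /nodes big_nil mul1r.
case: X TX XU => [//|x X] /= TX XU; rewrite addSn ltnS in TX.
have Ux : U x by apply: XU; rewrite mem_head.
have XU' : {in X, forall x, U x} by move=> y yX; apply: XU; rewrite inE yX orbT.
have c1 Y : {in Y, forall x, U x} -> contG (fun t => nodes T t / nodes Y t).
  by move=> YU; apply: contGM; [exact: contG_nodes|exact: contG_invnodes].
have E : oint (fun t => nodes (a :: T) t / nodes (x :: X) t) =
    oint (fun t => nodes T t / nodes X t) + (x - a) * oint (fun t => nodes T t / nodes (x :: X) t).
  rewrite -ointZ; last exact: c1.
  rewrite -ointD; [|exact: c1|by apply: contGM; [exact: contG_cst|exact: c1]].
  apply: eq_oint => t Gt; rewrite !nodes_cons.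
  have h1 := nodes_neq0 XU' Gt; have h2 := node_neq0 Ux Gt.
  by field; rewrite h1 h2.
by rewrite E (IH X)// (IH (x :: X)) ?add0r ?mulr0//= leqW.
Qed.

End Contour.

(** * Hoelder estimates for Cauchy integrals with several poles *)

Section PowRNeg.
Variables (R : realType) (alpha : R).
Hypothesis halpha : 0 < alpha < 1.
Implicit Types x y : R.

Lemma powR_neg_le x y : 0 < x -> x <= y -> y `^ (alpha - 2) <= x `^ (alpha - 2).
Proof.
move=> x0 xy; have y0 : 0 < y by lra.
have [a0 a1] := andP halpha.
rewrite -[alpha - 2]opprB !powRN lef_pV2 ?posrE ?powR_gt0//.
by apply: ge0_ler_powR; rewrite ?nnegrE ?(ltW x0) ?(ltW y0)//; lra.
Qed.

Lemma powR_sub2 x : 0 < x -> x `^ (alpha - 2) = x `^ alpha / x / x.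
Proof.
move=> x0; rewrite powRB; last by apply/implyP => _; rewrite gt_eqF.
by rewrite powR_mulrn ?ltW// expr2 invfM mulrA.
Qed.

Lemma powR_sub1 x : 0 < x -> x * x `^ (alpha - 1) = x `^ alpha.
Proof.
move=> x0; rewrite powRB; last by apply/implyP => _; rewrite gt_eqF.
by rewrite powRr1 ?ltW// mulrCA divff ?mulr1// gt_eqF.
Qed.

End PowRNeg.

Section CauchyEstimate.
Variables (R : realType) (U : set R[i]) (l : nat) (G : smooth_boundary U l) (alpha : R).
Hypotheses (U_open : open U) (l2 : (2 <= l)%N) (halpha : 0 < alpha < 1).
Hypotheses (U_connected : connected U).
Implicit Types (f g : R[i] -> R[i]) (t x y z : R[i]) (X T Y : seq R[i]) (A B K e : R).
Implicit Types (F : R[i] -> {poly R[i]}) (j : 'I_(ncurves G)).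

Local Notation gam := (curve G).
Local Notation Gam := (closure U `\` interior U).
Local Notation dgam j := (nderive 1 (curve G j)).
Local Notation mu := (@lebesgue_measure R).

(** On each curve the distance from [gam j s] to [x] is comparable to [e] plus the
    length of the arc between [gam j s] and the point nearest to [x].  The three
    kernels in [bd] take into account that this arc may run through the origin of
    the parametrization. *)
Lemma oint_kernel : exists2 C : R, 0 <= C & forall x e f B, 0 < e ->
  (forall t, Gam t -> e <= normc (t - x)) -> contG G f -> 0 <= B ->
  (forall t, Gam t -> normc (f t) <= B * normc (t - x) `^ (alpha - 2)) ->
  normc (oint G f) <= C * B * e `^ (alpha - 1).
Proof.
have [a0 a1] := andP halpha; have [c c0 [Hc _]] := arc_chord G l2.
pose c1 := Num.min 1 (c / 2) / 2.
have m0 : 0 < Num.min 1 (c / 2) by rewrite lt_min ltr01 divr_gt0.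
have c10 : 0 < c1 by rewrite divr_gt0.
have c1a : 2 * c1 <= 1 by rewrite /c1 mulrCA divff// mulr1 ge_min lexx.
have c1b : 2 * c1 <= c / 2 by rewrite /c1 mulrCA divff// mulr1 ge_min lexx orbT.
pose M := c1 `^ (alpha - 2) * (12 / (1 - alpha)).
have M0 : 0 <= M by rewrite mulr_ge0 ?powR_ge0// divr_ge0//; lra.
exists ((ncurves G)%:R * M); first by rewrite mulr_ge0.
move=> x e f B e0 ex cf B0 fB; apply: le_trans (nc_sum _ _ _) _.
have -> : (ncurves G)%:R * M * B * e `^ (alpha - 1) =
    \sum_(j < ncurves G) M * (B * e `^ (alpha - 1)).
  by rewrite sumr_const card_ord -[RHS]mulr_natl -!mulrA.
apply: ler_sum => j _.
have L0 : 0 < len G j := len_gt0 j.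
have [s0 /andP[s00 s0L] Hs0] := nearest_on_curve j x.
pose k (a s : R) := (e + `|s - a|) `^ (alpha - 2).
pose bd s := B * c1 `^ (alpha - 2) * (k s0 s + k (s0 + len G j) s + k (s0 - len G j) s).
have ck a : continuous (k a) by exact: continuous_kernel.
have k0 a s : 0 <= k a s by exact: powR_ge0.
have cbd : continuous bd.
  by move=> s; apply: cvgMr; exact: (cvgD (cvgD (ck _ s) (ck _ s)) (ck _ s)).
have lower s a : gam j a = gam j s0 -> `|s - a| <= len G j / 2 ->
    c1 * (e + `|s - a|) <= normc (gam j s - x).
  move=> ga sa; have := Hc j s a sa; rewrite ga => h1.
  have := nc_tri (gam j s) x (gam j s0); rewrite (ncBC x) => h2.
  have := Hs0 s => h3; have h4 := ex _ (Gam_curve j s).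
  have : 2 * c1 * `|s - a| <= c / 2 * `|s - a| by rewrite ler_wpM2r.
  have : 2 * c1 * e <= 1 * e by rewrite ler_wpM2r ?(ltW e0).
  rewrite mulrDr; lra.
have upper s a : gam j a = gam j s0 -> `|s - a| <= len G j / 2 ->
    normc (gam j s - x) `^ (alpha - 2) <= c1 `^ (alpha - 2) * k a s.
  move=> ga sa; have H := lower s a ga sa.
  have ea : 0 < e + `|s - a| by rewrite ltr_pwDl.
  by rewrite -powRM ?(ltW c10) ?(ltW ea)//; apply: powR_neg_le => //; rewrite mulr_gt0.
have fbd s : 0 <= s <= len G j -> normc (f (gam j s) * dgam j s) <= bd s.
  move=> /andP[s1 s2]; rewrite ncM dgam1 mulr1.
  apply: le_trans (fB _ (Gam_curve j s)) _; rewrite /bd -[leRHS]mulrA ler_wpM2l//.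
  have P a : 0 <= c1 `^ (alpha - 2) * k a s by rewrite mulr_ge0 ?powR_ge0.
  have := P s0; have := P (s0 + len G j); have := P (s0 - len G j).
  rewrite !mulrDr.
  have [near|far] := leP `|s - s0| (len G j / 2).
    have := upper s s0 erefl near; lra.
  have [ss|/ltW ss] := leP s0 s.
    have E : gam j (s0 + len G j) = gam j s0 by exact: curve_periodic.
    have := upper s (s0 + len G j) E.
    move: far; rewrite ger0_norm ?subr_ge0// => far H.
    have : `|s - (s0 + len G j)| <= len G j / 2 by rewrite ler_norml; apply/andP; split; lra.
    move=> /H; lra.
  have E : gam j (s0 - len G j) = gam j s0.
    by rewrite -(curve_periodic j (s0 - len G j)) subrK.
  have := upper s (s0 - len G j) E.
  move: far; rewrite ler0_norm ?subr_le0// => far H.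
  have : `|s - (s0 - len G j)| <= len G j / 2 by rewrite ler_norml; apply/andP; split; lra.
  move=> /H; lra.
have cint : ccont (fun s => f (gam j s) * dgam j s).
  by apply: ccontM; [exact: cf|exact: ccont_dgam].
apply: le_trans (cintegral_le cint cbd fbd) _.
have ik a : mu.-integrable `[0, len G j] (EFin \o k a) by exact: continuous_integrable_cc.
have ckk : continuous (fun s => k s0 s + k (s0 + len G j) s).
  by move=> s; exact: cvgD (ck _ s) (ck _ s).
have -> : \int[mu]_(s in `[0, len G j]) bd s = B * c1 `^ (alpha - 2) *
   (\int[mu]_(s in `[0, len G j]) k s0 s + \int[mu]_(s in `[0, len G j]) k (s0 + len G j) s +
    \int[mu]_(s in `[0, len G j]) k (s0 - len G j) s).
  rewrite -RintegralD// -RintegralD//; last exact: continuous_integrable_cc.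
  rewrite -RintegralZl//; apply: continuous_integrable_cc => s.
  exact: cvgD (ckk s) (ck _ s).
have KI a := kernel_integral halpha a e0 L0.
have := KI s0; have := KI (s0 + len G j); have := KI (s0 - len G j).
rewrite -/(k _); move=> h1 h2 h3.
apply: (@le_trans _ _ (2 * (B * c1 `^ (alpha - 2) * (6 * (e `^ (alpha - 1) / (1 - alpha)))))).
  rewrite ler_wpM2l// ler_wpM2l ?mulr_ge0 ?powR_ge0//; lra.
by rewrite /M le_eqVlt; apply/orP; left; apply/eqP; ring.
Qed.

(** Replacing [f] by [f - f tau] costs nothing, since the moments vanish, and
    creates a zero at the boundary point [tau] nearest to the pole [x]; the factor
    [(t - tau) / (t - x)] is bounded by two.  Iterating absorbs all poles but the
    last two; the accumulated factors form the quotient of [nodes T] by [nodes Y].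
    In the last step the zero is put next to the pole [x1]. *)
Lemma oint_two_poles (j0 : 'I_(ncurves G)) p : exists2 C : R, 0 <= C &
  forall X T Y F A B x1 x2 e K, size X = p -> size T = size Y ->
  {in X, forall x, U x} -> {in Y, forall x, U x} -> U x1 -> U x2 ->
  0 <= B -> (forall t, Gam t -> normc (nodes T t / nodes Y t) <= B) ->
  whitney alpha Gam p F A -> contG G (fun t => (F t).[t] * (nodes T t / nodes Y t)) ->
  0 < e -> (forall t, Gam t -> e <= normc (t - x1)) ->
  (forall t, Gam t -> e <= normc (t - x2)) -> 0 <= K -> normc (x1 - x2) <= K * e ->
  normc (oint G (fun t => (F t).[t] * (nodes T t / nodes Y t) / nodes [:: x1, x2 & X] t)) <=
    C * (1 + K) * (A * B) * e `^ (alpha - 1).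
Proof.
have split_at X T Y F (t0 : R[i]) : size T = size Y -> {in X, forall x, U x} ->
    {in Y, forall x, U x} -> (2 <= size X)%N -> Gam t0 ->
    contG G (fun t => (F t).[t] * (nodes T t / nodes Y t)) ->
    oint G (fun t => (F t).[t] * (nodes T t / nodes Y t) / nodes X t) =
    oint G (fun t => ((F t).[t] - (F t0).[t0]) * (nodes T t / nodes Y t) / nodes X t).
  move=> TY XU YU X2 Gt0 cF; set z := (F t0).[t0].
  have cK : contG G (fun t => nodes T t / nodes Y t).
    by apply: contGM; [exact: contG_nodes|exact: contG_invnodes].
  have cX := @contG_invnodes _ _ _ G U_open _ XU.
  have XYU : {in X ++ Y, forall x, U x} by move=> x; rewrite mem_cat => /orP[/XU|/YU].
  have M : oint G (fun t => nodes T t / nodes Y t / nodes X t) = 0.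
    rewrite -[RHS](oint_moment G U_open l2 U_connected (T := T) (X := X ++ Y))//.
      apply: eq_oint => t Gt.
      rewrite (_ : nodes (X ++ Y) t = nodes X t * nodes Y t); last by rewrite /nodes big_cat.
      by rewrite invfM mulrAC mulrA.
    by rewrite size_cat TY addnC leq_add2r.
  rewrite -[LHS]subr0 -[X in _ - X](mulr0 z) -M -ointZ//; last exact: contGM.
  rewrite -ointB//; [|exact: contGM|].
    by apply: eq_oint => t _; rewrite mulrBl mulrBl !mulrA.
  by apply: contGM; [exact: contG_cst|exact: contGM].
have zero t (t0 x : R[i]) : (forall t', Gam t' -> normc (t0 - x) <= normc (t' - x)) ->
    Gam t -> normc (t - t0) <= 2 * normc (t - x).
  move=> nr Gt; have := nc_tri t x t0; rewrite (ncBC x); have := nr t Gt; lra.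
elim: p => [|p [C C0 IH]].
  have [C C0 HC] := oint_kernel; exists (2 * C); first by rewrite mulr_ge0.
  move=> X T Y F A B x1 x2 e K /size0nil -> TY _ YU U1 U2 B0 KB wF cF e0 e1 e2 K0 xx.
  have [t0 Gt0 nr] := nearest j0 x1.
  have A0 : 0 <= A := le_trans (nc_ge0 _) (whitney_bound wF Gt0).
  have XU : {in [:: x1; x2], forall x, U x} by move=> x; rewrite !inE => /orP[]/eqP->.
  rewrite (split_at _ _ _ _ t0)//.
  have -> : 2 * C * (1 + K) * (A * B) = C * (2 * A * B * (1 + K)) by ring.
  apply: (HC x1) => //.
  - apply: contGM; last exact: contG_invnodes.
    have cK : contG G (fun t => nodes T t / nodes Y t).
      by apply: contGM; [exact: contG_nodes|exact: contG_invnodes].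
    have : contG G (fun t => (F t).[t] * (nodes T t / nodes Y t) -
        (F t0).[t0] * (nodes T t / nodes Y t)).
      by apply: contGB => //; apply: contGM => //; exact: contG_cst.
    by apply: eq_contG => t _; rewrite mulrBl.
  - by rewrite !mulr_ge0//; lra.
  move=> t Gt; have p1 : 0 < normc (t - x1) := lt_le_trans e0 (e1 t Gt).
  have p2 : 0 < normc (t - x2) := lt_le_trans e0 (e2 t Gt).
  rewrite powR_sub2// !ncM !ncV nodes_cons nodes_cons /nodes big_nil mulr1 !ncM.
  have h1 : normc ((F t).[t] - (F t0).[t0]) <= A * (2 * normc (t - x1) `^ alpha).
    apply: le_trans (whitney_holder halpha wF Gt Gt0) _; rewrite ler_wpM2l//.
    by apply: powR_le_scale => //; rewrite ?nc_ge0//; [lra|exact: zero].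
  have h2 : (normc (t - x2))^-1 <= (1 + K) / normc (t - x1).
    rewrite ler_pdivlMr// mulrC ler_pdivrMr// mulrDl mul1r.
    apply: le_trans (nc_tri t x2 x1) _; rewrite lerD2l (ncBC x2).
    by apply: le_trans xx _; rewrite ler_wpM2l//; exact: e2.
  rewrite invfM; have := KB t Gt; rewrite ncM ncV => h3.
  apply: (@le_trans _ _ (A * (2 * normc (t - x1) `^ alpha) * B *
     ((normc (t - x1))^-1 * ((1 + K) / normc (t - x1))))).
    apply: ler_pM; rewrite ?mulr_ge0 ?invr_ge0 ?nc_ge0//.
      by apply: ler_pM; rewrite ?mulr_ge0 ?invr_ge0 ?nc_ge0.
    by rewrite ler_wpM2l// invr_ge0 nc_ge0.
  by rewrite le_eqVlt; apply/orP; left; apply/eqP; ring.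
have [Cd Cd0 Hd] := whitney_div Gam halpha p.
exists (C * Cd * 2); first by rewrite !mulr_ge0.
move=> [//|x X] T Y F A B x1 x2 e K /= [sX] TY XU YU U1 U2 B0 KB wF cF e0 e1 e2 K0 xx.
have [t0 Gt0 nr] := nearest j0 x.
have Ux : U x by apply: XU; rewrite mem_head.
have XU' : {in X, forall x, U x} by move=> y yX; apply: XU; rewrite inE yX orbT.
have YU' : {in x :: Y, forall x, U x} by move=> y; rewrite inE => /predU1P[->|/YU].
have [F' wF' HF'] := Hd F A t0 Gt0 wF.
have AU : {in [:: x1, x2, x & X], forall x, U x}.
  by move=> y; rewrite !inE => /or4P[/eqP->|/eqP->|/eqP->|/XU'].
rewrite (split_at _ _ _ _ t0)//.
have nz t : Gam t -> [/\ t - x != 0, nodes Y t != 0 & nodes [:: x1, x2 & X] t != 0].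
  move=> Gt; split; [exact: node_neq0 Ux Gt|exact: nodes_neq0 YU Gt|].
  apply: (nodes_neq0 U_open) Gt.
  by move=> y; rewrite !inE => /or3P[/eqP->|/eqP->|/XU'].
rewrite (_ : oint G _ = oint G (fun t => (F' t).[t] * (nodes (t0 :: T) t / nodes (x :: Y) t) /
     nodes [:: x1, x2 & X] t)); last first.
  apply: eq_oint => t Gt; rewrite HF'//.
  have pX : perm_eq [:: x1, x2, x & X] (x :: [:: x1, x2 & X]).
    by rewrite (perm_catCA [:: x1; x2] [:: x] X).
  rewrite (nodes_perm _ pX) [nodes (t0 :: T) t]nodes_cons [nodes (x :: Y) t]nodes_cons.
  rewrite [nodes (x :: [:: x1, x2 & X]) t]nodes_cons.
  by have [h1 h2 h3] := nz t Gt; field; rewrite h1 h2 h3.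
have -> : C * Cd * 2 * (1 + K) * (A * B) = C * (1 + K) * (Cd * A * (2 * B)) by ring.
apply: IH => //.
- by rewrite /= TY.
- by rewrite mulr_ge0.
- move=> t Gt; rewrite !nodes_cons invfM mulrACA ncM ler_pM ?nc_ge0//; last exact: KB.
  have [h1 _ _] := nz t Gt.
  by rewrite ncM ncV ler_pdivrMr ?nc_gt0//; exact: zero.
- apply: (@eq_contG _ _ _ G (fun t => ((F t).[t] * (nodes T t / nodes Y t) -
     (F t0).[t0] * (nodes T t / nodes Y t)) * (t - x)^-1)).
    move=> t Gt; rewrite -mulrBl HF'// !nodes_cons.
    by have [h1 h2 h3] := nz t Gt; field; rewrite h1 h2.
  apply: contGM; last by have := @contG_invnode _ _ _ G U_open _ 1 Ux.
  apply: contGB => //; apply: contGM; first exact: contG_cst.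
  by apply: contGM; [exact: contG_nodes|exact: contG_invnodes].
Qed.

End CauchyEstimate.

(** * From interior estimates to the boundary *)

Section Chains.
Variables (R : realType) (U : set R[i]) (l : nat) (G : smooth_boundary U l) (alpha : R).
Hypotheses (U_open : open U) (l2 : (2 <= l)%N) (halpha : 0 < alpha < 1).
Hypotheses (U_bounded : bounded_set U).
Implicit Types (t x y z : R[i]) (A K e : R) (h : R[i] -> R[i]).

Local Notation gam := (curve G).
Local Notation Gam := (closure U `\` interior U).
Local Notation dgam j := (nderive 1 (curve G j)).

Definition deep e x := forall t, Gam t -> e <= normc (t - x).

(** The estimate with two poles controls such pairs only, whose distance is
    comparable to their distances to the boundary. *)
Definition interior_holder h K A := forall x y e, U x -> U y -> 0 < e -> deep e x ->
  deep e y -> normc (x - y) <= K * e -> normc (h x - h y) <= A * e `^ alpha.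

Let lam : R := (2^-1) `^ alpha.

Let lam1 : lam < 1.
Proof.
have [a0 a1] := andP halpha; suff : lam < 1 `^ alpha by rewrite powR1.
by rewrite /lam gt0_ltr_powR// ?nnegrE; lra.
Qed.

Let lam_half e : 0 <= e -> (e / 2) `^ alpha = lam * e `^ alpha.
Proof. by move=> e0; rewrite mulrC powRM// invr_ge0. Qed.

(** Starting at [x] close to the boundary, move to the point at height [d] above
    the nearest boundary point, doubling the height at each step: the errors form
    a geometric series dominated by the last one. *)
Lemma deepen (j0 : 'I_(ncurves G)) : exists2 e0 : R, 0 < e0 & exists2 C : R, 0 <= C &
  forall h K A, 4 <= K -> 0 <= A -> interior_holder h K A ->
  forall x d, U x -> 0 < d <= e0 -> exists x',
  [/\ U x', deep (d / 2) x', normc (x - x') <= 2 * d &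
      normc (h x - h x') <= C * A * d `^ alpha].
Proof.
have [a0 a1] := andP halpha.
have [e0 e00 Hc] := collar G U_open l2.
have l1 := lam1; have l0 : 0 <= lam by exact: powR_ge0.
pose C : R := (1 - lam)^-1.
have Cpos : 0 < C by rewrite invr_gt0; lra.
have CE : C * lam + 1 = C.
  by rewrite /C; field; rewrite subr_eq0 gt_eqF.
have C1 : 1 <= C by rewrite -CE lerDr mulr_ge0// ltW.
exists e0 => //; exists C; first exact: ltW.
move=> h K A K4 A0 ih x d Ux /andP[d0 de0].
have [t /[dup] Gt /(Gam_param G)[j [s gs]] nr] := nearest j0 x.
set eps := normc (t - x) in nr.
have eps0 : 0 < eps by rewrite nc_gt0; exact: (node_neq0 U_open Ux Gt).
pose p e := gam j s + e%:C * 'i%C * dgam j s.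
have Up e : 0 < e <= e0 -> U (p e) /\ deep (e / 2) (p e) by exact: Hc.
have pd e e' : normc (p e - p e') = `|e - e'|.
  rewrite (_ : p e - p e' = (e - e')%:C * 'i%C * dgam j s); last by rewrite /p rmorphB /=; ring.
  by rewrite !ncM dgam1 ncR nc_i !mulr1.
have pt e : 0 < e -> normc (t - p e) = e.
  move=> ep; rewrite -gs /p opprD addrA subrr sub0r ncN !ncM dgam1 ncR nc_i !mulr1.
  by rewrite gtr0_norm.
have xp e : 0 < e -> normc (x - p e) <= eps + e.
  by move=> ep; have := nc_tri x t (p e); rewrite (pt e ep) (ncBC x t).
have [deepx|shallow] := leP d eps.
  exists x; split => //.
  - by move=> t' Gt'; apply: le_trans (nr t' Gt'); lra.
  - by rewrite subrr nc0 mulr_ge0// ltW.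
  - by rewrite subrr nc0 !mulr_ge0 ?powR_ge0// ltW.
have main N : forall e, 0 < e <= e0 -> eps <= e -> e <= 2 ^+ N * eps ->
    normc (h x - h (p e)) <= C * A * e `^ alpha.
  elim: N => [|N IH] e ee0 le1 le2.
    have [Upe dpe] := Up e ee0; have /andP[ep _] := ee0.
    have dx : deep (e / 2) x.
      by move=> t' Gt'; apply: le_trans (nr t' Gt'); rewrite expr0 mul1r in le2; lra.
    have e20 : 0 < e / 2 by rewrite divr_gt0.
    have := ih x (p e) (e / 2) Ux Upe e20 dx dpe _.
    rewrite (lam_half (ltW ep)) => H; apply: le_trans (H _) _.
      apply: le_trans (xp e ep) _; have : 4 * (e / 2) <= K * (e / 2) by rewrite ler_wpM2r// ltW.
      lra.
    rewrite mulrA ler_wpM2r ?powR_ge0// mulrC ler_wpM2r//; lra.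
  have /andP[ep ele] := ee0.
  have [small|big] := leP e (2 * eps).
    have [Upe dpe] := Up e ee0.
    have dx : deep (e / 2) x.
      by move=> t' Gt'; apply: le_trans (nr t' Gt'); lra.
    have e20 : 0 < e / 2 by rewrite divr_gt0.
    have := ih x (p e) (e / 2) Ux Upe e20 dx dpe _.
    rewrite (lam_half (ltW ep)) => H; apply: le_trans (H _) _.
      apply: le_trans (xp e ep) _; have : 4 * (e / 2) <= K * (e / 2) by rewrite ler_wpM2r// ltW.
      lra.
    rewrite mulrA ler_wpM2r ?powR_ge0// mulrC ler_wpM2r//; lra.
  have e2e0 : 0 < e / 2 <= e0 by apply/andP; split; lra.
  have [Upe dpe] := Up e ee0; have [Upe2 dpe2] := Up _ e2e0.
  have H1 : normc (h x - h (p (e / 2))) <= C * A * (e / 2) `^ alpha.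
    by apply: IH => //; [lra|rewrite exprS in le2; lra].
  have e40 : 0 < e / 2 / 2 by rewrite !divr_gt0.
  have dpe' : deep (e / 2 / 2) (p e) by move=> t' Gt'; apply: le_trans (dpe t' Gt'); lra.
  have H2 := ih _ _ _ Upe2 Upe e40 dpe2 dpe' _.
  have {}H2 : normc (h (p (e / 2)) - h (p e)) <= A * (e / 2 / 2) `^ alpha.
    apply: H2; rewrite pd ler0_norm; last by lra.
    by have : 4 * (e / 2 / 2) <= K * (e / 2 / 2) by [rewrite ler_wpM2r// ltW]; lra.
  apply: le_trans (nc_tri _ (h (p (e / 2))) _) _.
  apply: le_trans (lerD H1 H2) _.
  have e0' := ltW ep; have e20' : 0 <= e / 2 by lra.
  rewrite !lam_half//.
  rewrite -{2}CE mulrDl mul1r mulrDl.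
  have -> : C * A * (lam * e `^ alpha) = C * lam * A * e `^ alpha by ring.
  rewrite lerD2l ler_wpM2l// mulrA -[leRHS]mul1r ler_wpM2r ?powR_ge0//.
  by rewrite mulr_ile1// ltW.
have [N HN] : exists N, d <= 2 ^+ N * eps.
  exists (Num.truncn (d / eps)).+1; rewrite -ler_pdivrMr//.
  apply: le_trans (ltW (truncnS_gt _)) _.
  by rewrite -natrX ler_nat ltnW// ltn_expl.
exists (p d); have dd : 0 < d <= e0 by rewrite d0.
have [U1 D1] := Up d dd; split => //.
  by apply: le_trans (xp d d0) _; lra.
by apply: (main N) => //; exact: ltW.
Qed.

(** Two points at distance [dl] are first moved to a depth of the order of [dl],
    where the hypothesis compares them; the depth is limited by the width of the
    collar, and [K] makes up for it since [U] is bounded. *)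
Lemma chain_holder (j0 : 'I_(ncurves G)) : exists2 K : R, 0 <= K & exists2 C : R, 0 <= C &
  forall h A, 0 <= A -> interior_holder h K A ->
  forall x y, U x -> U y -> normc (h x - h y) <= C * A * normc (x - y) `^ alpha.
Proof.
have [a0 a1] := andP halpha.
have [e0 e00 [C C0 HC]] := deepen j0.
have [S S0 HS] := bounded_nc U_bounded.
pose K := 10 + 4 * S / e0.
have K10 : 10 <= K by rewrite /K lerDl divr_ge0 ?mulr_ge0 ?(ltW e00).
exists K; first by lra.
exists (2 * C + 1); first by rewrite addr_ge0 ?mulr_ge0.
move=> h A A0 ih x y Ux Uy.
have [->|xy] := eqVneq x y.
  by rewrite !subrr nc0 mulr_ge0 ?powR_ge0// mulr_ge0// addr_ge0 ?mulr_ge0.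
set dl := normc (x - y).
have dl0 : 0 < dl by rewrite nc_gt0 subr_eq0.
pose d := Num.min dl e0.
have d0 : 0 < d by rewrite lt_min dl0.
have de0 : d <= e0 by rewrite ge_min lexx orbT.
have ddl : d <= dl by rewrite ge_min lexx.
have dd : 0 < d <= e0 by rewrite d0.
have K4 : 4 <= K by lra.
have [x' [Ux' Dx' xx' hx]] := HC h K A K4 A0 ih x d Ux dd.
have [y' [Uy' Dy' yy' hy]] := HC h K A K4 A0 ih y d Uy dd.
have x'y' : normc (x' - y') <= dl + 4 * d.
  have := nc_tri x' x y'; have := nc_tri x y y'; rewrite (ncBC x' x) -/dl; lra.
have far : dl + 4 * d <= K * (d / 2).
  have [le|lt] := leP dl e0.
    have dE : d = dl by rewrite /d min_l.
    have : 10 * (d / 2) <= K * (d / 2) by rewrite ler_wpM2r//; lra.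
    rewrite -dE; lra.
  have dE : d = e0 by rewrite /d min_r// ltW.
  have : dl <= 2 * S.
    apply: le_trans (ncB _ _) _; have := HS x Ux; have := HS y Uy; lra.
  rewrite dE (_ : K * (e0 / 2) = 5 * e0 + 2 * S); first by lra.
  by rewrite /K; field; rewrite gt_eqF.
have d20 : 0 < d / 2 by rewrite divr_gt0.
have H := ih x' y' (d / 2) Ux' Uy' d20 Dx' Dy' (le_trans x'y' far).
have H' : normc (h x' - h y') <= A * d `^ alpha.
  apply: le_trans H _; rewrite ler_wpM2l//.
  by apply: ge0_ler_powR; rewrite ?nnegrE//; lra.
apply: (@le_trans _ _ ((2 * C + 1) * A * d `^ alpha)).
  have := nc_tri (h x) (h x') (h y); have := nc_tri (h x') (h y') (h y).
  rewrite (ncBC (h y') (h y)) !mulrDl; lra.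
rewrite ler_wpM2l ?mulr_ge0 ?addr_ge0 ?mulr_ge0//.
by apply: ge0_ler_powR; rewrite ?nnegrE//; lra.
Qed.

End Chains.

(** * Cauchy integrals as functions of their poles *)

Section MultiCauchy.
Variables (R : realType) (U : set R[i]) (l : nat) (G : smooth_boundary U l) (alpha : R).
Variable m : nat.
Hypotheses (U_nonempty : U !=set0) (U_open : open U) (U_connected : connected U).
Hypotheses (U_bounded : bounded_set U).
Hypotheses (ml : (m.+2 <= l)%N) (halpha : 0 < alpha < 1).
Implicit Types (t x y z : R[i]) (X Y P : seq R[i]) (A K e : R) (phi : R[i] -> R[i]).

Local Notation gam := (curve G).
Local Notation Gam := (closure U `\` interior U).

Let l2 : (2 <= l)%N. Proof. exact: leq_trans ml. Qed.

(** On distinct nodes this is, up to a constant, the divided difference of the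
    Cauchy transform of [phi]. *)
Definition multi_cauchy phi X : R[i] := oint G (fun t => phi t / nodes X t).

Lemma oint_nocurve f : ncurves G = 0%N -> oint G f = 0.
Proof.
move=> n0; rewrite /oint; apply: big1 => j _.
by have := ltn_ord j; rewrite {2}n0.
Qed.

(** The difference in one variable is [x - y] times an integral with both poles
    [x] and [y]. *)
Let multi_cauchy_one : exists2 C : R, 0 <= C & forall phi A, 0 <= A -> contG G phi ->
  (forall j, hold alpha 1 m (fun s => phi (gam j s)) A) ->
  forall X x y, size X = m -> {in X, forall x, U x} -> U x -> U y ->
  normc (multi_cauchy phi (x :: X) - multi_cauchy phi (y :: X)) <= C * A * normc (x - y) `^ alpha.
Proof.
have [n0|np] := posnP (ncurves G).
  exists 0 => // phi A A0 _ _ X x y _ _ _ _.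
  by rewrite /multi_cauchy !oint_nocurve// subrr nc0 !mul0r.
have j0 : 'I_(ncurves G) := Ordinal np.
have [Cj Cj0 HJ] := boundary_jet G halpha ml.
have [C2 C20 H2] := oint_two_poles U_open l2 halpha U_connected j0 m.
have [K K0 [C3 C30 H3]] := chain_holder U_open l2 halpha U_bounded j0.
exists (C3 * (K * (C2 * (1 + K) * Cj))); first by rewrite !mulr_ge0 ?addr_ge0.
move=> phi A A0 cphi hphi X x y sX XU Ux Uy.
have [F wF HF] := HJ phi A A0 hphi.
rewrite [leRHS](_ : _ = C3 * (K * (C2 * (1 + K) * Cj) * A) * normc (x - y) `^ alpha); last by ring.
apply: (H3 (fun z => multi_cauchy phi (z :: X))) => //.
  by rewrite !mulr_ge0 ?addr_ge0.
move=> {Ux Uy} {}x {}y e Ux Uy e0 Dx Dy xy.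
have cX z : U z -> {in z :: X, forall x, U x}.
  by move=> Uz u; rewrite inE => /predU1P[->|/XU].
have cXX : {in [:: x, y & X], forall x, U x}.
  by move=> u; rewrite !inE => /or3P[/eqP->|/eqP->|/XU].
have Ediff : multi_cauchy phi (x :: X) - multi_cauchy phi (y :: X) =
    (x - y) * oint G (fun t => (F t).[t] * (nodes [::] t / nodes [::] t) / nodes [:: x, y & X] t).
  rewrite -ointB//; try by apply: contGM => //; apply: (contG_invnodes U_open); exact: cX.
  rewrite -ointZ//.
    apply: eq_oint => t Gt; rewrite HF// !nodes_cons.
    have h1 := node_neq0 U_open Ux Gt; have h2 := node_neq0 U_open Uy Gt.
    have h3 := nodes_neq0 U_open XU Gt; rewrite /nodes !big_nil.
    by rewrite divff ?oner_eq0// mulr1; field; rewrite h1 h2 h3.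
  apply: (@eq_contG _ _ _ G (fun t => phi t / nodes [:: x, y & X] t)).
    by move=> t Gt; rewrite HF// /nodes !big_nil divff ?oner_eq0// mulr1.
  by apply: contGM => //; apply: (contG_invnodes U_open).
rewrite Ediff ncM.
have B : normc (oint G (fun t => (F t).[t] * (nodes [::] t / nodes [::] t) / nodes [:: x, y & X] t))
    <= C2 * (1 + K) * (Cj * A * 1) * e `^ (alpha - 1).
  apply: (H2 X [::] [::] F (Cj * A) 1 x y e K) => //.
    by move=> t _; rewrite /nodes !big_nil divff ?oner_eq0// nc1.
  apply: (@eq_contG _ _ _ G phi) => // t Gt.
  by rewrite HF// /nodes !big_nil divff ?oner_eq0// mulr1.
apply: le_trans (ler_pM (nc_ge0 _) (nc_ge0 _) xy B) _.
rewrite -(powR_sub1 alpha e0) le_eqVlt; apply/orP; left; apply/eqP; ring.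
Qed.

Definition nodes_close (d : R) X Y := all2 (fun x y => normc (x - y) <= d) X Y.

Lemma multi_cauchy_perm phi X Y : perm_eq X Y -> multi_cauchy phi X = multi_cauchy phi Y.
Proof. by move=> XY; apply: eq_oint => t _; rewrite (nodes_perm _ XY). Qed.

(** The nodes are moved one at a time.  Boundedness follows from Hoelder
    continuity, by comparison with the list that repeats a fixed point of [U]. *)
Lemma multi_cauchy_holder : exists2 C : R, 0 <= C & forall phi A, 0 <= A -> contG G phi ->
  (forall j, hold alpha 1 m (fun s => phi (gam j s)) A) ->
  (forall X Y d, size X = m.+1 -> {in X, forall x, U x} -> {in Y, forall y, U y} ->
    0 <= d -> nodes_close d X Y -> normc (multi_cauchy phi X - multi_cauchy phi Y) <= C * A * d `^ alpha) /\
  (forall X, size X = m.+1 -> {in X, forall x, U x} -> normc (multi_cauchy phi X) <= C * A).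
Proof.
have [a0 a1] := andP halpha.
have [C C0 HC] := multi_cauchy_one.
have [S S0 HS] := bounded_nc U_bounded.
have [u Uu] := U_nonempty.
have [e e0 He] := dist_pos U_open Uu.
have [Co Co0 HCo] := oint_le G l2.
pose C1 := m.+1%:R * C.
have C10 : 0 <= C1 by rewrite mulr_ge0.
pose C2 := C1 * (2 * S) `^ alpha + Co * (e ^- m.+1).
have C20 : 0 <= C2.
  by rewrite addr_ge0 ?mulr_ge0 ?powR_ge0// invr_ge0 exprn_ge0// ltW.
exists (C1 + C2); first exact: addr_ge0.
move=> phi A A0 cphi hphi.
have step d P X Y : 0 <= d -> (size P + size X = m.+1)%N -> {in P ++ X, forall x, U x} ->
    {in Y, forall y, U y} -> nodes_close d X Y ->
    normc (multi_cauchy phi (P ++ X) - multi_cauchy phi (P ++ Y)) <= (size X)%:R * (C * A * d `^ alpha).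
  move=> d0; elim: X Y P => [|x X IH] [|y Y] P //= sPX PXU YU.
    by rewrite subrr nc0 mul0r.
  move=> /andP[xy XY].
  have pc z Z : perm_eq (P ++ z :: Z) (z :: (P ++ Z)) by rewrite perm_catC /= perm_cons perm_catC.
  have Uy : U y by apply: YU; rewrite mem_head.
  have Ux : U x by apply: PXU; rewrite mem_cat mem_head orbT.
  have PXU' : {in P ++ X, forall x, U x}.
    by move=> z; rewrite mem_cat => /orP[zP|zX]; apply: PXU; rewrite mem_cat ?zP// inE zX !orbT.
  have H1 : normc (multi_cauchy phi (P ++ x :: X) - multi_cauchy phi (P ++ y :: X)) <= C * A * d `^ alpha.
    rewrite !(multi_cauchy_perm _ (pc _ _)); apply: le_trans (HC phi A A0 cphi hphi _ _ _ _ _ Ux Uy) _ => //.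
      by rewrite size_cat; move: sPX; rewrite addnS => -[].
    rewrite ler_wpM2l ?mulr_ge0//; apply: ge0_ler_powR; rewrite ?nnegrE ?nc_ge0// ltW//.
  have H2 : normc (multi_cauchy phi (rcons P y ++ X) - multi_cauchy phi (rcons P y ++ Y)) <=
      (size X)%:R * (C * A * d `^ alpha).
    apply: IH => //.
    - by rewrite size_rcons addSnnS.
    - move=> z; rewrite cat_rcons mem_cat inE => /or3P[zP|/eqP->//|zX]; apply: PXU';
        by rewrite mem_cat ?zP ?zX ?orbT.
    - by move=> z zY; apply: YU; rewrite inE zY orbT.
  rewrite !cat_rcons in H2.
  apply: le_trans (nc_tri _ (multi_cauchy phi (P ++ y :: X)) _) _.
  by rewrite -[in leRHS]natr1 mulrDl mul1r addrC lerD.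
have hol X Y d : size X = m.+1 -> {in X, forall x, U x} -> {in Y, forall y, U y} ->
    0 <= d -> nodes_close d X Y -> normc (multi_cauchy phi X - multi_cauchy phi Y) <= C1 * A * d `^ alpha.
  move=> sX XU YU d0 XY; have := step d [::] X Y d0 sX XU YU XY.
  by rewrite sX /C1 !mulrA.
split.
  move=> X Y d sX XU YU d0 XY; apply: le_trans (hol X Y d sX XU YU d0 XY) _.
  by rewrite !ler_wpM2r ?powR_ge0// lerDl.
move=> X sX XU.
pose Y := nseq m.+1 u.
have YU : {in Y, forall y, U y} by move=> y /nseqP[-> _].
have XY : nodes_close (2 * S) X Y.
  rewrite /Y -sX; elim: X {sX} XU => //= x X IH XU; apply/andP; split.
    apply: le_trans (ncB _ _) _; have := HS x (XU x (mem_head _ _)); have := HS u Uu; lra.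
  by apply: IH => z zX; apply: XU; rewrite inE zX orbT.
have H := hol X Y (2 * S) sX XU YU (mulr_ge0 (ler0n _ _) S0) XY.
have HY : normc (multi_cauchy phi Y) <= Co * (A * e ^- m.+1).
  apply: HCo; first by apply: contGM => //; apply: (contG_invnodes U_open).
  move=> t Gt; rewrite ncM ncV; apply: ler_pM; rewrite ?nc_ge0 ?invr_ge0 ?nc_ge0//.
    by have [j [s <-]] := Gam_param G Gt; exact: hold_bound (hphi j).
  have nE : normc (nodes Y t) = normc (t - u) ^+ m.+1.
    by rewrite /nodes /Y big_nseq iter_mulr_1 ncX.
  have tu := He t Gt.
  rewrite nE lef_pV2 ?posrE ?exprn_gt0//; last exact: lt_le_trans tu.
  by rewrite lerXn2r ?nnegrE ?nc_ge0// ltW.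
have := nc_rtri (multi_cauchy phi X) (multi_cauchy phi Y).
have : C1 * A * (2 * S) `^ alpha + Co * (A * e ^- m.+1) = C2 * A by rewrite /C2; ring.
have : 0 <= C1 * A by rewrite mulr_ge0.
rewrite [(C1 + C2) * A]mulrDl; lra.
Qed.

End MultiCauchy.

(** * Roots and coefficients *)

Section Roots.
Variable R : realType.
Implicit Types (x y t : R[i]) (X Y : seq R[i]) (r e B C : R).

Lemma vieta (S : comNzRingType) n (x : 'I_n -> S) (t : S) :
  \prod_i (t - x i) = t ^+ n + \sum_(i < n) (-1) ^+ i.+1 *
    (\sum_(A : {set 'I_n} | #|A| == i.+1) \prod_(j in A) x j) * t ^+ (n - i.+1).
Proof.
rewrite (eq_bigr (fun i => (- x i) + t)); last by move=> i _; rewrite addrC.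
rewrite (bigA_distr _ _ (fun i => - x i) (fun=> t)) /=.
have mc (A : {set 'I_n}) : (#|A| <= n)%N by rewrite -[leqRHS]card_ord max_card.
have term (A : {set 'I_n}) : \prod_i (if i \in A then - x i else t) =
    (-1) ^+ #|A| * (\prod_(j in A) x j) * t ^+ (n - #|A|).
  rewrite (bigID (fun i => i \in A)) /=; congr (_ * _).
    rewrite (eq_bigr (fun i => - x i)); last by move=> i ->.
    by rewrite prodrN.
  rewrite (eq_bigr (fun=> t)); last by move=> i /negbTE->.
  rewrite prodr_const; congr (_ ^+ _).
  apply: (@addnI #|A|); rewrite subnKC//.
  exact: etrans (cardC (mem A)) (card_ord n).
rewrite (eq_bigr _ (fun A _ => term A)).
rewrite (partition_big (fun A : {set 'I_n} => inord #|A| : 'I_n.+1) xpredT)//=.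
rewrite big_ord_recl; congr (_ + _).
  rewrite (big_pred1 (finset.set0 : {set 'I_n})); last first.
    move=> A /=; rewrite -cards_eq0; apply/eqP/eqP => [/(congr1 val)|A0].
      by rewrite /= inordK// ltnS mc.
    by apply/val_inj; rewrite /= inordK A0.
  by rewrite cards0 expr0 mul1r big_pred0 ?mul1r ?subn0// => i; rewrite inE.
apply: eq_bigr => i _.
rewrite (eq_bigl (fun A : {set 'I_n} => #|A| == i.+1)); last first.
  move=> A; apply/eqP/eqP => [/(congr1 val)|Ai].
    by rewrite /= inordK// ltnS mc.
  by apply/val_inj; rewrite /= inordK Ai// ltnS.
rewrite mulr_sumr mulr_suml; apply: eq_bigr => A /eqP ->.
by [].
Qed.

Definition rootpoly X : {poly R[i]} := \prod_(x <- X) ('X - x%:P).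

Lemma rootpoly_cons x X : rootpoly (x :: X) = ('X - x%:P) * rootpoly X.
Proof. by rewrite /rootpoly big_cons. Qed.

Lemma rootpoly_perm X Y : perm_eq X Y -> rootpoly X = rootpoly Y.
Proof. exact: perm_big. Qed.

Lemma pnorm_rootpoly r s X : 0 <= s -> {in X, forall x, normc x <= r} ->
  pnorm s (rootpoly X) <= (s + r) ^+ size X.
Proof.
move=> s0; elim: X => [|x X IH] Xr.
  by rewrite /rootpoly big_nil -polyC1 pnormC nc1 expr0.
rewrite rootpoly_cons /= exprS; apply: le_trans (pnormM _ _ s0) _.
apply: ler_pM; rewrite ?pnorm_ge0//.
  apply: le_trans (pnorm_XsubC _ s0) _.
  by rewrite lerD2l Xr// mem_head.
by apply: IH => y yX; apply: Xr; rewrite inE yX orbT.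
Qed.

(** The radius exceeds the modulus of [x] by one, hence the term [x *: Q] of the
    product cannot compensate ['X * Q]. *)
Lemma pnorm_synth r x (Q : {poly R[i]}) : 0 <= r -> normc x <= r ->
  pnorm (r + 1) Q <= pnorm (r + 1) (('X - x%:P) * Q).
Proof.
move=> r0 xr; have r1 : 0 <= r + 1 by lra.
have Q0 := pnorm_ge0 Q r1.
have : (r + 1) * pnorm (r + 1) Q <= pnorm (r + 1) (('X - x%:P) * Q) + r * pnorm (r + 1) Q.
  rewrite -pnormMX.
  have -> : Q * 'X = ('X - x%:P) * Q + x *: Q by rewrite -mul_polyC; ring.
  apply: le_trans (pnormD _ _ r1) _; rewrite lerD2l pnormZ.
  by rewrite ler_wpM2r.
lra.
Qed.

Let prod_gt (c : R) x Y : 0 <= c -> (0 < size Y)%N -> {in Y, forall y, c < normc (x - y)} ->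
  c ^+ size Y < normc (\prod_(y <- Y) (x - y)).
Proof.
move=> c0; elim: Y => [//|y Y IH] _ H; rewrite big_cons ncM /= exprS.
have cy : c < normc (x - y) by apply: H; rewrite mem_head.
case: Y IH H => [_ _|z Z IH H]; first by rewrite big_nil nc1 expr0 !mulr1.
apply: ltr_pM => //; rewrite ?exprn_ge0// IH//.
by move=> w wY; apply: H; rewrite inE wY orbT.
Qed.

Lemma nodes_close_mono (d d' : R) X Y : d <= d' -> nodes_close d X Y -> nodes_close d' X Y.
Proof.
move=> dd'; elim: X Y => [|x X IH] [|y Y] //= /andP[h /IH ->].
by rewrite (le_trans h dd').
Qed.

(** If the coefficients of two monic polynomials of degree [n] differ by a
    quantity of size [e ^+ n`!], their roots can be matched within a multiple of
    [e]: some root of the second polynomial is close to a given root of the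
    first one, and both are divided out. Each division costs one root extraction,
    hence the factorial. *)
Lemma root_matching r n : 0 <= r -> forall B, 0 <= B -> exists2 C : R, 0 <= C &
  forall e X Y, 0 <= e <= 1 -> size X = n -> size Y = n ->
  {in X, forall x, normc x <= r} -> {in Y, forall y, normc y <= r} ->
  pnorm (r + 1) (rootpoly X - rootpoly Y) <= B * e ^+ n`! ->
  exists2 Y', perm_eq Y Y' & nodes_close (C * e) X Y'.
Proof.
move=> r0; elim: n => [|n IH] B B0.
  by exists 0 => // e X Y _ /size0nil-> /size0nil-> _ _ _; exists [::].
have r1 : 0 <= r + 1 by lra.
pose B' := B + (B + 1) * (r + 1 + r) ^+ n.
have B'0 : 0 <= B' by rewrite /B' addr_ge0 ?mulr_ge0 ?exprn_ge0//; lra.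
have [C C0 HC] := IH B' B'0.
exists (B + 1 + C); first lra.
move=> e X Y /andP[e0 e1]; case: X => [//|x X] [sX] sY Xr Yr H.
have xr : normc x <= r by apply: Xr; rewrite mem_head.
pose c := (B + 1) * e ^+ n`!.
have c0 : 0 <= c by rewrite mulr_ge0 ?exprn_ge0//; lra.
(* If all the roots in [Y] were farther from [x] than [c], the value at [x] of their
   polynomial would exceed [c ^+ n.+1], more than the coefficients allow. *)
have [y yY xy] : exists2 y, y \in Y & normc (x - y) <= c.
  have [/hasP[y yY xy]|/hasPn far] := boolP (has (fun y => normc (x - y) <= c) Y).
    by exists y.
  have Y0 : (0 < size Y)%N by rewrite sY.
  have := @prod_gt c x Y c0 Y0 _; rewrite sY => /(_ _)/lt_le_trans P.
  exfalso; suff : c ^+ n.+1 < c ^+ n.+1 by rewrite ltxx.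
  apply: P; first by move=> y /far; rewrite -ltNge.
  have <- : (rootpoly Y).[x] = \prod_(y <- Y) (x - y).
    by rewrite /rootpoly horner_prod; apply: eq_bigr => y _; rewrite !hornerE.
  have rx : (rootpoly (x :: X)).[x] = 0 by rewrite rootpoly_cons !hornerE subrr mul0r.
  have -> : normc (rootpoly Y).[x] = normc (rootpoly (x :: X) - rootpoly Y).[x].
    by rewrite !hornerE rx sub0r ncN.
  apply: le_trans (pnorm_horner _ _) (le_trans H _); first by lra.
  rewrite /c exprMn factS mulnC exprM ler_wpM2r ?exprn_ge0//.
  apply: (@le_trans _ _ (B + 1)); first lra.
  by rewrite -[leLHS]expr1 ler_weXn2l//; lra.
have pY := perm_to_rem yY; set Z := rem y Y in pY.
have sZ : size Z = n by rewrite size_rem// sY.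
have Xr' : {in X, forall x, normc x <= r} by move=> z zX; apply: Xr; rewrite inE zX orbT.
have Zr : {in Z, forall z, normc z <= r} by move=> z /mem_rem; exact: Yr.
have e1X k : e ^+ k <= 1 by rewrite exprn_ile1.
have HZ : pnorm (r + 1) (rootpoly X - rootpoly Z) <= B' * e ^+ n`!.
  apply: le_trans (pnorm_synth _ r0 xr) _.
  have -> : ('X - x%:P) * (rootpoly X - rootpoly Z) =
      (rootpoly (x :: X) - rootpoly Y) + (x - y) *: rootpoly Z.
    rewrite (rootpoly_perm pY) !rootpoly_cons -mul_polyC polyCB; ring.
  apply: le_trans (pnormD _ _ r1) _; rewrite pnormZ mulrDl; apply: lerD.
    apply: le_trans H _; rewrite ler_wpM2l// factS mulnC exprM -[leRHS]expr1.
    by apply: ler_wiXn2l => //; rewrite exprn_ge0.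
  rewrite mulrAC; apply: ler_pM => //; rewrite ?nc_ge0 ?pnorm_ge0//.
  by rewrite -sZ; exact: pnorm_rootpoly.
have [Z' ZZ' XZ'] := HC e X Z (introT andP (conj e0 e1)) sX sZ Xr' Zr HZ.
exists (y :: Z').
  by apply: perm_trans pY _; rewrite perm_cons.
rewrite /nodes_close /=; apply/andP; split; last first.
  by apply: nodes_close_mono XZ'; rewrite ler_wpM2r//; lra.
apply: le_trans xy _; rewrite /c; apply: ler_pM; rewrite ?exprn_ge0//; try lra.
by rewrite -[leRHS]expr1 ler_wiXn2l// fact_gt0.
Qed.

End Roots.

Section Symmetrization.
Variables (R : realType) (n : nat).
Implicit Types (z w x y : 'rV[R[i]]_n) (t : R[i]).

Definition coords x : seq R[i] := [seq x 0 i | i <- enum 'I_n].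

Lemma size_coords x : size (coords x) = n.
Proof. by rewrite size_map size_enum_ord. Qed.

Lemma coordsP (P : R[i] -> Prop) x : (forall i, P (x 0 i)) -> {in coords x, forall t, P t}.
Proof. by move=> H t /mapP[i _ ->]. Qed.

Lemma q_symmetrization x t : q (symmetrization x) t = nodes (coords x) t.
Proof.
rewrite /nodes /coords big_map big_enum /= (vieta (fun i => x 0 i)) /q.
by congr (_ + _); apply: eq_bigr => i _; rewrite mxE.
Qed.

Definition qpoly z : {poly R[i]} :=
  'X^n + \sum_(i < n) ((-1) ^+ i.+1 * z 0 i) *: 'X^(n - i.+1).

Lemma qpoly_symmetrization x : qpoly (symmetrization x) = rootpoly (coords x).
Proof.
rewrite /rootpoly /coords big_map big_enum /= (vieta (fun i => (x 0 i)%:P)) /qpoly.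
congr (_ + _); apply: eq_bigr => i _; rewrite mxE -mul_polyC; congr (_ * _).
rewrite rmorphM rmorphXn rmorphN rmorph1 rmorph_sum /=; congr (_ * _).
by apply: eq_bigr => A _; rewrite rmorph_prod.
Qed.

Lemma entry_le z w i : normc (z 0 i - w 0 i) <= euclidean_dist z w.
Proof.
rewrite /euclidean_dist -[leLHS](ger0_norm (nc_ge0 _)) -sqrtr_sqr ler_wsqrtr//.
by rewrite (bigD1 i)//= lerDl sumr_ge0// => j _; exact: exprn_ge0 (nc_ge0 _).
Qed.

Lemma pnorm_qpoly r : 0 <= r -> exists2 C : R, 0 <= C & forall z w,
  pnorm r (qpoly z - qpoly w) <= C * euclidean_dist z w.
Proof.
move=> r0; exists (\sum_(i < n) r ^+ (n - i.+1)).
  by apply: sumr_ge0 => i _; rewrite exprn_ge0.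
move=> z w; have -> : qpoly z - qpoly w =
    \sum_(i < n) ((-1) ^+ i.+1 * (z 0 i - w 0 i)) *: 'X^(n - i.+1).
  rewrite /qpoly opprD addrACA subrr add0r -sumrB; apply: eq_bigr => i _.
  by rewrite -scalerBl mulrBr.
rewrite mulr_suml; elim/big_rec2: _ => [|i y1 y2 _ H]; first by rewrite -polyC0 pnormC nc0.
apply: le_trans (pnormD _ _ r0) _; apply: lerD => //.
rewrite pnormZ ncM ncX ncN nc1 expr1n mul1r mulrC; apply: ler_pM; rewrite ?nc_ge0 ?pnorm_ge0//.
  apply: le_trans (pnormXn _ _ r0) _.
  by rewrite lerXn2r ?nnegrE ?pnorm_ge0// -['X]mul1r pnormMX -polyC1 pnormC nc1 mulr1.
exact: entry_le.
Qed.

(** The matching of roots with [e ^+ n`!] equal to the distance of the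
    coefficients. *)
Lemma coords_close r : 0 <= r -> exists2 C : R, 0 <= C & forall x y,
  (forall i, normc (x 0 i) <= r) -> (forall i, normc (y 0 i) <= r) ->
  euclidean_dist (symmetrization x) (symmetrization y) <= 1 ->
  exists2 Y, perm_eq (coords y) Y &
    nodes_close (C * euclidean_dist (symmetrization x) (symmetrization y) `^ (n`!%:R)^-1) (coords x) Y.
Proof.
move=> r0; have r1 : 0 <= r + 1 by lra.
have [B B0 HB] := pnorm_qpoly r1.
have [C C0 HC] := root_matching n r0 B0.
exists C => // x y xr yr; set d := euclidean_dist _ _ => d1.
have d0 : 0 <= d by exact: sqrtr_ge0.
have f0 : n`!%:R != 0 :> R by rewrite pnatr_eq0 -lt0n fact_gt0.
apply: HC; rewrite ?size_coords//.
- rewrite powR_ge0 /=; suff : d `^ (n`!%:R)^-1 <= 1 `^ (n`!%:R)^-1 by rewrite powR1.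
  by apply: ge0_ler_powR; rewrite ?nnegrE ?invr_ge0.
- by apply: coordsP.
- by apply: coordsP.
- rewrite -!qpoly_symmetrization -powR_mulrn ?powR_ge0// -powRrM mulVf// powRr1//.
Qed.

End Symmetrization.

(** * Holomorphy and derivatives *)

Section CauchyDerivatives.
Variables (R : realType) (U : set R[i]) (l n : nat) (G : smooth_boundary U l).
Hypotheses (U_open : open U) (l2 : (2 <= l)%N).
Implicit Types (z v : 'rV[R[i]]_n) (t : R[i]) (phi : R[i] -> R[i]).
Implicit Types (Phi : 'rV[R[i]]_n -> R[i]) (a r : nat).

Local Notation gam := (curve G).
Local Notation Gam := (closure U `\` interior U).

Definition regular : set 'rV[R[i]]_n := [set z | forall t, Gam t -> q z t != 0].

(** The shape common to the transform and all its derivatives. *)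
Definition qint phi a r z : R[i] := oint G (fun t => phi t * t ^+ a * q z t ^- r).

Definition qlin v t : R[i] := \sum_(i < n) (-1) ^+ i.+1 * v 0 i * t ^+ (n - i.+1).

Lemma qD z v t : q (v + z) t = q z t + qlin v t.
Proof.
rewrite /q /qlin -addrA -big_split; congr (_ + _); apply: eq_bigr => i _ /=.
by rewrite mxE -mulrDl -mulrDr [v 0 i + _]addrC.
Qed.

Lemma contG_sum (I : Type) (s : seq I) (F : I -> R[i] -> R[i]) :
  (forall i, contG G (F i)) -> contG G (fun t => \sum_(i <- s) F i t).
Proof. by move=> cF j; apply: (@ccont_sum _ _ _ _ (fun i u => F i (gam j u))) => i; exact: cF. Qed.

Lemma oint_sum (I : Type) (s : seq I) (F : I -> R[i] -> R[i]) :
  (forall i, contG G (F i)) -> oint G (fun t => \sum_(i <- s) F i t) = \sum_(i <- s) oint G (F i).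
Proof.
move=> cF; elim: s => [|i s IH].
  rewrite big_nil -[RHS](mul0r (oint G (fun=> 0))) -ointZ//; last exact: contG_cst.
  by apply: eq_oint => t _; rewrite big_nil mul0r.
rewrite big_cons -IH -ointD//; last exact: contG_sum.
by apply: eq_oint => t _; rewrite big_cons.
Qed.

Lemma contG_qlin v : contG G (qlin v).
Proof.
have H : forall i : 'I_n, contG G (fun t => (-1) ^+ i.+1 * v 0 i * t ^+ (n - i.+1)).
  move=> i.
  by apply: contGM; [exact: contG_cst|apply: contGX; exact: contG_id].
exact: (contG_sum (index_enum _) H).
Qed.

Lemma contG_q z : contG G (q z).
Proof.
have h : contG G (fun t => t ^+ n + qlin z t).
  by apply: contGD; [apply: contGX; exact: contG_id|exact: contG_qlin].
exact: h.
Qed.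

Lemma contG_invq z r : regular z -> contG G (fun t => q z t ^- r).
Proof.
move=> rz; apply: contGV; first by move=> t Gt; rewrite expf_neq0 ?rz.
by apply: contGX; exact: contG_q.
Qed.

Lemma Gam_bounded : exists2 S : R, 0 <= S & forall t, Gam t -> normc t <= S.
Proof.
have [||S S0 HS] := @fin_ub R _ (fun j (S : R) => forall s, normc (gam j s) <= S).
- move=> j; apply: (periodic_bounded (len_gt0 j)); first exact: ccont_gam.
  by move=> s; exact: curve_periodic.
- by move=> j C C' CC' H s; exact: le_trans CC'.
by exists S => // t /(Gam_param G)[j [s <-]].
Qed.

Lemma regular_lb z : regular z -> exists2 d : R, 0 < d & forall t, Gam t -> d <= normc (q z t).
Proof.
move=> rz; have [||d d0 Hd] := @fin_lb R _ (fun j d => forall s, d <= normc (q z (gam j s))).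
- move=> j; have cn : {within `[0, len G j], continuous (fun s => normc (q z (gam j s)))}.
    by apply: continuous_subspaceT; apply: continuous_normc; exact: contG_q.
  have [c _ Hc] := EVT_min (ltW (len_gt0 j)) cn.
  exists (normc (q z (gam j c))); first by rewrite nc_gt0 rz//; exact: Gam_curve.
  move=> s; have [s0 /andP[h1 h2] [<- _]] := curve_reduce j s.
  by apply: Hc; rewrite in_itv /= h1 ltW.
- by move=> j c c' _ cc' H s; exact: le_trans (H s).
by exists d => // t /(Gam_param G)[j [s <-]].
Qed.

(** The maximum norm, as a real number. *)
Definition nv v : R := complex.Re `|v|.

Lemma nvE v : (nv v)%:C = `|v|.
Proof. by rewrite /nv RRe_real// ger0_real. Qed.

Lemma nv_ge0 v : 0 <= nv v.
Proof. by rewrite -lecR nvE; exact: normr_ge0. Qed.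

Lemma entry_nv v i : normc (v 0 i) <= nv v.
Proof.
rewrite -lecR nvE ncE [leRHS]mx_normE -[leLHS]nngE num_le.
exact: (le_bigmax _ _ (ord0, i)).
Qed.

Lemma qlin_le : exists2 D : R, 0 <= D & forall v t, Gam t -> normc (qlin v t) <= D * nv v.
Proof.
have [S S0 HS] := Gam_bounded.
exists (\sum_(i < n) S ^+ (n - i.+1)); first by apply: sumr_ge0 => i _; rewrite exprn_ge0.
move=> v t Gt; apply: le_trans (nc_sum _ _ _) _; rewrite mulr_suml; apply: ler_sum => i _.
rewrite !ncM !ncX ncN nc1 expr1n mul1r mulrC ler_pM ?exprn_ge0 ?nc_ge0//; last exact: entry_nv.
by rewrite lerXn2r ?nnegrE ?nc_ge0//; exact: HS.
Qed.

Lemma inv_taylor r (d : R) : 0 < d -> exists2 C : R, 0 <= C & forall x y : R[i],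
  d <= normc x -> normc y <= d / 2 ->
  normc ((x + y) ^- r - x ^- r + r%:R * y * x ^- r.+1) <= C * normc y ^+ 2.
Proof.
move=> d0; have d20 : 0 < d / 2 by rewrite divr_gt0.
pose b := (d / 2)^-1; have b0 : 0 <= b by rewrite invr_ge0 ltW.
have bnd (u : R[i]) k : d / 2 <= normc u -> normc (u ^- k) <= b ^+ k.
  move=> du; rewrite ncV ncX -exprVn lerXn2r ?nnegrE ?invr_ge0 ?nc_ge0 ?(ltW d20)//.
  by rewrite /b lef_pV2 ?posrE//; exact: lt_le_trans du.
have low (x y : R[i]) : d <= normc x -> normc y <= d / 2 -> d / 2 <= normc (x + y).
  by move=> dx yd; have := nc_rtri x (- y); rewrite opprK ncN; lra.
elim: r => [|r [C C0 HC]].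
  by exists 0 => // x y _ _; rewrite !expr0 subrr add0r !mul0r nc0.
exists (b * C + r.+1%:R * (b ^+ r.+2 * b)).
  apply: addr_ge0; first exact: mulr_ge0.
  by apply: mulr_ge0 => //; apply: mulr_ge0 => //; exact: exprn_ge0.
move=> x y dx yd.
have dx' : d / 2 <= normc x by lra.
have dxy := low x y dx yd.
have x0 : x != 0 by rewrite -nc_gt0; lra.
have xy0 : x + y != 0 by rewrite -nc_gt0; lra.
have xr : x ^+ r != 0 by rewrite expf_neq0.
have -> : (x + y) ^- r.+1 - x ^- r.+1 + r.+1%:R * y * x ^- r.+2 =
   (x + y)^-1 * ((x + y) ^- r - x ^- r + r%:R * y * x ^- r.+1) +
   r.+1%:R * (x ^- r.+2 * (x + y) ^- 1) * y ^+ 2.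
  rewrite -!exprVn !exprSr -natr1 !exprVn; field.
  by rewrite x0 xy0 xr.
apply: le_trans (ncD _ _) _; rewrite mulrDl; apply: lerD.
  rewrite ncM -[leRHS]mulrA; apply: ler_pM; rewrite ?nc_ge0//; last exact: HC.
  by have := bnd _ 1%N dxy; rewrite !expr1.
rewrite 3!ncM ncX nc_nat ler_wpM2r ?exprn_ge0 ?nc_ge0// ler_wpM2l//.
by apply: ler_pM; rewrite ?nc_ge0 ?bnd//; have := bnd _ 1%N dxy; rewrite expr1.
Qed.

Section RowForm.
Variable c : 'I_n -> R[i].

Definition rowform (v : 'rV[R[i]]_n) : R[i] := \sum_(i < n) v 0 i * c i.

Lemma rowform_is_linear : linear rowform.
Proof.
move=> k u w; rewrite /rowform scaler_sumr -big_split; apply: eq_bigr => i _ /=.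
by rewrite !mxE mulrDl -mulrA.
Qed.

HB.instance Definition _ := GRing.isLinear.Build R[i] 'rV[R[i]]_n R[i] *:%R rowform rowform_is_linear.

Lemma rowform_continuous : continuous rowform.
Proof.
have H (s : seq 'I_n) : continuous (fun v : 'rV[R[i]]_n => \sum_(i <- s) v 0 i * c i).
  elim: s => [|i s IH] v.
    rewrite (_ : (fun v => _) = fun=> 0); first exact: cst_continuous.
    by apply/funext => u; rewrite big_nil.
  rewrite (_ : (fun v => _) = fun v => v 0 i * c i + \sum_(k <- s) v 0 k * c k); last first.
    by apply/funext => u; rewrite big_cons.
  have ci : {for v, continuous (fun v : 'rV[R[i]]_n => v 0 i * c i)}.
    have cc : {for v, continuous (fun v : 'rV[R[i]]_n => v 0 i)} by exact: coord_continuous.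
    exact: cvgM cc (@cst_continuous _ _ (c i) v).
  exact: cvgD ci (IH v).
exact: H.
Qed.

Lemma rowform_delta i : rowform (delta_mx 0 i) = c i.
Proof.
rewrite /rowform (bigD1 i)//= mxE !eqxx mul1r big1 ?addr0// => k ki.
by rewrite mxE (negbTE ki) andbF mul0r.
Qed.

End RowForm.

(** The integrand is expanded to first order in [q]; the quadratic remainder is
    uniform since the modulus of [q z] is bounded below on the boundary. *)
Lemma qint_expand phi a r z : contG G phi -> regular z ->
  exists c : 'I_n -> R[i], (forall i, c i = - r%:R * (-1) ^+ i.+1 * qint phi (a + (n - i.+1)) r.+1 z) /\
  exists2 C : R, 0 <= C & exists2 d : R, 0 < d & forall v, nv v <= d ->
    regular (v + z) /\
    normc (qint phi a r (v + z) - qint phi a r z - rowform c v) <= C * nv v ^+ 2.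
Proof.
move=> cphi rz.
exists (fun i : 'I_n => - r%:R * (-1) ^+ i.+1 * qint phi (a + (n - i.+1)) r.+1 z); split => //.
have [d d0 Hd] := regular_lb rz.
have [D D0 HD] := qlin_le.
have [C C0 HC] := inv_taylor r d0.
have [Co Co0 HCo] := oint_le G l2.
have cpa k : contG G (fun t => phi t * t ^+ k).
  by apply: contGM => //; apply: contGX; exact: contG_id.
have [S S0 HS] : exists2 S : R, 0 <= S & forall t, Gam t -> normc (phi t * t ^+ a) <= S.
  have [||S S0 HS] := @fin_ub R _ (fun j (S : R) => forall s, 0 <= s <= len G j ->
      normc (phi (gam j s) * gam j s ^+ a) <= S).
  - move=> j; have cn : {within `[0, len G j],
        continuous (fun s => normc (phi (gam j s) * gam j s ^+ a))}.
      apply: continuous_subspaceT.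
      by apply: (continuous_normc (f := fun s => phi (gam j s) * gam j s ^+ a)); exact: cpa.
    have [c _ Hc] := EVT_max (ltW (len_gt0 j)) cn.
    exists (normc (phi (gam j c) * gam j c ^+ a)); first exact: nc_ge0.
    by move=> s sL; apply: Hc; rewrite in_itv.
  - by move=> j C1 C2 C12 H s sL; exact: le_trans (H s sL) C12.
  exists S => // t /(Gam_param G)[j [s <-]].
  have [s0 /andP[h1 h2] [<- _]] := curve_reduce j s.
  by apply: HS; rewrite h1 ltW.
exists (Co * (S * (C * D ^+ 2))); first by rewrite !mulr_ge0 ?exprn_ge0.
exists (d / (2 * (D + 1))); first by rewrite divr_gt0// mulr_gt0//; lra.
move=> v vd.
have nv0 := nv_ge0 v.
have ql t : Gam t -> normc (qlin v t) <= d / 2.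
  move=> Gt; apply: le_trans (HD v t Gt) _.
  apply: (@le_trans _ _ ((D + 1) * (d / (2 * (D + 1))))).
    by apply: ler_pM => //; lra.
  rewrite le_eqVlt; apply/orP; left; apply/eqP; field; rewrite gt_eqF//; lra.
have rvz : regular (v + z).
  move=> t Gt; rewrite qD -nc_gt0.
  have := nc_rtri (q z t) (- qlin v t); rewrite opprK ncN.
  have := Hd t Gt; have := ql t Gt; lra.
split => //.
have cf k : contG G (fun t => phi t * t ^+ k * q z t ^- r.+1).
  by apply: contGM => //; exact: contG_invq.
have ci : contG G (fun t => phi t * t ^+ a * (qlin v t * q z t ^- r.+1)).
  by apply: contGM => //; apply: contGM; [exact: contG_qlin|exact: contG_invq].
have rowE : rowform (fun i : 'I_n => - r%:R * (-1) ^+ i.+1 * qint phi (a + (n - i.+1)) r.+1 z) v =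
    - r%:R * oint G (fun t => phi t * t ^+ a * (qlin v t * q z t ^- r.+1)).
  rewrite /rowform -ointZ//; transitivity (oint G (fun t => \sum_(i < n)
      (v 0 i * (- r%:R * (-1) ^+ i.+1)) * (phi t * t ^+ (a + (n - i.+1)) * q z t ^- r.+1))).
    rewrite oint_sum; last by move=> i; apply: contGM => //; exact: contG_cst.
    by apply: eq_bigr => i _; rewrite ointZ// mulrA.
  apply: eq_oint => t _; rewrite /qlin mulr_suml !mulr_sumr; apply: eq_bigr => i _.
  by rewrite exprD; ring.
have cr w : regular w -> contG G (fun t => phi t * t ^+ a * q w t ^- r).
  by move=> rw; apply: contGM => //; exact: contG_invq.
rewrite rowE mulNr opprK -ointZ// /qint -ointB//; [|exact: cr|exact: cr].
rewrite -ointD//; last 2 first.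
- by apply: contGB; exact: cr.
- by apply: contGM => //; exact: contG_cst.
have -> : Co * (S * (C * D ^+ 2)) * nv v ^+ 2 = Co * (S * (C * (D * nv v) ^+ 2)).
  by rewrite exprMn; ring.
apply: HCo.
  apply: contGD; first by apply: contGB; exact: cr.
  by apply: contGM => //; exact: contG_cst.
move=> t Gt; rewrite qD.
rewrite (_ : _ + _ = phi t * t ^+ a *
   ((q z t + qlin v t) ^- r - q z t ^- r + r%:R * qlin v t * q z t ^- r.+1)); last by ring.
rewrite ncM; apply: ler_pM; rewrite ?nc_ge0//; first exact: HS.
apply: le_trans (HC _ _ (Hd t Gt) (ql t Gt)) _; rewrite ler_wpM2l//.
by rewrite lerXn2r ?nnegrE ?nc_ge0 ?mulr_ge0//; exact: HD.
Qed.

Lemma qint_diff phi a r (k : R[i]) Phi z : contG G phi ->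
  (forall w, regular w -> Phi w = k * qint phi a r w) -> regular z ->
  differentiable Phi z /\ forall i, partial i Phi z =
    k * (- r%:R * (-1) ^+ i.+1) * qint phi (a + (n - i.+1)) r.+1 z.
Proof.
move=> cphi HPhi rz.
have [c [cE [C C0 [d d0 Hd]]]] := qint_expand a r cphi rz.
pose c' i := k * c i.
have lin : Phi \o shift z = cst (Phi z) + rowform c' +o_ (0 : 'rV[R[i]]_n) id.
  apply/eqaddoP => e e0.
  have [er er0 eE] : exists2 er : R, 0 < er & e = er%:C.
    move: e0; case: e => x y; rewrite ltcE /= => /andP[/eqP -> x0].
    by exists x.
  pose d' := Num.min d (er / (normc k * C + 1)).
  have K0 : 0 < normc k * C + 1 by rewrite ltr_pwDr// mulr_ge0 ?nc_ge0.
  have d'0 : 0 < d' by rewrite lt_min d0 divr_gt0.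
  suff : \forall v \near (0 : 'rV[R[i]]_n),
      `|(Phi \o shift z - (cst (Phi z) + rowform c')) v| <= e * `|v| by [].
  apply/nbhs_normP; exists d'%:C; first by rewrite /= ltcR.
  move=> v; rewrite /ball_ /= sub0r normrN -nvE ltcR lt_min => /andP[vd ve].
  have nv0 := nv_ge0 v.
  have [rv Hv] := Hd v (ltW vd).
  rewrite eE -ncE -rmorphM lecR.
  rewrite [X in normc X](_ : _ = k * (qint phi a r (v + z) - qint phi a r z - rowform c v)).
    rewrite ncM; apply: le_trans (ler_wpM2l (nc_ge0 _) Hv) _.
    rewrite expr2 !mulrA ler_wpM2r//.
    apply: (@le_trans _ _ ((normc k * C + 1) * nv v)); first by rewrite ler_wpM2r// lerDl.
    by rewrite mulrC -ler_pdivlMr// ltW.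
  rewrite /= !fctE /= HPhi// HPhi// mulrBr mulrBr opprD addrA; congr (_ - _).
  by rewrite /rowform mulr_sumr; apply: eq_bigr => i _; rewrite /c' mulrCA.
have E := diff_unique (rowform_continuous (c := c')) lin.
have dP : differentiable Phi z.
  by apply/diff_locallyP; rewrite E; split => //; exact: rowform_continuous.
split => // i; rewrite /partial deriveE// E -[LHS]/(rowform c' (delta_mx 0 i)) rowform_delta /c' cE.
by rewrite !mulrA.
Qed.

Lemma qint_partials i p a r (k : R[i]) : exists (k' : R[i]) a', forall phi Phi, contG G phi ->
  (forall w, regular w -> Phi w = k * qint phi a r w) ->
  forall w, regular w -> iter p (partial i) Phi w = k' * qint phi a' (r + p) w.
Proof.
elim: p => [|p [k' [a' IH]]].
  by exists k, a => phi Phi cphi H w rw; rewrite addn0 /= H.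
exists (k' * (- (r + p)%:R * (-1) ^+ i.+1)), (a' + (n - i.+1))%N => phi Phi cphi H w rw.
rewrite iterS; have [_ ->] := qint_diff cphi (IH phi Phi cphi H) rw.
by rewrite addnS.
Qed.

(** The entry [z 0 i] enters [q z t] linearly, with the coefficient
    [(-1) ^+ i.+1 * t ^+ (n - i.+1)], so that every differentiation raises the power
    of [q] by one and multiplies [phi] by a power of [t]. *)
Lemma mpartial_qint (k0 : R[i]) (g : 'I_n -> nat) : exists (k : R[i]) a, forall phi Phi,
  contG G phi -> (forall w, regular w -> Phi w = k0 * qint phi 0 1 w) ->
  forall w, regular w -> mpartial g Phi w = k * qint phi a (\sum_(i < n) g i).+1 w.
Proof.
rewrite /mpartial -big_enum /=; elim: (enum 'I_n) => [|i s [k [a IH]]].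
  exists k0, 0%N => phi Phi cphi H w rw; rewrite big_nil /=; exact: H.
have [k' [a' H']] := qint_partials i (g i) a (\sum_(j <- s) g j).+1 k.
exists k', a' => phi Phi cphi H w rw /=.
by rewrite big_cons addnC -addSn; apply: H' => // w' rw'; exact: IH.
Qed.

End CauchyDerivatives.

(** * The theorem *)

Section Repetition.
Variable R : realType.
Implicit Types (X Y : seq R[i]) (d : R).

Lemma nodes_close_cat d X Y X' Y' : nodes_close d X Y -> nodes_close d X' Y' ->
  nodes_close d (X ++ X') (Y ++ Y').
Proof.
by move=> + XY'; elim: X Y => [|x X IH] [|y Y] //= /andP[-> /IH].
Qed.

(** Powers of [q] in the denominator correspond to repeated nodes. *)
Definition multi r X := flatten (nseq r X).

Lemma size_multi r X : size (multi r X) = (r * size X)%N.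
Proof. by elim: r => [//|r IH]; rewrite /multi /= size_cat IH mulSn. Qed.

Lemma multi_in r X (P : R[i] -> Prop) : {in X, forall x, P x} -> {in multi r X, forall x, P x}.
Proof. by move=> XP x /flattenP[Y /nseqP[-> _]]; exact: XP. Qed.

Lemma nodes_close_multi r d X Y : nodes_close d X Y -> nodes_close d (multi r X) (multi r Y).
Proof. by move=> XY; elim: r => [//|r IH]; exact: nodes_close_cat. Qed.

Lemma perm_multi r X Y : perm_eq X Y -> perm_eq (multi r X) (multi r Y).
Proof. by move=> XY; elim: r => [//|r IH]; exact: perm_cat. Qed.

Lemma nodes_multi r X t : nodes (multi r X) t = nodes X t ^+ r.
Proof.
elim: r => [|r IH]; first by rewrite /nodes big_nil.
by rewrite exprS -IH /nodes /multi /= big_cat.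
Qed.

End Repetition.

Section Bounds.
Variables (R : realType) (U : set R[i]) (l n k : nat) (G : smooth_boundary U l) (alpha : R).
Hypotheses (n0 : (0 < n)%N) (U_nonempty : U !=set0) (U_open : open U).
Hypotheses (U_connected : connected U) (U_bounded : bounded_set U).
Local Notation m := ((k + 1) * n - 1)%N.
Hypotheses (ml : (m.+2 <= l)%N) (halpha : 0 < alpha < 1).
Implicit Types (z w x y : 'rV[R[i]]_n) (t : R[i]) (phi : R[i] -> R[i]) (A : R) (a r : nat).

Local Notation gam := (curve G).
Local Notation Gam := (closure U `\` interior U).
Local Notation Omega := (sym_product (n := n) U).

Let l2 : (2 <= l)%N. Proof. exact: leq_trans ml. Qed.

Lemma Omega_regular z : Omega z -> regular U z.
Proof.
move=> [x xU <-] t Gt; rewrite q_symmetrization; apply: (nodes_neq0 U_open) Gt.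
exact: coordsP.
Qed.

Lemma qint_multi_cauchy phi a r x : (forall i, U (x 0 i)) ->
  qint G phi a r (symmetrization x) = multi_cauchy G (fun t => phi t * t ^+ a) (multi r (coords x)).
Proof.
by move=> xU; apply: eq_oint => t Gt; rewrite q_symmetrization nodes_multi.
Qed.

Lemma hold_mulX a (p : nat) : (p <= m)%N -> exists2 C : R, 0 <= C & forall phi A, 0 <= A ->
  (forall j, hold alpha 1 m (fun s => phi (gam j s)) A) ->
  forall j, hold alpha 1 p (fun s => phi (gam j s) * gam j s ^+ a) (C * A).
Proof.
move=> pm; have [C1 C10 H1] := hold_le halpha ltr01 pm.
have [C2 C20 H2] := holdM halpha ltr01 p.
have [||B B0 HB] := @fin_ub R _ (fun (j : 'I_(ncurves G)) B => hold alpha 1 p (fun s => gam j s ^+ a) B).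
- move=> j; have [A [HA _]] := hold_dgam halpha ml j.
  have [C3 _ H3] := hold_le halpha ltr01 (leq_trans pm (leqnSn m)).
  have [B HB] := hold_exp halpha ltr01 a (H3 _ _ HA).
  by exists B => //; exact: hold_ge0 HB.
- by move=> j C C' CC'; exact: hold_mono.
exists (C2 * (C1 * B)); first by rewrite !mulr_ge0.
move=> phi A A0 hphi j; have := H2 _ _ _ _ (H1 _ _ (hphi j)) (HB j).
by congr (hold _ _ _ _ _); ring.
Qed.

(** For coefficients at distance at most one, match the roots and move each of the
    [r * n] poles by a multiple of [d `^ (n`!%:R)^-1]; otherwise boundedness
    suffices. *)
Lemma qint_bounds a r (beta : R) : (0 < r <= k.+1)%N -> 0 <= beta -> beta <= alpha / n`!%:R ->
  exists2 C : R, 0 <= C & forall phi A, 0 <= A -> contG G phi ->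
  (forall j, hold alpha 1 m (fun s => phi (gam j s)) A) ->
  (forall z, Omega z -> normc (qint G phi a r z) <= C * A) /\
  (forall z w, Omega z -> Omega w -> 0 < euclidean_dist z w ->
     normc (qint G phi a r z - qint G phi a r w) <= C * A * euclidean_dist z w `^ beta).
Proof.
move=> /andP[r0 rk] b0 ba; have [a0 a1] := andP halpha.
pose p := (r * n).-1.
have pE : p.+1 = (r * n)%N by rewrite prednK// muln_gt0 r0.
have pm : (p <= m)%N.
  by rewrite -ltnS pE subn1 prednK ?muln_gt0 ?addn1// leq_mul2r rk orbT.
have pl : (p.+2 <= l)%N by apply: leq_trans ml; rewrite !ltnS.
have [C1 C10 H1] := hold_mulX a pm.
have [C2 C20 H2] := multi_cauchy_holder G U_nonempty U_open U_connected U_bounded pl halpha.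
have [S S0 HS] := bounded_nc U_bounded.
have [D D0 HD] := coords_close n S0.
pose E := 2 * (C2 * C1) + C2 * C1 * D `^ alpha.
have CC0 : 0 <= C2 * C1 by exact: mulr_ge0.
have CD0 : 0 <= C2 * C1 * D `^ alpha by rewrite mulr_ge0// powR_ge0.
exists E; first by rewrite /E addr_ge0// mulr_ge0.
move=> phi A A0 cphi hphi.
have cpa : contG G (fun t => phi t * t ^+ a).
  by apply: contGM => //; apply: contGX; exact: contG_id.
have CA0 : 0 <= C1 * A by exact: mulr_ge0.
have [Hol Bd] := H2 _ _ CA0 cpa (H1 phi A A0 hphi).
have sz x : size (multi r (coords x)) = p.+1 by rewrite size_multi size_coords pE.
have inU x : (forall i, U (x 0 i)) -> {in multi r (coords x), forall t, U t}.
  by move=> xU; apply: multi_in; exact: coordsP.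
have bd z : Omega z -> normc (qint G phi a r z) <= C2 * C1 * A.
  move=> [x xU <-]; rewrite qint_multi_cauchy// -mulrA; apply: Bd; first exact: sz.
  exact: inU.
split.
  move=> z Oz; apply: le_trans (bd z Oz) _; rewrite ler_wpM2r// /E; lra.
move=> z w Oz Ow; set d := euclidean_dist z w => d0.
have EA : E * A * d `^ beta = 2 * (C2 * C1 * A) * d `^ beta + C2 * C1 * D `^ alpha * A * d `^ beta.
  by rewrite /E; ring.
have P1 : 0 <= 2 * (C2 * C1 * A) * d `^ beta by rewrite !mulr_ge0 ?powR_ge0.
have P2 : 0 <= C2 * C1 * D `^ alpha * A * d `^ beta by rewrite !mulr_ge0 ?powR_ge0.
have [d1|d1] := leP d 1; last first.
  apply: le_trans (ncB _ _) _; have := bd z Oz; have := bd w Ow => h1 h2.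
  have : 2 * (C2 * C1 * A) * 1 <= 2 * (C2 * C1 * A) * d `^ beta.
    rewrite ler_wpM2l ?mulr_ge0//.
    suff : 1 `^ beta <= d `^ beta by rewrite powR1.
    by apply: ge0_ler_powR; rewrite ?nnegrE// ltW.
  rewrite mulr1 => h3; apply: le_trans (lerD h2 h1) _.
  have -> : C2 * C1 * A + C2 * C1 * A = 2 * (C2 * C1 * A) by ring.
  by rewrite EA; apply: le_trans h3 _; rewrite lerDl.
move: Oz Ow => [x xU xz] [y yU yw].
have [|||Y pY cY] := HD x y.
- by move=> i; apply: HS.
- by move=> i; apply: HS.
- by rewrite xz yw.
rewrite xz yw -/d in cY.
have e0 : 0 <= D * d `^ (n`!%:R)^-1 by rewrite mulr_ge0 ?powR_ge0.
rewrite -xz -yw !qint_multi_cauchy// (multi_cauchy_perm _ _ (perm_multi r pY)).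
have YU : {in multi r Y, forall t, U t}.
  by apply: multi_in => t; rewrite -(perm_mem pY); exact: coordsP.
apply: le_trans (Hol _ _ _ (sz x) (inU x xU) YU e0 (nodes_close_multi r cY)) _.
rewrite EA powRM ?powR_ge0// -powRrM.
apply: (@le_trans _ _ (C2 * C1 * D `^ alpha * A * d `^ beta)); last by rewrite lerDr.
rewrite [leLHS](_ : _ = C2 * C1 * D `^ alpha * A * d `^ ((n`!%:R)^-1 * alpha)); last by ring.
rewrite ler_wpM2l ?mulr_ge0 ?powR_ge0//.
by apply: ger_powR; rewrite ?d0// mulrC.
Qed.

Lemma sup_norm_ge0 (T : Type) (D : set T) (psi : T -> R[i]) : D !=set0 -> (0 <= sup_norm D psi)%E.
Proof.
move=> [p Dp]; apply: (@le_trans _ _ (normc (psi p))%:E); first by rewrite lee_fin nc_ge0.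
by apply: ereal_sup_ubound; exists p.
Qed.

Lemma sum_ge_term (I : finType) (f : I -> \bar R) i : (forall j, 0 <= f j)%E ->
  (f i <= \sum_j f j)%E.
Proof.
by move=> f0; rewrite (bigD1 i)//= leeDl// sume_ge0.
Qed.

(** The seminorm on the boundary is relative to the distance in the plane, which is
    at most twice the arc length. *)
Lemma hold_bnorm phi A : 0 <= A -> (forall j, Cm m (fun s => phi (gam j s))) ->
  (bnorm G m alpha phi <= A%:E)%E -> forall j, hold alpha 1 m (fun s => phi (gam j s)) (2 * A).
Proof.
move=> A0 Cphi bA j; have [a0 a1] := andP halpha.
have L0 := len_gt0 j.
have ne : [set: 'I_(ncurves G) * R] !=set0 by exists (j, 0).
have s0 (i : nat) : (0 <= sup_norm setT (arc_derive (G := G) i phi))%E by exact: sup_norm_ge0.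
have h0 : (0 <= holder_seminorm (@bdist R U l G) setT alpha (arc_derive (G := G) m phi))%E.
  have dpos : 0 < bdist (G := G) (j, 0) (j, len G j / 2).
    rewrite /bdist /bpoint /= nc_gt0 subr_eq0; apply/eqP => E.
    have H1 : 0 <= (0 : R) < len G j by rewrite lexx.
    have H2 : 0 <= len G j / 2 < len G j by apply/andP; split; lra.
    have [_] := curve_inj H1 H2 E; lra.
  apply: (@le_trans _ _ (normc (arc_derive (G := G) m phi (j, 0) - arc_derive (G := G) m phi (j, len G j / 2)) /
      bdist (G := G) (j, 0) (j, len G j / 2) `^ alpha)%:E).
    by rewrite lee_fin divr_ge0 ?nc_ge0 ?powR_ge0.
  by apply: ereal_sup_ubound; exists ((j, 0), (j, len G j / 2)).
have supA (i : nat) : (i <= m)%N -> (sup_norm setT (arc_derive (G := G) i phi) <= A%:E)%E.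
  move=> im; apply: le_trans bA; apply: (@le_trans _ _
     (\sum_(i < m.+1) sup_norm setT (arc_derive (G := G) i phi))%E); last by rewrite leeDl.
  rewrite -ltnS in im.
  exact: (@sum_ge_term _ (fun i : 'I_m.+1 => sup_norm setT (arc_derive (G := G) i phi)) (Ordinal im)).
have holA : (holder_seminorm (@bdist R U l G) setT alpha (arc_derive (G := G) m phi) <= A%:E)%E.
  by apply: le_trans bA; rewrite leeDr// sume_ge0.
apply: hold_nderive => //.
  move=> i s im; apply: (@le_trans _ _ A); last by lra.
  rewrite -lee_fin; apply: le_trans (supA i im).
  by apply: ereal_sup_ubound; exists (j, s).
move=> s s' ss'; have [E|ne0] := eqVneq (gam j s) (gam j s').
  have -> : nderive m (fun s => phi (gam j s)) s = nderive m (fun s => phi (gam j s)) s'.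
    have [u1 Hu1 [E1 [k1 k1E]]] := curve_reduce j s.
    have [u2 Hu2 [E2 [k2 k2E]]] := curve_reduce j s'.
    have [_ uu] := curve_inj Hu1 Hu2 (etrans E1 (etrans E (esym E2))).
    have per (u : R) : nderive m (fun s => phi (gam j s)) (u + len G j) =
        nderive m (fun s => phi (gam j s)) u.
      apply: (nderive_periodic (Cphi j) (leqnn m)) => v; by rewrite curve_periodic.
    have back (u v : R) (kk : int) : u = v - len G j *~ kk ->
        nderive m (fun s => phi (gam j s)) v = nderive m (fun s => phi (gam j s)) u.
      by move=> ->; rewrite -mulrNz (periodic_int per).
    by rewrite (back _ _ _ k1E) (back _ _ _ k2E) uu.
  by rewrite subrr nc0 !mulr_ge0 ?powR_ge0.
have d0 : 0 < normc (gam j s - gam j s') by rewrite nc_gt0 subr_eq0.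
have H : normc (nderive m (fun s => phi (gam j s)) s - nderive m (fun s => phi (gam j s)) s') /
    normc (gam j s - gam j s') `^ alpha <= A.
  rewrite -lee_fin; apply: le_trans holA.
  by apply: ereal_sup_ubound; exists ((j, s), (j, s')).
rewrite ler_pdivrMr ?powR_gt0// in H; apply: le_trans H _.
rewrite mulrAC mulrC ler_wpM2r//.
by apply: (powR_le_scale halpha) => //; rewrite ?nc_ge0//; [lra|exact: gam_lip].
Qed.

(** The function [Phi] is prescribed up to equality on the regular points only, so
    that the bound applies to a difference of two transforms as well. *)
Lemma hnorm_bound (beta : R) (k0 : R[i]) : 0 <= beta -> beta <= alpha / n`!%:R ->
  exists2 C : R, 0 <= C & forall phi A Phi, 0 <= A ->
  (forall j, Cm m (fun s => phi (gam j s))) -> (bnorm G m alpha phi <= A%:E)%E ->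
  (forall w, regular U w -> Phi w = k0 * qint G phi 0 1 w) ->
  (hnorm Omega k beta Phi <= (C * A)%:E)%E.
Proof.
move=> b0 ba.
pose P (g : {ffun 'I_n -> 'I_k.+1}) (C : R) := (\sum_(i < n) g i <= k)%N ->
  forall phi A Phi, 0 <= A -> contG G phi ->
  (forall j, hold alpha 1 m (fun s => phi (gam j s)) A) ->
  (forall w, regular U w -> Phi w = k0 * qint G phi 0 1 w) ->
  (sup_norm Omega (mpartial (fun i => g i) Phi) <= (C * A)%:E)%E /\
  (holder_seminorm (@euclidean_dist R n) Omega beta (mpartial (fun i => g i) Phi) <= (C * A)%:E)%E.
have [||C C0 HC] := @fin_ub R _ P.
- move=> g; rewrite /P; have [gk|gk] := leqP (\sum_(i < n) g i) k; last by exists 0.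
  have [c [a Hg]] := mpartial_qint G l2 k0 (fun i => g i).
  have rk : (0 < (\sum_(i < n) g i).+1 <= k.+1)%N by [].
  have [C C0 HC] := qint_bounds a rk b0 ba.
  exists (normc c * C); first by rewrite mulr_ge0 ?nc_ge0.
  move=> _ phi A Phi A0 cphi hphi HPhi.
  have [Hb Hh] := HC phi A A0 cphi hphi.
  have E w : Omega w -> mpartial (fun i => g i) Phi w = c * qint G phi a (\sum_(i < n) g i).+1 w.
    by move=> Ow; apply: Hg => //; exact: Omega_regular.
  split; apply: ub_ereal_sup => _ [z Oz <-]; rewrite lee_fin.
    by rewrite E// ncM -mulrA ler_wpM2l ?nc_ge0//; exact: Hb.
  have [Oz1 Oz2 d0] := Oz.
  rewrite ler_pdivrMr ?powR_gt0// !E// -mulrBr ncM -mulrA -mulrA ler_wpM2l ?nc_ge0//.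
  by rewrite mulrA; exact: Hh.
- move=> g C C' CC' H gk phi A Phi A0 cphi hphi HPhi.
  have [h1 h2] := H gk phi A Phi A0 cphi hphi HPhi.
  by split; [apply: le_trans h1 _|apply: le_trans h2 _]; rewrite lee_fin ler_wpM2r.
pose N := #|{ffun 'I_n -> 'I_k.+1}|.
exists (N%:R * (C * 2) + N%:R * (C * 2)); first by rewrite addr_ge0 ?mulr_ge0.
move=> phi A Phi A0 Cphi bA HPhi.
have hphi := hold_bnorm A0 Cphi bA.
have cphi : contG G phi by move=> j; exact: ccont_Cm (Cphi j).
have A20 : 0 <= 2 * A by rewrite mulr_ge0.
have CA0 : 0 <= C * (2 * A) by rewrite mulr_ge0.
have half (Q : pred {ffun 'I_n -> 'I_k.+1}) (f : {ffun 'I_n -> 'I_k.+1} -> \bar R) :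
    (forall g, Q g -> f g <= (C * (2 * A))%:E)%E ->
    (\sum_(g | Q g) f g <= (N%:R * (C * (2 * A)))%:E)%E.
  move=> Hf; apply: le_trans (lee_sum _ Hf) _.
  rewrite sumEFin lee_fin sumr_const -[leLHS]mulr_natl ler_wpM2r// ler_nat.
  exact: max_card.
rewrite (_ : _ * A = N%:R * (C * (2 * A)) + N%:R * (C * (2 * A))); last by ring.
rewrite EFinD; apply: leeD; apply: half => g gk.
  by have [] := HC g gk phi (2 * A) Phi A20 cphi hphi HPhi.
have gk' : (\sum_(i < n) g i <= k)%N by rewrite (eqP gk).
by have [] := HC g gk' phi (2 * A) Phi A20 cphi hphi HPhi.
Qed.

Lemma sym_cauchy_qint phi z : sym_cauchy (n := n) G phi z =
  ((2 * pi)%:C * 'i%C)^-1 * qint G phi 0 1 z.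
Proof.
by congr (_ * _); apply: eq_bigr => j _; apply: eq_cintegral => s; rewrite expr0 mulr1 expr1.
Qed.

Lemma Cm_realB (p : nat) (u v : R -> R) : Cm_real p u -> Cm_real p v ->
  Cm_real p (fun s => u s - v s).
Proof.
move=> [du cu] [dv cv].
have E i : (i <= p)%N -> ((fun s => u s - v s)^`(i))%classic =
    (fun s => (u^`(i))%classic s - (v^`(i))%classic s).
  elim: i => [//|i IH] ip; rewrite !derive1nS IH ?(ltnW ip)//; apply/funext => s.
  have -> : (fun s => (u^`(i))%classic s - (v^`(i))%classic s) = (u^`(i))%classic - (v^`(i))%classic.
    by [].
  by rewrite !derive1E deriveB//; [exact: du|exact: dv].
split.
  by move=> i ip s; rewrite E ?(ltnW ip)//; apply: derivableB; [exact: du|exact: dv].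
by rewrite E// => s; apply: cvgB; [exact: cu|exact: cv].
Qed.

Lemma CmB (p : nat) (f g : R -> R[i]) : Cm p f -> Cm p g -> Cm p (fun s => f s - g s).
Proof.
move=> [fr fi] [gr gi]; split.
  rewrite (_ : (fun s => _) = (fun s => complex.Re (f s) - complex.Re (g s))).
    exact: Cm_realB.
  by apply/funext => s; rewrite ReD ReN.
rewrite (_ : (fun s => _) = (fun s => complex.Im (f s) - complex.Im (g s))).
  exact: Cm_realB.
by apply/funext => s; rewrite ImD ImN.
Qed.

Lemma sym_cauchy_continuous (beta : R) : 0 <= beta -> beta <= alpha / n`!%:R ->
  continuous_between (bspace G m alpha) (bnorm G m alpha)
    (hspace Omega k beta) (hnorm Omega k beta) (sym_cauchy (n := n) G).
Proof.
move=> b0 ba; set k0 := ((2 * pi)%:C * 'i%C)^-1 : R[i].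
have [C C0 HC] := hnorm_bound k0 b0 ba.
have contC phi : (forall j, Cm m (fun s => phi (gam j s))) -> contG G phi.
  by move=> Cphi j; exact: ccont_Cm (Cphi j).
split.
  move=> phi [Cphi bphi]; split.
    move=> z Oz; have [] := qint_diff l2 (a := 0) (r := 1) (k := k0)
      (Phi := sym_cauchy G phi) (contC phi Cphi) _ (Omega_regular Oz) => //.
    by move=> w _; exact: sym_cauchy_qint.
  have [A A0 bA] : exists2 A : R, 0 <= A & (bnorm G m alpha phi <= A%:E)%E.
    case: (bnorm G m alpha phi) bphi => [r _|//|_].
      by exists (Num.max 0 r); rewrite ?lee_fin ?le_max ?lexx ?orbT.
    by exists 0; rewrite ?leNye.
  apply: le_lt_trans (HC phi A _ A0 Cphi bA _) (ltry _).
  by move=> w _; exact: sym_cauchy_qint.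
move=> phi [Cphi bphi] e e0.
have C1 : 0 < C + 1 by lra.
exists (e / (C + 1)); first by rewrite divr_gt0.
move=> psi [Cpsi bpsi] bd.
have d0 : 0 <= e / (C + 1) by rewrite divr_ge0// ltW.
have Cd j : Cm m (fun s => (psi \- phi)%R (gam j s)) by exact: CmB.
apply: le_lt_trans (HC (psi \- phi)%R (e / (C + 1)) _ d0 Cd (ltW bd) _) _.
  move=> w rw; rewrite /= !sym_cauchy_qint -mulrBr; congr (_ * _).
  have cr f : (forall j, Cm m (fun s => f (gam j s))) ->
      contG G (fun t => f t * t ^+ 0 * q w t ^- 1).
    move=> Cf; apply: contGM; last exact: contG_invq.
    by apply: contGM; [exact: contC|apply: contGX; exact: contG_id].
  rewrite /qint -ointB; [|exact: l2|exact: cr|exact: cr].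
  by apply: eq_oint => t _; rewrite /= !mulrBl.
rewrite lte_fin mulrA ltr_pdivrMr// mulrC ltr_pM2l//; lra.
Qed.

End Bounds.

Lemma factorial_le_Lambda (R : realType) n : n`!%:R <= Lambda R n.
Proof.
rewrite /Lambda; case: ifP => // _.
by rewrite ler_peMl//; lra.
Qed.

Theorem theorem1p2 (R : realType) (k n : nat) (hn : (1 <= n)%N)
  (U : set R[i]) (U_nonempty : U !=set0) (U_open : open U)
  (U_connected : connected U) (U_bounded : bounded_set U)
  (G : smooth_boundary U (n * k + n + 1))
  (alpha : R) (halpha : 0 < alpha < 1) :
  let m := ((k + 1) * n - 1)%N in
  let beta := alpha / Lambda R n in
  let Omega := sym_product (n := n) U in
  continuous_between
    (bspace G m alpha) (bnorm G m alpha)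
    (hspace Omega k beta) (hnorm Omega k beta)
    (sym_cauchy (n := n) G).
Proof.
have [a0 a1] := andP halpha.
have f0 : 0 < n`!%:R :> R by rewrite ltr0n fact_gt0.
have L0 : 0 < Lambda R n := lt_le_trans f0 (factorial_le_Lambda R n).
have ml : (((k + 1) * n - 1).+2 <= n * k + n + 1)%N.
  by rewrite subn1 prednK ?muln_gt0 ?addn1// mulSn mulnC addnC.
move=> m beta Omega; apply: sym_cauchy_continuous => //.
  by rewrite divr_ge0// ltW.
by rewrite ler_wpM2l ?(ltW a0)// lef_pV2 ?posrE//; exact: factorial_le_Lambda.
Qed.
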